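(* Let $b$ be a two-dimensional vector field in $C^1_\sharp(Y_2)^2$ such that $b=\rho\,\Phi$, where $\rho\in C^1_\sharp(Y_2)$ is a non negative function which is not identically zero, and $$\Phi=a\,R_\perp\nabla u\quad\text{in }Y_2,$$ where $a$ is a positive function in $C^1_\sharp(Y_2)$, $\nabla u$ is a non vanishing gradient field in $C^1_\sharp(Y_2)^2$ and $R_\perp$ is the $-\pi/2$ rotation matrix of $\mathbb{R}^{2\times2}$. Also assume that $$\forall\,\kappa\in\mathbb{Z}^2\setminus\{0_{\mathbb{R}^2}\},\quad\left(\int_{Y_2}\nabla u(y)\,dy\right)\cdot\kappa\neq0.$$ Let $X$ be the flow associated with $b$ and let $\underline{a\rho}$ be the harmonic mean of the function $a\rho$. Then: - If $\rho$ is positive in $Y_2$, then $$\forall\,x\in Y_2,\quad\lim_{t\to\infty}\frac{X(t,x)}{t}=\underline{a\rho}\int_{Y_2}R_\perp\nabla u(y)\,dy.$$ - If $\rho$ vanishes in $Y_2$ (at some point) and $\underline{a\rho}=0$, then $$\forall\,x\in Y_2,\quad\lim_{t\to\infty}\frac{X(t,x)}{t}=0_{\mathbb{R}^2}.$$ - If $\rho$ vanishes in $Y_2$ (at some point) and $\underline{a\rho}>0$, then $$\mathsf{C}_b=[0_{\mathbb{R}^2},\zeta]\quad\text{with}\quad\zeta:=\underline{a\rho}\int_{Y_2}R_\perp\nabla u(y)\,dy\neq0_{\mathbb{R}^2}.$$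
   Context: $Y_2=\mathbb{R}^2/\mathbb{Z}^2$ is the two-dimensional torus, identified with $[0,1)^2$. $C^k_\sharp(Y_2)$ is the space of real-valued $\mathbb{Z}^2$-periodic functions in $C^k(\mathbb{R}^2)$. Here $u$ is a function on $\mathbb{R}^2$ whose gradient is $\mathbb{Z}^2$-periodic ($u$ itself need not be periodic). The matrix $R_\perp$ is $\begin{pmatrix}0&1\\-1&0\end{pmatrix}$. For a non negative $f\in L^1_\sharp(Y_2)$ (periodic, integrable on $Y_2$), the harmonic mean is $\underline{f}:=\left(\int_{Y_2}\frac{dy}{f(y)}\right)^{-1}$, with value $0$ when the integral is $+\infty$. For $b\in C^1_\sharp(Y_2)^2$, the flow $X:\mathbb{R}\times\mathbb{R}^2\to\mathbb{R}^2$ associated with $b$ is the solution of $\partial_t X(t,x)=b(X(t,x))$, $t\in\mathbb{R}$, $X(0,x)=x$; it satisfies $X(t,x+\kappa)=X(t,x)+\kappa$ for $\kappa\in\mathbb{Z}^2$, so it induces a flow on $Y_2$. A probability measure $\mu$ on $Y_2$ is invariant for the flow $X$ if $\int_{Y_2}\psi(X(t,y))\,d\mu(y)=\int_{Y_2}\psi(y)\,d\mu(y)$ for all $t\in\mathbb{R}$ and $\psi\in C^0_\sharp(Y_2)$; $\mathscr{I}_b$ denotes the set of these invariant probability measures. The (Herman) rotation set is $\mathsf{C}_b:=\left\{\int_{Y_2}b(y)\,d\mu(y):\mu\in\mathscr{I}_b\right\}\subset\mathbb{R}^2$. $[0_{\mathbb{R}^2},\zeta]$ is the closed line segment. *)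

(* Defs.v *)
From HB Require Import structures.
From mathcomp Require Import all_boot all_order all_algebra.
From mathcomp Require Import all_classical all_reals all_analysis.

Set Implicit Arguments.
Unset Strict Implicit.
Unset Printing Implicit Defensive.
Import Order.TTheory GRing.Theory Num.Theory.
Import numFieldNormedType.Exports.

Local Open Scope classical_set_scope.
Local Open Scope ring_scope.

(* Points and vectors of the plane are pairs.  A function on the torus
   R^2/Z^2 is a Z^2-periodic function on the plane, and a Borel measure on the
   torus is a Borel measure on the plane carried by the unit square [0,1)^2. *)
Definition Y2 {R : realType} : set (R * R) := `[0, 1[ `*` `[0, 1[.

Definition intvec {R : realType} (k : int * int) : R * R := (k.1%:~R, k.2%:~R).

Definition dot {R : realType} (v w : R * R) : R := v.1 * w.1 + v.2 * w.2.

(* The matrix ((0, 1), (-1, 0)) acting on column vectors. *)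
Definition Rperp {R : realType} (v : R * R) : R * R := (v.2, - v.1).

Definition Z2periodic {R : realType} {T : Type} (f : R * R -> T) : Prop :=
  forall (y : R * R) (k : int * int), f (y + intvec k) = f y.

Definition C0sharp {R : realType} {V : normedModType R} (f : R * R -> V) : Prop :=
  Z2periodic f /\ continuous f.

Definition C1sharp {R : realType} {V : normedModType R} (f : R * R -> V) : Prop :=
  [/\ Z2periodic f,
      forall y, differentiable f y,
      continuous (fun y => 'D_((1, 0) : R * R) f y) &
      continuous (fun y => 'D_((0, 1) : R * R) f y)].

Definition grad {R : realType} (u : R * R -> R) (y : R * R) : R * R :=
  ('D_((1, 0) : R * R) u y, 'D_((0, 1) : R * R) u y).

(* The plane R * R with the Borel sigma-algebra on which lebesgue_measure is
   defined on each factor. *)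
Notation mplane R := (measurableTypeR R * measurableTypeR R)%type.

Definition leb2 {R : realType} : {measure set (mplane R) -> \bar R} :=
  (@lebesgue_measure R \x @lebesgue_measure R)%E.

Definition vint {R : realType} (mu : {measure set (mplane R) -> \bar R})
    (F : R * R -> R * R) : R * R :=
  (\int[mu]_(y in Y2) (F y).1, \int[mu]_(y in Y2) (F y).2).

(* Both inverses are taken in the extended reals, with 0^-1 = +oo and
   +oo^-1 = 0: the zeros of f count in the integral, and the mean is 0 when
   the integral is infinite. *)
Definition harmonic_mean_Y2 {R : realType} (f : R * R -> R) : R :=
  fine ((\int[leb2]_(y in Y2) ((f y)%:E)^-1)^-1)%E.

Definition is_flow {R : realType} (b : R * R -> R * R)
    (X : R -> R * R -> R * R) : Prop :=
  forall x : R * R, X 0 x = x /\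
    forall t : R, is_derive t (1 : R) (fun s : R => X s x) (b (X t x)).

Definition invariant_probability {R : realType} (X : R -> R * R -> R * R)
    (mu : probability (mplane R) R) : Prop :=
  mu Y2 = 1%E /\
  forall (t : R) (psi : R * R -> R), C0sharp psi ->
    \int[mu]_(y in Y2) psi (X t y) = \int[mu]_(y in Y2) psi y.

Definition rotation_set {R : realType} (b : R * R -> R * R)
    (X : R -> R * R -> R * R) : set (R * R) :=
  [set vint mu b | mu in [set mu : probability (mplane R) R |
                           invariant_probability X mu]].

Definition segment0 {R : realType} (z : R * R) : set (R * R) :=
  [set s *: z | s in `[0, 1]].

(* Main.v *)
Require Import Defs.
From HB Require Import structures.
From mathcomp Require Import all_boot all_order all_algebra.
From mathcomp Require Import all_classical all_reals all_analysis.
From mathcomp Require Import measurable_realfun.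
From mathcomp Require Import ring lra.
Import Order.TTheory GRing.Theory Num.Theory.
Import numFieldNormedType.Exports.
Local Open Scope classical_set_scope.
Local Open Scope ring_scope.

Set Implicit Arguments.
Unset Strict Implicit.
Unset Printing Implicit Defensive.

(** Write [w = a rho], so that [b = w R_perp grad u].  The function [u] is
    constant along the orbits of [b], and these orbits run inside the level
    lines of [u], the leaves.  The leaves are also the orbits of the field
    [R_perp grad u] (the leaf flow), and the proof rests on its unique
    ergodicity: every continuous periodic [F] has the same mean [mean2 F] along
    all leaves, uniformly in the starting point ([leaf_mean]).

    To see this, consider the transversal flow [T] of [grad u / |grad u|^2].
    Along it [u] grows at unit speed, so [T] maps leaves to leaves, and it
    stretches their parameter by an explicit factor [jac] ([jac_leaf]).  If
    [k] is an integer vector and [s] is the increment of [u] under translation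
    by [k], then [T] for time [s] maps every leaf to its translate by [k],
    moving each point by a bounded time of the leaf flow, since level sets of
    [u] are connected ([trans_by_period]).  As leaves are not closed curves
    ([leaf_injective]), the transport by [T s] is therefore a bounded shift of
    the parameter, and it changes integrals along leaves by bounded amounts
    only.  By the irrationality assumption [s] can be taken as small as
    desired ([small_period]), and differentiating at [s = 0] shows that the
    transversal divergences have zero mean along leaves.  So do derivatives
    along leaves, and the two together give all divergences of periodic C^1
    fields ([divergence_negligible]).  A continuous function minus its mean is
    uniformly close to such a divergence ([steklov]).

    An orbit of [b] is a leaf run at speed [w].  The leaf parameter [clock]
    elapsed at time [t] determines the displacement up to a sublinear error
    ([displacement]), and time itself is the integral of [1 / w] against the
    clock.  If [w] is positive, the clock grows at the rate given by the
    harmonic mean ([positive_limit]); if [1 / w] is not integrable, bounding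
    it from below by [1 / (w + 1/n)] shows that the clock is sublinear
    ([degenerate_limit]).

    If [mu] is an invariant probability measure, then unique ergodicity forces
    [w mu] to be a multiple [c] of Lebesgue measure ([invariant_mean]); testing
    this against [1 / (w + 1/n)] gives [c <= m], where [m] is the harmonic mean,
    so the rotation vector lies in the segment ([rotation_vector_segment]).
    Conversely [m / w] is an invariant probability density when [1 / w] is
    integrable, as the limit of the invariant densities of the flows with speed
    [w + 1/n] ([density_mean_flow]), and a zero of [rho] carries an invariant
    Dirac mass; their convex combinations realise every point of the segment
    ([rotation_vector_mixture]). *)

(** * Derivatives and antiderivatives on the line *)

Section calculus.
Context {R : realType}.
Implicit Types (f g h P Q : R -> R) (a b c t : R).

Lemma is_derive_ext f g t d :
  f =1 g -> is_derive t (1 : R) f d -> is_derive t (1 : R) g d.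
Proof. by move=> /funext ->. Qed.

Lemma derD f g t d e : is_derive t (1 : R) f d -> is_derive t (1 : R) g e ->
  is_derive t (1 : R) (fun s => f s + g s) (d + e).
Proof. by move=> ? ?; apply: is_deriveD. Qed.

Lemma derN f t d : is_derive t (1 : R) f d ->
  is_derive t (1 : R) (fun s => - f s) (- d).
Proof. by move=> ?; apply: is_deriveN. Qed.

Lemma derB f g t d e : is_derive t (1 : R) f d -> is_derive t (1 : R) g e ->
  is_derive t (1 : R) (fun s => f s - g s) (d - e).
Proof. by move=> ? ?; apply: is_deriveB. Qed.

Lemma derM f g t d e : is_derive t (1 : R) f d -> is_derive t (1 : R) g e ->
  is_derive t (1 : R) (fun s => f s * g s) (d * g t + f t * e).
Proof.
move=> ? ?; apply: (@is_derive_eq _ _ _ _ _ _ _ _ (is_deriveM _ _)).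
by rewrite addrC /GRing.scale /= (mulrC (g t)).
Qed.

Lemma derC c t : is_derive t (1 : R) (fun=> c) 0.
Proof. exact: is_derive_cst. Qed.

Lemma derI t : is_derive t (1 : R) (fun s => s) 1.
Proof. exact: is_derive_id. Qed.

Lemma derZ c f t d : is_derive t (1 : R) f d ->
  is_derive t (1 : R) (fun s => c * f s) (c * d).
Proof.
move=> fd; have := derM (derC c t) fd.
by rewrite mul0r add0r.
Qed.

Lemma derV f t d : f t != 0 -> is_derive t (1 : R) f d ->
  is_derive t (1 : R) (fun s => (f s)^-1) (- d / (f t) ^+ 2).
Proof.
move=> f0 fd; apply: (@is_derive_eq _ _ _ _ _ _ _ _ (is_deriveV f0 fd)).
by rewrite /GRing.scale /= mulrC mulrN mulNr.
Qed.

Lemma derComp f g t d e : is_derive (g t) (1 : R) f d ->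
  is_derive t (1 : R) g e -> is_derive t (1 : R) (fun s => f (g s)) (d * e).
Proof. by move=> ? ?; apply: is_derive1_comp. Qed.

Lemma derExp f t d : is_derive t (1 : R) f d ->
  is_derive t (1 : R) (fun s => expR (f s)) (expR (f t) * d).
Proof. by move=> fd; exact: (derComp (is_derive_expR _) fd). Qed.

Lemma derShift f t c d : is_derive (t + c) (1 : R) f d ->
  is_derive t (1 : R) (fun s => f (s + c)) d.
Proof.
move=> fd; rewrite -[d]mulr1.
rewrite -[X in d * X](addr0 1).
exact: (@derComp f (fun s => s + c) _ _ _ fd (derD (derI t) (derC c t))).
Qed.

Lemma derOpp f t d : is_derive (- t) (1 : R) f d ->
  is_derive t (1 : R) (fun s => f (- s)) (- d).
Proof.
move=> fd; rewrite -mulrN1.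
exact: (@derComp f (fun s => - s) _ _ _ fd (derN (derI t))).
Qed.

Lemma der_cont f t d : is_derive t (1 : R) f d -> {for t, continuous f}.
Proof.
by move=> fd; apply: differentiable_continuous; apply/derivable1_diffP.
Qed.

Lemma der_MVT f df a b : a <= b ->
    (forall x, a <= x <= b -> is_derive x (1 : R) f (df x)) ->
  exists c, a <= c <= b /\ f b - f a = df c * (b - a).
Proof.
move=> ab fd; have [| |c cab ->] := @MVT_segment R f df a b ab.
- by move=> x /itvP xab; apply: fd; rewrite !xab.
- apply: derivable_within_continuous => x /itvP xab.
  by have /(_ _)[] := fd x; rewrite ?xab.
- by exists c; split; [move: cab; rewrite in_itv|].
Qed.

Lemma der_le P Q p q a b : a <= b ->
    (forall x, a <= x <= b -> is_derive x (1 : R) P (p x)) ->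
    (forall x, a <= x <= b -> is_derive x (1 : R) Q (q x)) ->
    (forall x, a <= x <= b -> p x <= q x) ->
  P b - P a <= Q b - Q a.
Proof.
move=> ab Pp Qq pq.
have [|c [cab]] := @der_MVT (fun s => Q s - P s) (fun s => q s - p s) a b ab.
  by move=> x xab; apply: derB; [apply: Qq|apply: Pp].
have : 0 <= (q c - p c) * (b - a) by rewrite mulr_ge0 ?subr_ge0 ?pq.
lra.
Qed.

Lemma der_bound P p k a b : a <= b ->
    (forall x, a <= x <= b -> is_derive x (1 : R) P (p x)) ->
    (forall x, a <= x <= b -> `|p x| <= k) ->
  `|P b - P a| <= k * (b - a).
Proof.
move=> ab Pp pk; have [c [cab ->]] := der_MVT ab Pp.
by rewrite normrM (ger0_norm (_ : 0 <= b - a)) ?subr_ge0// ler_wpM2r ?subr_ge0 ?pk.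
Qed.

Lemma der_lip P p k : (forall x, is_derive x (1 : R) P (p x)) ->
  (forall x, `|p x| <= k) -> forall a b, `|P b - P a| <= k * `|b - a|.
Proof.
move=> Pp pk a b; case: (leP a b) => ab.
  by rewrite (ger0_norm (_ : 0 <= b - a)) ?subr_ge0//; apply: der_bound.
rewrite distrC (distrC b) (ger0_norm (_ : 0 <= a - b)) ?subr_ge0 ?(ltW ab)//.
by apply: der_bound => //; apply: ltW.
Qed.

Lemma der_eq P Q p : (forall x, is_derive x (1 : R) P (p x)) ->
  (forall x, is_derive x (1 : R) Q (p x)) -> P 0 = Q 0 -> P =1 Q.
Proof.
move=> Pp Qp PQ0 t.
have := @der_lip (fun s => P s - Q s) (fun s => p s - p s) 0 _ _ 0 t.
rewrite mul0r PQ0 subrr subr0 => PQ; apply/eqP.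
rewrite -subr_eq0 -normr_le0; by apply: PQ => x; rewrite subrr normr0.
Qed.

Let integrableW f a b : continuous f ->
  (@lebesgue_measure R).-integrable `[a, b] (EFin \o f).
Proof.
move=> cf; apply: continuous_compact_integrable; first exact: segment_compact.
exact: continuous_subspaceT.
Qed.

Let half_prim f : continuous f -> exists P, P 0 = 0 /\
  forall t, -1 < t -> is_derive t (1 : R) P (f t).
Proof.
move=> cf; pose F (x : R) := (\int[lebesgue_measure]_(t in `[(-1)%R, x]) (f t)).
exists (fun x => F x - F 0); split=> [|t t1]; first by rewrite subrr.
have [] := @continuous_FTC1 R f (BLeft (-1)) t (t + 1).
- by lra.
- exact: integrableW.
- by rewrite lte_fin.
- exact: cf.
move=> Fd Fe; rewrite -[f t]subr0; apply: (derB _ (derC (F 0) t)).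
by split; [exact: Fd|rewrite -derive1E; exact: Fe].
Qed.

(** Gluing two one-sided integrals gives an antiderivative on the whole line.
    Time integrals are written with antiderivatives throughout: the mean value
    theorem then treats intervals of either orientation at once. *)
Lemma prim_exists f : continuous f -> exists P, P 0 = 0 /\
  forall t, is_derive t (1 : R) P (f t).
Proof.
move=> cf; have [G [G0 Gd]] := half_prim cf.
have cfN : continuous (fun x => f (- x)).
  move=> x; apply: (@continuous_comp _ _ _ -%R f); last exact: cf.
  exact: opp_continuous.
have [H [H0 Hd]] := half_prim cfN.
have HNd t : t < 1 -> is_derive t (1 : R) (fun s => - H (- s)) (f t).
  move=> t1; rewrite -[f t]opprK; apply: derN; apply: derOpp.
  by have := Hd (- t); rewrite opprK; apply; lra.
have HG t : -1 < t -> t < 1 -> G t = - H (- t).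
  move=> t1 t2.
  have aux x : - `|t| <= x <= `|t| ->
      is_derive x (1 : R) (fun s => G s - - H (- s)) (f x - f x).
    rewrite -ler_norml => xt; have : `|t| < 1 by rewrite ltr_norml t1 t2.
    move=> /(le_lt_trans xt); rewrite ltr_norml => /andP[x1 x2].
    by apply: derB; [apply: Gd|apply: HNd].
  apply/eqP; rewrite -subr_eq0; apply/eqP.
  have [t0|t0] := leP 0 t.
    have [|c [_]] := @der_MVT (fun x => G x - - H (- x)) (fun x => f x - f x) 0 t t0 _.
      by move=> x /andP[x0 xt]; apply: aux; rewrite ger0_norm// xt andbT; lra.
    by rewrite G0 !oppr0 H0 !oppr0 addr0 subr0 subrr mul0r.
  have [|c [_]] := @der_MVT (fun x => G x - - H (- x)) (fun x => f x - f x) t 0 (ltW t0) _.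
    by move=> x /andP[x0 xt]; apply: aux; rewrite ltr0_norm//; lra.
  by rewrite G0 !oppr0 H0 !oppr0 addr0 subrr !sub0r mul0r => /eqP; rewrite oppr_eq0 => /eqP.
exists (fun t => if -1 < t then G t else - H (- t)); split.
  by rewrite G0 ltrN10.
move=> t; case: (ltP (-1) t) => t1.
  apply: near_eq_is_derive (Gd t t1); near=> x.
  have -> // : -1 < x by near: x; exact: lt_nbhsr.
apply: near_eq_is_derive (HNd t _); last by lra.
near=> x.
have x1 : x < 1 by near: x; apply: lt_nbhsl; lra.
by case: ifPn => // x2; rewrite HG.
Unshelve. all: by end_near. Qed.

Definition prim f : R -> R :=
  xget (fun=> 0) [set P | P 0 = 0 /\ forall t, is_derive t (1 : R) P (f t)].

Lemma primP f : continuous f ->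
  prim f 0 = 0 /\ forall t, is_derive t (1 : R) (prim f) (f t).
Proof.
by move=> /prim_exists [P PP]; rewrite /prim; case: xgetP => [Q _ //|/(_ P)].
Qed.

Lemma prim0 f : continuous f -> prim f 0 = 0.
Proof. by case/primP. Qed.

Lemma prim_der f t : continuous f -> is_derive t (1 : R) (prim f) (f t).
Proof. by case/primP. Qed.

Lemma prim_uniq f P : continuous f -> P 0 = 0 ->
  (forall t, is_derive t (1 : R) P (f t)) -> prim f = P.
Proof.
move=> cf P0 Pd; apply/funext; apply: (@der_eq _ _ f (fun x => prim_der x cf) Pd).
by rewrite prim0 // P0.
Qed.

Lemma prim_dist f g k c : continuous f -> continuous g ->
  (forall x, `|x| <= `|c| -> `|f x - g x| <= k) ->
  `|prim f c - prim g c| <= k * `|c|.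
Proof.
move=> cf cg fgk.
have aux x : is_derive x (1 : R) (fun s => prim f s - prim g s) (f x - g x).
  by apply: derB; exact: prim_der.
have [c0|c0] := leP 0 c.
  have := @der_bound _ _ k 0 c c0 (fun x _ => aux x).
  rewrite !prim0 // !subr0 (ger0_norm c0); apply => x /andP[x0 xc].
  by apply: fgk; rewrite !ger0_norm.
have := @der_bound _ _ k c 0 (ltW c0) (fun x _ => aux x).
rewrite !prim0 // subrr !sub0r normrN (ltr0_norm c0); apply => x /andP[x0 xc].
by apply: fgk; rewrite (ltr0_norm c0) ler0_norm // lerN2.
Qed.

(** Gronwall's inequality, in the homogeneous form to which the estimates on
    trajectories are reduced by adding a constant to a squared distance. *)
Lemma gronwall (q q' : R -> R) k T : (forall t, is_derive t (1 : R) q (q' t)) ->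
  (forall t, `|t| <= T -> `|q' t| <= k * q t) ->
  forall t, `|t| <= T -> q t <= q 0 * expR (k * `|t|).
Proof.
move=> qd qk t tT.
have ek c x : is_derive x (1 : R) (fun s => expR (c * s)) (expR (c * x) * c).
  by apply: derExp; rewrite -[X in is_derive _ _ _ X]mulr1; apply: derZ; exact: derI.
have [t0|t0] := leP 0 t.
  have := @der_le (fun s => q s * expR (- k * s)) (fun=> 0)
    (fun s => q' s * expR (- k * s) + q s * (expR (- k * s) * - k)) (fun=> 0)
    0 t t0.
  rewrite subrr subr_le0 !mulr0 expR0 mulr1 (ger0_norm t0) => H.
  have qt : q t = q t * expR (- k * t) * expR (k * t).
    by rewrite -mulrA -expRD -mulrDl addNr mul0r expR0 mulr1.
  rewrite qt ler_pM2r ?expR_gt0 //.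
  apply: (H (fun x _ => derM (qd x) (ek _ x)) (fun x _ => derC 0 x)) => x /andP[x0 xt].
  have -> : q' x * expR (- k * x) + q x * (expR (- k * x) * - k)
    = (q' x - k * q x) * expR (- k * x) by ring.
  rewrite pmulr_lle0 ?expR_gt0 // subr_le0.
  apply: (le_trans (ler_norm _)); apply: qk.
  by apply: le_trans tT; rewrite !ger0_norm.
have := @der_le (fun=> 0) (fun s => q s * expR (k * s)) (fun=> 0)
  (fun s => q' s * expR (k * s) + q s * (expR (k * s) * k)) t 0 (ltW t0).
rewrite subrr subr_ge0 !mulr0 expR0 mulr1 (ltr0_norm t0) => H.
have qt : q t = q t * expR (k * t) * expR (k * - t).
  by rewrite -mulrA -expRD -mulrDr subrr mulr0 expR0 mulr1.
rewrite qt ler_pM2r ?expR_gt0 //.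
apply: (H (fun x _ => derC 0 x) (fun x _ => derM (qd x) (ek _ x))) => x /andP[tx x0].
have -> : q' x * expR (k * x) + q x * (expR (k * x) * k)
  = (q' x + k * q x) * expR (k * x) by ring.
rewrite mulr_ge0 ?expR_ge0 // -lerBlDr sub0r lerNl.
apply: (le_trans (ler_norm _)); rewrite normrN; apply: qk.
by apply: le_trans tT; rewrite (ltr0_norm t0) ler0_norm // lerN2.
Qed.

End calculus.

(** * Functions of class C^1 on the plane *)

Section plane.
Context {R : realType}.
Implicit Types (y z : R * R) (f g : R * R -> R).

Definition dist1 y z : R := `|y.1 - z.1| + `|y.2 - z.2|.

Lemma dist1_ge0 y z : 0 <= dist1 y z.
Proof. exact: addr_ge0. Qed.

Lemma dist1_fst y z : `|y.1 - z.1| <= dist1 y z.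
Proof. by rewrite lerDl. Qed.

Lemma dist1_snd y z : `|y.2 - z.2| <= dist1 y z.
Proof. by rewrite lerDr. Qed.

Lemma dist1C y z : dist1 y z = dist1 z y.
Proof. by rewrite /dist1 distrC (distrC y.2). Qed.

Lemma dist1_tri x y z : dist1 x z <= dist1 x y + dist1 y z.
Proof.
have := ler_distD y.1 x.1 z.1; have := ler_distD y.2 x.2 z.2.
by rewrite /dist1; lra.
Qed.

Lemma dist1D y z v : dist1 (y + v) (z + v) = dist1 y z.
Proof.
have E (a b c : R) : a + c - (b + c) = a - b by ring.
by rewrite /dist1 /= !E.
Qed.

Lemma dist1_eq0 y z : dist1 y z <= 0 -> y = z.
Proof.
move=> d0; have := dist1_fst y z; have := dist1_snd y z.
move=> /le_trans /(_ d0); rewrite normr_le0 subr_eq0 => /eqP e2.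
move=> /le_trans /(_ d0); rewrite normr_le0 subr_eq0 => /eqP e1.
by case: y z e1 e2 {d0} => ? ? [? ?] /= -> ->.
Qed.

(** Estimates of distances between trajectories are written with the l^1
    distance, so continuity is needed in this form. *)
Lemma cont_epsP f y : {for y, continuous f} <->
  forall e : R, 0 < e -> exists2 d : R, 0 < d &
    forall z, dist1 y z < d -> `|f y - f z| < e.
Proof.
split=> [/cvgrPdist_lt fy e e0|fy].
  have /nbhs_ballP[d /= d0 dP] := fy e e0.
  exists d => // z yz; apply: dP; split => /=.
    by apply: le_lt_trans yz; exact: dist1_fst.
  by apply: le_lt_trans yz; exact: dist1_snd.
apply/cvgrPdist_lt => e e0; have [d d0 dP] := fy e e0.
apply/(@nbhs_ballP R (R * R)%type); exists (d / 2) => /=; first by rewrite divr_gt0.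
move=> z [/= y1 y2]; apply: dP; rewrite [ltRHS](splitr d).
exact: ltrD.
Qed.

Lemma is_derive_epsP (f : R -> R) t d : is_derive t (1 : R) f d <->
  forall e : R, 0 < e -> exists2 r : R, 0 < r &
    forall h : R, `|h| < r -> `|f (t + h) - f t - d * h| <= e * `|h|.
Proof.
have E e h : 0 < e -> h != 0 -> (`|d - h^-1 *: (f (h *: (1 : R) + t) - f t)| <= e)
    = (`|f (t + h) - f t - d * h| <= e * `|h|).
  move=> e0 h0; rewrite /GRing.scale /= mulr1 (addrC h).
  have -> : f (t + h) - f t - d * h = - (d - h^-1 * (f (t + h) - f t)) * h.
    by field.
  by rewrite normrM normrN ler_pM2r // normr_gt0.
split=> [fd e e0|fd].
  have fc : h^-1 *: (f (h *: (1 : R) + t) - f t) @[h --> 0^'] --> d.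
    by have [fc <-] := fd; exact: fc.
  move/cvgrPdist_le/(_ e e0): fc => /nbhs_ballP[r /= r0 rP].
  exists r => // h hr; have [->|h0] := eqVneq h 0.
    by rewrite addr0 subrr mulr0 subrr normr0 mulr0.
  rewrite -E //; apply: rP => //=.
  by rewrite /ball /= sub0r normrN.
have fc : h^-1 *: (f (h *: (1 : R) + t) - f t) @[h --> 0^'] --> d.
  apply/cvgrPdist_le => e e0; have [r r0 rP] := fd e e0.
  apply/nbhs_ballP; exists r => //= h; rewrite /ball /= sub0r normrN => hr h0.
  by rewrite E //; exact: rP.
split; first by apply/cvg_ex; exists d.
exact: cvg_lim fc.
Qed.

(** The partial derivatives are arguments, so that the formulas for sums,
    products and inverses belong to the closure lemmas. *)
Definition C1 (f f1 f2 : R * R -> R) : Prop :=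
  [/\ continuous f1, continuous f2,
      forall a b : R, is_derive a (1 : R) (fun s => f (s, b)) (f1 (a, b)) &
      forall a b : R, is_derive b (1 : R) (fun s => f (a, s)) (f2 (a, b))].

Lemma der_between (f f' : R -> R) (a b : R) :
    (forall x, is_derive x (1 : R) f (f' x)) ->
  exists c, `|c - a| <= `|b - a| /\ f b - f a = f' c * (b - a).
Proof.
move=> fd; have [ab|ab] := leP a b.
  have [c [/andP[c1 c2] ->]] := der_MVT ab (fun x _ => fd x).
  exists c; split => //; rewrite !ger0_norm ?subr_ge0 //; lra.
have [c [/andP[c1 c2] E]] := der_MVT (ltW ab) (fun x _ => fd x).
exists c; split; last by rewrite -opprB E -mulrN opprB.
by rewrite !ler0_norm ?subr_le0 ?(ltW ab) //; lra.
Qed.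

(** The increment splits into a horizontal and a vertical one, and each is
    given by the mean value theorem. *)
Lemma C1_incr f f1 f2 y z : C1 f f1 f2 -> exists c c',
  [/\ dist1 y c <= dist1 y z, dist1 y c' <= dist1 y z &
      f z - f y = f1 c * (z.1 - y.1) + f2 c' * (z.2 - y.2)].
Proof.
move=> [_ _ fd1 fd2].
have [c [cy Ec]] := der_between y.1 z.1 (fun x => fd1 x z.2).
have [d [dy Ed]] := der_between y.2 z.2 (fun x => fd2 y.1 x).
exists (c, z.2), (y.1, d); split.
- by rewrite /dist1 /= lerD2r distrC (distrC y.1).
- by rewrite /dist1 /= subrr normr0 add0r distrC (le_trans dy) // distrC lerDr.
- by rewrite -Ec -Ed /=; case: z {cy Ec dy Ed} => ? ? /=; case: y => ? ? /=; ring.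
Qed.

Lemma C1_cont f f1 f2 : C1 f f1 f2 -> continuous f.
Proof.
move=> fC y; apply/cont_epsP => e e0.
have [c1 c2 _ _] := fC.
have [d1 d10 d1P] := (cont_epsP f1 y).1 (c1 y) 1 ltr01.
have [d2 d20 d2P] := (cont_epsP f2 y).1 (c2 y) 1 ltr01.
pose K := `|f1 y| + `|f2 y| + 1.
have K0 : 0 < K by rewrite ltr_wpDl // addr_ge0.
exists (Num.min (Num.min d1 d2) (e / K)).
  by rewrite !lt_min d10 d20 divr_gt0.
move=> z; rewrite !lt_min => /andP[/andP[yz1 yz2] yze].
have [c [c' [yc yc' E]]] := C1_incr y z fC.
rewrite distrC E; apply: le_lt_trans (_ : K * dist1 y z < e); last first.
  by rewrite mulrC -ltr_pdivlMr.
have /d1P h1 := le_lt_trans yc yz1; have /d2P h2 := le_lt_trans yc' yz2.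
have k1 : `|f1 c| <= K.
  have := ler_normD (f1 y) (f1 c - f1 y); rewrite (distrC _ (f1 y)) addrC subrK.
  by have := normr_ge0 (f2 y); rewrite /K; lra.
have k2 : `|f2 c'| <= K.
  have := ler_normD (f2 y) (f2 c' - f2 y); rewrite (distrC _ (f2 y)) addrC subrK.
  by have := normr_ge0 (f1 y); rewrite /K; lra.
apply: le_trans (ler_normD _ _) _; rewrite !normrM /dist1 mulrDr.
by rewrite (distrC y.1) (distrC y.2) lerD // ler_wpM2r.
Qed.

(** Continuous partial derivatives make the function differentiable, hence
    derivable along curves. *)
Lemma C1_chain f f1 f2 (g1 g2 : R -> R) t v1 v2 : C1 f f1 f2 ->
  is_derive t (1 : R) g1 v1 -> is_derive t (1 : R) g2 v2 ->
  is_derive t (1 : R) (fun s => f (g1 s, g2 s))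
    (f1 (g1 t, g2 t) * v1 + f2 (g1 t, g2 t) * v2).
Proof.
move=> fC /is_derive_epsP gd1 /is_derive_epsP gd2.
set y := (g1 t, g2 t); apply/is_derive_epsP => e e0.
have [c1 c2 _ _] := fC.
pose K := `|f1 y| + `|f2 y| + `|v1| + `|v2| + 2.
have K0 : 0 < K by rewrite ltr_wpDl // !addr_ge0.
pose e' := Num.min 1 (e / K).
have e'0 : 0 < e' by rewrite lt_min ltr01 divr_gt0.
have e'1 : e' <= 1 by rewrite ge_min lexx.
have e'e : e' * K <= e by rewrite -ler_pdivlMr // ge_min lexx orbT.
have [d1 d10 d1P] := (cont_epsP f1 y).1 (c1 y) e' e'0.
have [d2 d20 d2P] := (cont_epsP f2 y).1 (c2 y) e' e'0.
have [r1 r10 r1P] := gd1 e' e'0; have [r2 r20 r2P] := gd2 e' e'0.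
exists (Num.min (Num.min r1 r2) (Num.min (d1 / K) (d2 / K))).
  by rewrite !lt_min r10 r20 !divr_gt0.
move=> h; rewrite !lt_min -!andbA => /and4P[hr1 hr2].
rewrite !ltr_pdivlMr // => hd1 hd2.
pose z := (g1 (t + h), g2 (t + h)).
have /= [c [c' [yc yc' ->]]] := C1_incr y z fC.
have {r1P}r1h := r1P _ hr1; have {r2P}r2h := r2P _ hr2.
set D1 := g1 (t + h) - g1 t in r1h *; set D2 := g2 (t + h) - g2 t in r2h *.
have D1h : `|D1| <= (`|v1| + 1) * `|h|.
  have := ler_normD (v1 * h) (D1 - v1 * h); rewrite addrC subrK normrM.
  have : e' * `|h| <= 1 * `|h| by rewrite ler_wpM2r.
  by lra.
have D2h : `|D2| <= (`|v2| + 1) * `|h|.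
  have := ler_normD (v2 * h) (D2 - v2 * h); rewrite addrC subrK normrM.
  have : e' * `|h| <= 1 * `|h| by rewrite ler_wpM2r.
  by lra.
have yz : dist1 y z <= `|h| * K.
  rewrite /dist1 /= distrC -/D1 (distrC (g2 t)) -/D2.
  apply: le_trans (lerD D1h D2h) _.
  have : 0 <= (`|f1 y| + `|f2 y|) * `|h| by rewrite mulr_ge0 // addr_ge0.
  by rewrite /K; lra.
have /d1P h1 := le_lt_trans (le_trans yc yz) hd1.
have /d2P h2 := le_lt_trans (le_trans yc' yz) hd2.
have -> : f1 c * D1 + f2 c' * D2 - (f1 y * v1 + f2 y * v2) * h =
  - ((f1 y - f1 c) * D1) + (- ((f2 y - f2 c') * D2)) + (f1 y * (D1 - v1 * h) + f2 y * (D2 - v2 * h)).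
  by ring.
apply: le_trans (_ : e' * K * `|h| <= _); last by rewrite ler_wpM2r.
have n1 : `|(f1 y - f1 c) * D1| <= e' * ((`|v1| + 1) * `|h|).
  by rewrite normrM ler_pM // ltW.
have n2 : `|(f2 y - f2 c') * D2| <= e' * ((`|v2| + 1) * `|h|).
  by rewrite normrM ler_pM // ltW.
have n3 : `|f1 y * (D1 - v1 * h)| <= `|f1 y| * (e' * `|h|).
  by rewrite normrM ler_wpM2l.
have n4 : `|f2 y * (D2 - v2 * h)| <= `|f2 y| * (e' * `|h|).
  by rewrite normrM ler_wpM2l.
apply: le_trans (ler_normD _ _) _.
have := ler_normD (- ((f1 y - f1 c) * D1)) (- ((f2 y - f2 c') * D2)).
have := ler_normD (f1 y * (D1 - v1 * h)) (f2 y * (D2 - v2 * h)).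
by rewrite !normrN /K; lra.
Qed.

Lemma C1C (c : R) : C1 (fun=> c) (fun=> 0) (fun=> 0).
Proof.
by split=> [y|y|a b|a b]; [exact: cst_continuous|exact: cst_continuous|exact: derC|exact: derC].
Qed.

Lemma C1D f f1 f2 g g1 g2 : C1 f f1 f2 -> C1 g g1 g2 ->
  C1 (fun y => f y + g y) (fun y => f1 y + g1 y) (fun y => f2 y + g2 y).
Proof.
move=> [cf1 cf2 fd1 fd2] [cg1 cg2 gd1 gd2]; split=> [y|y|a b|a b].
- by apply: cvgD; [exact: cf1|exact: cg1].
- by apply: cvgD; [exact: cf2|exact: cg2].
- exact: derD (fd1 a b) (gd1 a b).
- exact: derD (fd2 a b) (gd2 a b).
Qed.

Lemma C1N f f1 f2 : C1 f f1 f2 ->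
  C1 (fun y => - f y) (fun y => - f1 y) (fun y => - f2 y).
Proof.
move=> [cf1 cf2 fd1 fd2]; split=> [y|y|a b|a b].
- by apply: cvgN; exact: cf1.
- by apply: cvgN; exact: cf2.
- exact: derN (fd1 a b).
- exact: derN (fd2 a b).
Qed.

Lemma C1M f f1 f2 g g1 g2 : C1 f f1 f2 -> C1 g g1 g2 ->
  C1 (fun y => f y * g y) (fun y => f1 y * g y + f y * g1 y)
     (fun y => f2 y * g y + f y * g2 y).
Proof.
move=> fC gC; have cf := C1_cont fC; have cg := C1_cont gC.
case: fC gC => [cf1 cf2 fd1 fd2] [cg1 cg2 gd1 gd2]; split=> [y|y|a b|a b].
- by apply: cvgD; apply: cvgM; [exact: cf1|exact: cg|exact: cf|exact: cg1].
- by apply: cvgD; apply: cvgM; [exact: cf2|exact: cg|exact: cf|exact: cg2].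
- exact: derM (fd1 a b) (gd1 a b).
- exact: derM (fd2 a b) (gd2 a b).
Qed.

Lemma C1V f f1 f2 : C1 f f1 f2 -> (forall y, f y != 0) ->
  C1 (fun y => (f y)^-1) (fun y => - f1 y / f y ^+ 2) (fun y => - f2 y / f y ^+ 2).
Proof.
move=> fC f0; have cf := C1_cont fC.
case: fC => [cf1 cf2 fd1 fd2]; split=> [y|y|a b|a b].
- apply: cvgM; first by apply: cvgN; exact: cf1.
  by apply: cvgV; [rewrite expf_neq0|rewrite !expr2; apply: cvgM; exact: cf].
- apply: cvgM; first by apply: cvgN; exact: cf2.
  by apply: cvgV; [rewrite expf_neq0|rewrite !expr2; apply: cvgM; exact: cf].
- exact: derV (f0 _) (fd1 a b).
- exact: derV (f0 _) (fd2 a b).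
Qed.

(** Schwarz: both mixed derivatives are limits of the same second
    difference quotient. *)
Lemma C1_schwarz u u1 u2 u11 u12 u21 u22 : C1 u u1 u2 -> C1 u1 u11 u12 ->
  C1 u2 u21 u22 -> u12 =1 u21.
Proof.
move=> [_ _ d1 d2] [_ c12 _ d12] [c21 _ d21 _] y.
apply/eqP; rewrite -subr_eq0 -normr_le0; apply/ler_addgt0Pr => e e0.
rewrite add0r.
have e20 : 0 < e / 2 by rewrite divr_gt0.
have [r r0 rP] := (cont_epsP u12 y).1 (c12 y) _ e20.
have [s s0 sP] := (cont_epsP u21 y).1 (c21 y) _ e20.
pose h := Num.min r s / 3.
have h0 : 0 < h by rewrite divr_gt0 // lt_min r0 s0.
have hr : h + h < r.
  have : Num.min r s <= r by rewrite ge_min lexx.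
  by rewrite /h in h0 *; lra.
have hs : h + h < s.
  have : Num.min r s <= s by rewrite ge_min lexx orbT.
  by rewrite /h in h0 *; lra.
have yh1 : y.1 <= y.1 + h by rewrite lerDl ltW.
have yh2 : y.2 <= y.2 + h by rewrite lerDl ltW.
have dst a b : y.1 <= a <= y.1 + h -> y.2 <= b <= y.2 + h ->
    dist1 y (a, b) <= h + h.
  move=> /andP[? ?] /andP[? ?]; rewrite /dist1 /= lerD //.
    by rewrite distrC ger0_norm ?subr_ge0 // lerBlDl.
  by rewrite distrC ger0_norm ?subr_ge0 // lerBlDl.
have [a [ah E1]] := der_MVT yh1
  (fun x _ => derB (d1 x (y.2 + h)) (d1 x y.2)).
have [b [bh E2]] := der_MVT yh2 (fun x _ => d12 a x).
have [b' [b'h E1']] := der_MVT yh2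
  (fun x _ => derB (d2 (y.1 + h) x) (d2 y.1 x)).
have [a' [a'h E2']] := der_MVT yh1 (fun x _ => d21 x b').
move: E1 E1'; rewrite /= E2 E2' => E1 E1'.
have /mulIf := lt0r_neq0 h0 => hI.
have {E1 E1'} E : u12 (a, b) = u21 (a', b').
  apply: hI; apply: (mulIf (lt0r_neq0 h0)).
  by lra.
have /rP p1 := le_lt_trans (dst _ _ ah bh) hr.
have /sP p2 := le_lt_trans (dst _ _ a'h b'h) hs.
have -> : u12 y - u21 y = (u12 y - u12 (a, b)) - (u21 y - u21 (a', b')).
  by rewrite E; ring.
by apply: le_trans (ler_normB _ _) _; lra.
Qed.

End plane.

(** * Periodic functions *)

Section periodic.
Context {R : realType}.
Implicit Types (y z : R * R) (f g : R * R -> R).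

Lemma intvecN (k : int * int) : intvec (- k) = - intvec k :> R * R.
Proof. by rewrite /intvec /= !rmorphN. Qed.

Lemma to_Y2 y : exists k, (y + intvec k) \in Y2.
Proof.
exists (- Num.floor y.1, - Num.floor y.2).
have F (a : R) : (a + (- Num.floor a)%:~R) \in `[0, 1[.
  have /andP[a1 a2] := floor_itv a; rewrite intrD in a2.
  by rewrite in_itv /= rmorphN /=; apply/andP; split; lra.
by rewrite inE; split; exact: F.
Qed.

Let square_compact : compact (`[0, 1] `*` `[0, 1] : set (R * R)).
Proof. by apply: compact_setX; exact: segment_compact. Qed.

Let Y2_square : Y2 `<=` (`[0, 1] `*` `[0, 1] : set (R * R)).
Proof.
move=> y [/=]; rewrite !in_itv /= => /andP[-> /ltW ->] /andP[-> /ltW ->].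
by [].
Qed.

Lemma per_bounded f : C0sharp f -> exists2 M, 0 < M & forall y, `|f y| <= M.
Proof.
move=> [fp fc].
have [||c _ cM] := compact_EVT_max (f := fun y => `|f y|) _ square_compact.
- by exists (0, 0); rewrite /= !in_itv /= lexx ler01.
- by apply: continuous_subspaceT => y; apply: cvg_norm; exact: fc.
exists (`|f c| + 1) => [|y]; first by rewrite ltr_wpDl.
have [k yk] := to_Y2 y; rewrite -(fp y k).
have := cM (y + intvec k); rewrite !inE => H.
by apply: le_trans (H _) _; [apply: Y2_square; rewrite inE in yk|rewrite lerDl].
Qed.

Lemma per_pos_min f : C0sharp f -> (forall y, 0 < f y) ->
  exists2 m, 0 < m & forall y, m <= f y.
Proof.
move=> [fp fc] f0.
have [||c _ cM] := compact_EVT_min (f := f) _ square_compact.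
- by exists (0, 0); rewrite /= !in_itv /= lexx ler01.
- by apply: continuous_subspaceT => y; exact: fc.
exists (f c) => // y; have [k yk] := to_Y2 y; rewrite -(fp y k).
by apply: cM; rewrite inE; apply: Y2_square; rewrite inE in yk.
Qed.

(** Uniform continuity on the closed unit square extends to the plane by
    translation, provided the neighbour [z] of [y] is not required to lie in
    the square. *)
Lemma per_ucont f : C0sharp f -> forall e : R, 0 < e ->
  exists2 d : R, 0 < d & forall y z, dist1 y z < d -> `|f y - f z| < e.
Proof.
move=> [fp fc] e e0.
have /compact_near_coveringP nc := square_compact.
have := nc R (at_right (0 : R))
  (fun d y => forall z, dist1 y z < d -> `|f y - f z| < e) _.
case=> [y _|d /= d0 dP].
  have [r r0 rP] := (cont_epsP f y).1 (fc y) (e / 2) ltac:(by rewrite divr_gt0).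
  have r20 : 0 < r / 2 by rewrite divr_gt0.
  exists ([set z | dist1 y z < r / 2], [set d : R | d < r / 2]) => /=.
    split; last by exact: nbhs_right_lt.
    apply/(@nbhs_ballP R (R * R)%type); exists (r / 2 / 2) => /=.
      by rewrite !divr_gt0.
    by move=> z [/= y1 y2]; rewrite [ltRHS](splitr (r / 2)); exact: ltrD.
  move=> [y' d] [/= yy' dr] z y'z.
  have h1 : `|f y - f y'| < e / 2.
    by apply: rP; apply: lt_trans yy' _; rewrite ltr_pdivrMr //; lra.
  have h2 : `|f y - f z| < e / 2.
    by apply: rP; have := dist1_tri y y' z; lra.
  have -> : f y' - f z = (f y - f z) - (f y - f y') by ring.
  by apply: le_lt_trans (ler_normB _ _) _; lra.
exists (d / 2); first by rewrite divr_gt0.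
move=> y z yz; have [k yk] := to_Y2 y.
rewrite -(fp y k) -(fp z k); apply: (dP (d / 2)).
- by rewrite /= sub0r normrN ger0_norm ?divr_ge0 ?ltW // ltr_pdivrMr //; lra.
- by rewrite divr_gt0.
- by apply: Y2_square; rewrite inE in yk.
- by rewrite dist1D.
Qed.

Lemma perD f g : C0sharp f -> C0sharp g -> C0sharp (fun y => f y + g y).
Proof.
move=> [fp fc] [gp gc]; split=> [y k|y]; first by rewrite fp gp.
by apply: cvgD; [exact: fc|exact: gc].
Qed.

Lemma perN f : C0sharp f -> C0sharp (fun y => - f y).
Proof.
move=> [fp fc]; split=> [y k|y]; first by rewrite fp.
by apply: cvgN; exact: fc.
Qed.

Lemma perM f g : C0sharp f -> C0sharp g -> C0sharp (fun y => f y * g y).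
Proof.
move=> [fp fc] [gp gc]; split=> [y k|y]; first by rewrite fp gp.
by apply: cvgM; [exact: fc|exact: gc].
Qed.

Lemma perV f : C0sharp f -> (forall y, f y != 0) -> C0sharp (fun y => (f y)^-1).
Proof.
move=> [fp fc] f0; split=> [y k|y]; first by rewrite fp.
by apply: cvgV => //; exact: fc.
Qed.

Lemma perC (c : R) : C0sharp (fun=> c).
Proof. by split=> // y; exact: cst_continuous. Qed.

Definition C1per f f1 f2 : Prop :=
  [/\ C0sharp f, C0sharp f1, C0sharp f2 & C1 f f1 f2].

Lemma C1perM f f1 f2 g g1 g2 : C1per f f1 f2 -> C1per g g1 g2 ->
  C1per (fun y => f y * g y) (fun y => f1 y * g y + f y * g1 y)
     (fun y => f2 y * g y + f y * g2 y).
Proof.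
move=> [f0 ? ? fC] [g0 ? ? gC]; split; last exact: C1M.
- exact: perM.
- by apply: perD; apply: perM.
- by apply: perD; apply: perM.
Qed.

Lemma C1perD f f1 f2 g g1 g2 : C1per f f1 f2 -> C1per g g1 g2 ->
  C1per (fun y => f y + g y) (fun y => f1 y + g1 y) (fun y => f2 y + g2 y).
Proof. by move=> [? ? ? fC] [? ? ? gC]; split; [exact: perD..|exact: C1D]. Qed.

Lemma C1perN f f1 f2 : C1per f f1 f2 ->
  C1per (fun y => - f y) (fun y => - f1 y) (fun y => - f2 y).
Proof. by move=> [? ? ? fC]; split; [exact: perN..|exact: C1N]. Qed.

Lemma C1perC (c : R) : C1per (fun=> c) (fun=> 0) (fun=> 0).
Proof. by split; [exact: perC..|exact: C1C]. Qed.

Lemma C1perV f f1 f2 : C1per f f1 f2 -> (forall y, f y != 0) ->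
  C1per (fun y => (f y)^-1) (fun y => - f1 y / f y ^+ 2) (fun y => - f2 y / f y ^+ 2).
Proof.
move=> [f0 fp1 fp2 fC] fn0.
have fs : C0sharp (fun y => (f y ^+ 2)^-1).
  by apply: perV => [|y]; [exact: perM|rewrite expf_neq0].
split; [exact: perV|apply: perM => //; exact: perN..|exact: C1V].
Qed.

Lemma C1per_lip f f1 f2 : C1per f f1 f2 -> exists2 L, 0 < L &
  forall y z, `|f y - f z| <= L * dist1 y z.
Proof.
move=> [_ /per_bounded[M1 M10 h1] /per_bounded[M2 M20 h2] fC].
exists (M1 + M2) => [|y z]; first exact: addr_gt0.
have [c [c' [_ _ ->]]] := C1_incr z y fC.
apply: le_trans (ler_normD _ _) _; rewrite !normrM /dist1 mulrDr.
by apply: lerD; apply: ler_wpM2r => //; apply: le_trans (h1 _) _ || apply: le_trans (h2 _) _; lra.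
Qed.

(** * From Frechet derivatives to partial derivatives *)

(** The difference quotients in a coordinate direction and those of the
    corresponding slice are the same functions. *)
Lemma derivable_C1 f : (forall y, derivable f y (1, 0)) ->
  (forall y, derivable f y (0, 1)) ->
  continuous (fun y => 'D_((1, 0) : R * R) f y) ->
  continuous (fun y => 'D_((0, 1) : R * R) f y) ->
  C1 f (fun y => 'D_((1, 0) : R * R) f y) (fun y => 'D_((0, 1) : R * R) f y).
Proof.
move=> dv1 dv2 c1 c2; split; [exact: c1|exact: c2|move=> a b|move=> a b].
- have dv := dv1 (a, b).
  have E : (fun h : R => h^-1 *: (f (h *: (1 : R) + a, b) - f (a, b))) =
           (fun h : R => h^-1 *: (f (h *: ((1, 0) : R * R) + (a, b)) - f (a, b))).
    apply/funext => h; congr (_ *: (f _ - _)); congr pair.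
    by rewrite /= scaler0 add0r.
  by split; rewrite /derivable /derive /= E.
- have dv := dv2 (a, b).
  have E : (fun h : R => h^-1 *: (f (a, h *: (1 : R) + b) - f (a, b))) =
           (fun h : R => h^-1 *: (f (h *: ((0, 1) : R * R) + (a, b)) - f (a, b))).
    apply/funext => h; congr (_ *: (f _ - _)); congr pair.
    by rewrite /= scaler0 add0r.
  by split; rewrite /derivable /derive /= E.
Qed.

Lemma derive_periodic (V : normedModType R) (f : R * R -> V) v :
  Z2periodic f -> Z2periodic (fun y => 'D_v f y).
Proof.
move=> fp y k; rewrite /derive.
suff -> : (fun h : R => h^-1 *: ((f \o shift (y + intvec k)) (h *: v) - f (y + intvec k)))
  = (fun h : R => h^-1 *: ((f \o shift y) (h *: v) - f y)) by [].
by apply/funext => h /=; rewrite addrA !fp.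
Qed.

Lemma C1sharp_C1per f : C1sharp f ->
  C1per f (fun y => 'D_((1, 0) : R * R) f y) (fun y => 'D_((0, 1) : R * R) f y).
Proof.
move=> [fp fd c1 c2].
have fC : C1 f (fun y => 'D_((1, 0) : R * R) f y) (fun y => 'D_((0, 1) : R * R) f y).
  by apply: derivable_C1; [move=> y; exact: diff_derivable..|exact: c1|exact: c2].
split; last exact: fC.
- by split=> [|y]; [exact: fp|apply: differentiable_continuous; exact: fd].
- by split; [exact: derive_periodic|exact: c1].
- by split; [exact: derive_periodic|exact: c2].
Qed.

Lemma is_derive_pair (V : normedModType R) (F : V -> R * R) (p v : V) d :
  is_derive p v F d -> is_derive p v (fun x => (F x).1) d.1 /\
  is_derive p v (fun x => (F x).2) d.2.
Proof.
move=> [Fd <-]; have c : h^-1 *: (F (h *: v + p) - F p) @[h --> 0^'] --> 'D_v F p := Fd.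
have c1 : h^-1 *: ((F (h *: v + p)).1 - (F p).1) @[h --> 0^'] --> ('D_v F p).1.
  have cfst (z : R * R) : {for z, continuous (@fst R R)} by exact: cvg_fst.
  exact: (continuous_cvg _ (cfst _) c).
have c2 : h^-1 *: ((F (h *: v + p)).2 - (F p).2) @[h --> 0^'] --> ('D_v F p).2.
  have csnd (z : R * R) : {for z, continuous (@snd R R)} by exact: cvg_snd.
  exact: (continuous_cvg _ (csnd _) c).
split; split; by [apply/cvg_ex; eexists; eassumption|exact: cvg_lim].
Qed.

Lemma C1sharp_pair (F : R * R -> R * R) : C1sharp F ->
  (exists f1 f2, C1per (fun y => (F y).1) f1 f2) /\
  (exists f1 f2, C1per (fun y => (F y).2) f1 f2).
Proof.
move=> [Fp Fd c1 c2].
have cF y : {for y, continuous F} by apply: differentiable_continuous; exact: Fd.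
have cf (f : R * R -> R * R) : (forall y, {for y, continuous f}) ->
    continuous (fun y => (f y).1) /\ continuous (fun y => (f y).2).
  move=> cf; split=> y.
    have cfst (z : R * R) : {for z, continuous (@fst R R)} by exact: cvg_fst.
    exact: (continuous_comp (cf y) (cfst _)).
  have csnd (z : R * R) : {for z, continuous (@snd R R)} by exact: cvg_snd.
  exact: (continuous_comp (cf y) (csnd _)).
have d v y : is_derive y v F ('D_v F y).
  by apply: derivableP; exact: diff_derivable.
have E1 v : (fun y => 'D_v (fun y => (F y).1) y) = (fun y => ('D_v F y).1).
  by apply/funext => y; have [[_ ->] _] := is_derive_pair (d v y).
have E2 v : (fun y => 'D_v (fun y => (F y).2) y) = (fun y => ('D_v F y).2).
  by apply/funext => y; have [_ [_ ->]] := is_derive_pair (d v y).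
have mk (f : R * R -> R) : Z2periodic f ->
    C1 f (fun y => 'D_((1, 0) : R * R) f y) (fun y => 'D_((0, 1) : R * R) f y) ->
    continuous f -> exists f1 f2, C1per f f1 f2.
  move=> fp fC cff; exists (fun y => 'D_((1, 0) : R * R) f y), (fun y => 'D_((0, 1) : R * R) f y).
  have [cc1 cc2 _ _] := fC.
  split; last exact: fC.
  - by split; [exact: fp|exact: cff].
  - by split; [exact: derive_periodic|exact: cc1].
  - by split; [exact: derive_periodic|exact: cc2].
have [cF1 cF2] := cf _ cF; have [c11 c12] := cf _ c1; have [c21 c22] := cf _ c2.
split; apply: mk; [by move=> y k; rewrite Fp| |exact: cF1|by move=> y k; rewrite Fp| |exact: cF2].
- apply: derivable_C1 => [y|y||].
  + by have [[]] := is_derive_pair (d (1, 0) y).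
  + by have [[]] := is_derive_pair (d (0, 1) y).
  + by rewrite E1; exact: c11.
  + by rewrite E1; exact: c21.
- apply: derivable_C1 => [y|y||].
  + by have [_ []] := is_derive_pair (d (1, 0) y).
  + by have [_ []] := is_derive_pair (d (0, 1) y).
  + by rewrite E2; exact: c12.
  + by rewrite E2; exact: c22.
Qed.

End periodic.

(** * Trajectories of Lipschitz fields *)

Section ode.
Context {R : realType}.
Implicit Types (y z : R * R) (g h : R -> R * R).

Definition dcurve g (t : R) (v : R * R) : Prop :=
  is_derive t (1 : R) (fun s => (g s).1) v.1 /\
  is_derive t (1 : R) (fun s => (g s).2) v.2.

Definition trajectory (B : R * R -> R * R) g : Prop :=
  forall t, dcurve g t (B (g t)).

Definition lipschitz1 (L : R) (B : R * R -> R * R) : Prop :=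
  forall y z, `|(B y).1 - (B z).1| <= L * dist1 y z /\
              `|(B y).2 - (B z).2| <= L * dist1 y z.

Lemma dcurve_chain f f1 f2 g t v : C1 f f1 f2 -> dcurve g t v ->
  is_derive t (1 : R) (fun s => f (g s)) (f1 (g t) * v.1 + f2 (g t) * v.2).
Proof.
move=> fC [g1 g2]; have := C1_chain fC g1 g2.
rewrite -surjective_pairing; apply: is_derive_ext => s.
by rewrite -surjective_pairing.
Qed.

Lemma dcurve_reparam g (r : R -> R) t v d : dcurve g (r t) v ->
  is_derive t (1 : R) r d -> dcurve (fun s => g (r s)) t (v.1 * d, v.2 * d).
Proof.
move=> [g1 g2] rd; split => /=.
  exact: (derComp g1 rd).
exact: (derComp g2 rd).
Qed.

Lemma dcurve_shift g t v x : dcurve g t v -> dcurve (fun s => g s + x) t v.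
Proof.
move=> [g1 g2]; split.
  by rewrite -[v.1]addr0; apply: (derD g1 (derC x.1 t)).
by rewrite -[v.2]addr0; apply: (derD g2 (derC x.2 t)).
Qed.

Lemma dcurve_dist1 g v (M : R) a b :
    (forall t, dcurve g t (v t)) ->
    (forall t, `|(v t).1| <= M /\ `|(v t).2| <= M) ->
  dist1 (g a) (g b) <= 2 * M * `|a - b|.
Proof.
move=> gd vM; rewrite -mulrA mulrDl mul1r /dist1; apply: lerD.
  exact: (@der_lip _ (fun s => (g s).1) (fun t => (v t).1) M
    (fun t => (gd t).1) (fun t => (vM t).1)).
exact: (@der_lip _ (fun s => (g s).2) (fun t => (v t).2) M
    (fun t => (gd t).2) (fun t => (vM t).2)).
Qed.

Lemma dist1xx y : dist1 y y = 0.
Proof. by rewrite /dist1 !subrr normr0 addr0. Qed.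

(** Gronwall's inequality is applied to the squared Euclidean distance plus
    the square of the defect [kappa], which makes it homogeneous. *)
Lemma curve_gronwall g h v w L kappa T : 0 <= L -> 0 <= kappa ->
    (forall t, dcurve g t (v t)) -> (forall t, dcurve h t (w t)) ->
    (forall t, `|t| <= T ->
      `|(v t).1 - (w t).1| <= L * dist1 (g t) (h t) + kappa /\
      `|(v t).2 - (w t).2| <= L * dist1 (g t) (h t) + kappa) ->
  forall t, `|t| <= T -> dist1 (g t) (h t) ^+ 2 <=
    2 * (dist1 (g 0) (h 0) ^+ 2 + kappa ^+ 2) * expR ((4 * L + 2) * `|t|).
Proof.
move=> L0 k0 gd hd vw t tT.
pose e1 s := (g s).1 - (h s).1; pose e2 s := (g s).2 - (h s).2.
pose q s := e1 s * e1 s + e2 s * e2 s + kappa ^+ 2.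
pose d1 s := (v s).1 - (w s).1; pose d2 s := (v s).2 - (w s).2.
have e1d s : is_derive s (1 : R) e1 (d1 s) := derB (gd s).1 (hd s).1.
have e2d s : is_derive s (1 : R) e2 (d2 s) := derB (gd s).2 (hd s).2.
have qd s : is_derive s (1 : R) q
    (d1 s * e1 s + e1 s * d1 s + (d2 s * e2 s + e2 s * d2 s) + 0).
  exact: derD (derD (derM (e1d s) (e1d s)) (derM (e2d s) (e2d s))) (derC _ s).
have sq s : dist1 (g s) (h s) ^+ 2 <= 2 * (e1 s * e1 s + e2 s * e2 s) /\
    e1 s * e1 s + e2 s * e2 s <= dist1 (g s) (h s) ^+ 2.
  rewrite /dist1 -!/(e1 s) -!/(e2 s) -!expr2 -[e1 s ^+ 2]real_normK ?num_real //.
  rewrite -[e2 s ^+ 2]real_normK ?num_real //.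
  have := sqr_ge0 (`|e1 s| - `|e2 s|).
  have : 0 <= `|e1 s| * `|e2 s| by rewrite mulr_ge0.
  by rewrite !expr2; lra.
have qk s : `|s| <= T ->
    `|d1 s * e1 s + e1 s * d1 s + (d2 s * e2 s + e2 s * d2 s) + 0|
    <= (4 * L + 2) * q s.
  move=> sT; have [h1 h2] := vw s sT; have [s1 s2] := sq s.
  have -> : d1 s * e1 s + e1 s * d1 s + (d2 s * e2 s + e2 s * d2 s) + 0
    = 2 * (e1 s * d1 s + e2 s * d2 s) by ring.
  rewrite normrM (ger0_norm (_ : 0 <= 2)) //.
  set m := dist1 (g s) (h s) in h1 h2 s1 s2 *.
  have m0 : 0 <= m := dist1_ge0 _ _.
  have b0 : 0 <= L * m + kappa by rewrite addr_ge0 ?mulr_ge0.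
  apply: (@le_trans _ _ (2 * (m * (L * m + kappa)))).
    rewrite ler_wpM2l //; apply: le_trans (ler_normD _ _) _.
    by rewrite !normrM /m /dist1 mulrDl; apply: lerD; apply: ler_wpM2l.
  have : 0 <= (m - kappa) ^+ 2 by exact: sqr_ge0.
  have : 0 <= L * (2 * (e1 s * e1 s + e2 s * e2 s) - m ^+ 2).
    by rewrite mulr_ge0 // subr_ge0.
  have : 0 <= L * kappa ^+ 2 by rewrite mulr_ge0 ?sqr_ge0.
  have : 0 <= kappa ^+ 2 by exact: sqr_ge0.
  by rewrite /q !expr2; lra.
have := gronwall qd qk tT.
have [s1 _] := sq t; have [_ s2] := sq 0.
have E0 : 0 < expR ((4 * L + 2) * `|t|) by exact: expR_gt0.
move=> Q; apply: le_trans s1 _.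
rewrite -mulrA ler_pM2l //; apply: le_trans (_ : q t <= _).
  by rewrite /q lerDl sqr_ge0.
by apply: le_trans Q _; rewrite ler_pM2r // /q lerD2r.
Qed.

Lemma curve_unique g h v w L T : 0 <= L ->
    (forall t, dcurve g t (v t)) -> (forall t, dcurve h t (w t)) ->
    (forall t, `|t| <= T ->
      `|(v t).1 - (w t).1| <= L * dist1 (g t) (h t) /\
      `|(v t).2 - (w t).2| <= L * dist1 (g t) (h t)) ->
  g 0 = h 0 -> forall t, `|t| <= T -> g t = h t.
Proof.
move=> L0 gd hd vw gh t tT.
have := curve_gronwall L0 (lexx 0) gd hd _ tT.
rewrite gh dist1xx expr0n /= addr0 mulr0 mul0r => H.
apply: dist1_eq0; rewrite leNgt; apply/negP => /(exprn_gt0 2); apply/negP.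
by rewrite -leNgt; apply: H => s sT; rewrite addr0; exact: vw.
Qed.

Lemma trajectory_lip B L g h t : 0 <= L -> lipschitz1 L B ->
  trajectory B g -> trajectory B h ->
  dist1 (g t) (h t) ^+ 2 <= 2 * dist1 (g 0) (h 0) ^+ 2 * expR ((4 * L + 2) * `|t|).
Proof.
move=> L0 BL gB hB.
have := curve_gronwall L0 (lexx 0) gB hB _ (lexx `|t|).
rewrite expr0n /= addr0; apply => s _; rewrite addr0; exact: BL.
Qed.

Lemma trajectory_unique B L g h : 0 <= L -> lipschitz1 L B ->
  trajectory B g -> trajectory B h -> g 0 = h 0 -> g =1 h.
Proof.
move=> L0 BL gB hB gh t.
by apply: (curve_unique L0 gB hB _ gh (lexx `|t|)) => s _; exact: BL.
Qed.

(** The intervals of radius [e n] around [a n] are nested, and the supremum of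
    their left ends is a common point. *)
Lemma geometric_limit (a : nat -> R) c :
    (forall n, `|a n.+1 - a n| <= c * 2^-1 ^+ n) ->
  exists l, forall n, `|a n - l| <= 2 * c * 2^-1 ^+ n.
Proof.
move=> ac; pose e n : R := 2 * c * 2^-1 ^+ n.
have eS n : e n.+1 = e n - c * 2^-1 ^+ n by rewrite /e exprS; field.
have c0 : 0 <= c by have := ac 0; rewrite expr0 mulr1; exact: le_trans.
have e0 n : 0 <= e n by rewrite /e !mulr_ge0 // exprn_ge0 // invr_ge0.
have up m n : (m <= n)%N -> a m - e m <= a n - e n /\ a n + e n <= a m + e m.
  elim: n => [|n IH]; first by rewrite leqn0 => /eqP ->.
  rewrite leq_eqVlt => /predU1P[-> //|/IH[h1 h2]].
  by have := ac n; rewrite ler_norml eS => /andP[]; lra.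
have lu m n : a m - e m <= a n + e n.
  have [h1 _] := up _ _ (leq_maxl m n); have [_ h2] := up _ _ (leq_maxr m n).
  by have := e0 (maxn m n); lra.
pose S := range (fun n => a n - e n).
have Sne : S !=set0 by exists (a 0 - e 0); exists 0.
have Sub n : ubound S (a n + e n) by move=> _ [m _ <-]; exact: lu.
have Ssup : has_sup S by split => //; exists (a 0 + e 0).
exists (sup S) => n; rewrite -/(e n) ler_norml.
have : a n - e n <= sup S by apply: (sup_upper_bound Ssup); exists n.
have : sup S <= a n + e n by apply: ge_sup.
by lra.
Qed.

Lemma half_pow_small (c e : R) : 0 < e -> exists n, c * 2^-1 ^+ n < e.
Proof.
move=> e0; have [n] : exists n, `|c / e| < (2 : R) ^+ n.
  exists (Num.truncn `|c / e|).+1.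
  have := truncnS_gt `|c / e| ; move/lt_le_trans; apply.
  by rewrite -natrX ler_nat ltnW // ltn_expl.
move=> h; exists n; have p0 : 0 < (2 : R) ^+ n by rewrite exprn_gt0.
rewrite exprVn ltr_pdivrMr // -ltr_pdivrMl // mulrC.
by apply: le_lt_trans h; exact: ler_norm.
Qed.

(** The gain behind Picard iteration: with the weight [exp (4 L |t|)] the
    integral operator of an [L]-Lipschitz field is a contraction of ratio 1/2
    on the whole line at once. *)
Lemma weighted_growth (f f' : R -> R) (C L : R) : 0 < L -> 0 <= C ->
    (forall t, is_derive t (1 : R) f (f' t)) ->
    (forall t, `|f' t| <= L * C * expR (4 * L * `|t|)) -> f 0 = 0 ->
  forall t, `|f t| <= C / 4 * expR (4 * L * `|t|).
Proof.
move=> L0 C0.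
have ed (c x : R) : is_derive x (1 : R) (fun s => C / 4 * expR (c * s))
    (C / 4 * (expR (c * x) * c)).
  apply: derZ; apply: derExp; rewrite -[X in is_derive _ _ _ X]mulr1.
  exact: derZ (derI x).
have pos (g g' : R -> R) : (forall t, is_derive t (1 : R) g (g' t)) ->
    (forall t, `|g' t| <= L * C * expR (4 * L * `|t|)) -> g 0 = 0 ->
    forall t, 0 <= t -> g t <= C / 4 * expR (4 * L * `|t|).
  move=> gd gb g0 t t0.
  have E x : C / 4 * (expR (4 * L * x) * (4 * L)) = L * C * expR (4 * L * x) by field.
  have := @der_le _ g _ _ _ 0 t t0 (fun x _ => gd x) (fun x _ => ed (4 * L) x) _.
  rewrite g0 subr0 mulr0 expR0 mulr1 (ger0_norm t0) => up.
  apply: le_trans (up _) _; last by rewrite lerBlDr lerDl divr_ge0.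
  move=> x /andP[x0 _]; rewrite E -{2}(ger0_norm x0); apply: le_trans (gb x).
  by rewrite ler_norm.
have pos2 (g g' : R -> R) : (forall t, is_derive t (1 : R) g (g' t)) ->
    (forall t, `|g' t| <= L * C * expR (4 * L * `|t|)) -> g 0 = 0 ->
    forall t, 0 <= t -> `|g t| <= C / 4 * expR (4 * L * `|t|).
  move=> gd gb g0 t t0; rewrite ler_norml (pos _ _ gd gb) // andbT lerNl.
  apply: (pos _ _ (fun t => derN (gd t))) => //; last by rewrite g0 oppr0.
  by move=> s; rewrite normrN.
move=> fd fb f0 t; have [t0|t0] := leP 0 t; first exact: (pos2 _ _ fd fb).
have := @pos2 (fun s => f (- s)) (fun s => - f' (- s)) _ _ _ (- t).
rewrite opprK normrN oppr0; apply => //.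
- by move=> s; apply: derOpp.
- by move=> s; rewrite normrN -(normrN s).
- by rewrite oppr_ge0 ltW.
Qed.

End ode.

(** * Global existence of trajectories *)

Section picard.
Context {R : realType}.

Lemma cont_eps1P (f : R -> R) t : {for t, continuous f} <->
  forall e : R, 0 < e -> exists2 d : R, 0 < d &
    forall s, `|t - s| < d -> `|f t - f s| < e.
Proof.
split=> [/cvgrPdist_lt fy e e0|fy].
  have /nbhs_ballP[d /= d0 dP] := fy e e0.
  by exists d => // z yz; apply: dP.
apply/cvgrPdist_lt => e e0; have [d d0 dP] := fy e e0.
by apply/nbhs_ballP; exists d => // z /= yz; apply: dP.
Qed.

Lemma lipschitz1_cont (L : R) B : 0 < L -> lipschitz1 L B ->
  continuous (fun y : R * R => (B y).1) /\ continuous (fun y : R * R => (B y).2).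
Proof.
move=> L0 BL; split=> y; apply/cont_epsP => e e0; exists (e / L);
  rewrite ?divr_gt0 // => z; rewrite ltr_pdivlMr // mulrC;
  by apply: le_lt_trans; case: (BL y z).
Qed.

Lemma cont_comp2 (f : R * R -> R) (g1 g2 : R -> R) :
  continuous f -> continuous g1 -> continuous g2 ->
  continuous (fun s => f (g1 s, g2 s)).
Proof.
move=> cf c1 c2 t; apply: (@continuous_comp _ _ _ (fun s => (g1 s, g2 s)) f).
  exact: (cvg_pair (c1 t) (c2 t)).
exact: cf.
Qed.

Lemma cont_slice_v (f : R * R -> R) a : continuous f -> continuous (fun q => f (a, q)).
Proof.
move=> cf; apply: (cont_comp2 (g1 := fun=> a) (g2 := id) cf) => t.
  exact: cst_continuous.
exact: cvg_id.
Qed.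

Lemma cont_slice_h (f : R * R -> R) b : continuous f -> continuous (fun r => f (r, b)).
Proof.
move=> cf; apply: (cont_comp2 (g1 := id) (g2 := fun=> b) cf) => t.
  exact: cvg_id.
exact: cst_continuous.
Qed.

Lemma cont_curve (f : R * R -> R) (g : R -> R * R) : continuous f ->
  continuous (fun s => (g s).1) -> continuous (fun s => (g s).2) ->
  continuous (fun s => f (g s)).
Proof.
move=> cf c1 c2; have := cont_comp2 cf c1 c2.
by under eq_fun do rewrite -surjective_pairing.
Qed.

Lemma dcurve_cont (g v : R -> R * R) : (forall t, dcurve g t (v t)) ->
  continuous (fun s => (g s).1) /\ continuous (fun s => (g s).2).
Proof.
move=> gd; split=> t; have [g1 g2] := gd t.
  exact: der_cont g1.
exact: der_cont g2.
Qed.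

(** The Picard iterates converge geometrically for the weighted distance, hence
    locally uniformly; their limit is continuous and is fixed by the integral
    operator. *)
Theorem picard (L : R) B (x : R * R) : 0 < L -> lipschitz1 L B ->
  exists g, g 0 = x /\ trajectory B g.
Proof.
move=> L0 BL; have [cB1 cB2] := lipschitz1_cont L0 BL.
pose good (g : R -> R * R) :=
  continuous (fun s => (g s).1) /\ continuous (fun s => (g s).2).
pose b1 (g : R -> R * R) s := (B (g s)).1; pose b2 (g : R -> R * R) s := (B (g s)).2.
have gb1 g : good g -> continuous (b1 g) by case=> *; exact: (cont_curve cB1).
have gb2 g : good g -> continuous (b2 g) by case=> *; exact: (cont_curve cB2).
pose pic g t := (x.1 + prim (b1 g) t, x.2 + prim (b2 g) t).
have gpic g : good g -> good (pic g).
  move=> gg; split=> t; rewrite /pic /=.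
    by apply: cvgD; [exact: cvg_cst|exact: (der_cont (prim_der t (gb1 _ gg)))].
  by apply: cvgD; [exact: cvg_cst|exact: (der_cont (prim_der t (gb2 _ gg)))].
pose it n := iter n pic (fun=> x).
have git n : good (it n).
  elim: n => [|n /gpic //]; split=> t; exact: cst_continuous.
pose C := (`|(B x).1| + `|(B x).2|) / L.
have C0 : 0 <= C by rewrite divr_ge0 ?addr_ge0 // ltW.
pose W (t : R) : R := expR (4 * L * `|t|).
have W0 t : 0 < W t := expR_gt0 _.
have W1 t : 1 <= W t by rewrite -expR0 ler_expR !mulr_ge0 // ltW.
have Wle s t : `|s| <= `|t| -> W s <= W t.
  by move=> st; rewrite ler_expR ler_pM2l // mulr_gt0.
have p0 n : 0 <= (2^-1 : R) ^+ n by rewrite exprn_ge0 // invr_ge0.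
have step g h c : good g -> good h -> 0 <= c ->
    (forall t, dist1 (g t) (h t) <= c * W t) ->
    forall t, dist1 (pic g t) (pic h t) <= c / 2 * W t.
  move=> gg gh c0 gh_c t.
  have := weighted_growth L0 c0 (fun s => derB (prim_der s (gb1 _ gg)) (prim_der s (gb1 _ gh))).
  have := weighted_growth L0 c0 (fun s => derB (prim_der s (gb2 _ gg)) (prim_der s (gb2 _ gh))).
  rewrite /dist1 /pic /= !prim0; try by [exact: gb1|exact: gb2].
  rewrite subrr => w2 w1.
  have E (a b d : R) : a + b - (a + d) = b - d by ring.
  rewrite !E; have -> : c / 2 * W t = c / 4 * W t + c / 4 * W t by field.
  apply: lerD; [apply: w1 => // s|apply: w2 => // s].
    apply: le_trans (BL _ _).1 _; rewrite -mulrA ler_pM2l //; exact: gh_c.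
  apply: le_trans (BL _ _).2 _; rewrite -mulrA ler_pM2l //; exact: gh_c.
have dit n t : dist1 (it n.+1 t) (it n t) <= C * 2^-1 ^+ n * W t.
  elim: n t => [|n IH] t; last first.
    apply: le_trans (step _ _ _ (git n.+1) (git n) _ IH t) _.
      by rewrite mulr_ge0.
    by rewrite exprSr mulrA.
  rewrite expr0 mulr1.
  have c0 (c : R) : continuous (fun _ : R => c) by move=> s; exact: cst_continuous.
  have w1 := weighted_growth L0 C0 (fun s => prim_der s (c0 (B x).1)).
  have w2 := weighted_growth L0 C0 (fun s => prim_der s (c0 (B x).2)).
  rewrite /dist1 /it /= !(addrC x.1) !(addrC x.2) !addrK.
  apply: le_trans (_ : C / 4 * W t + C / 4 * W t <= _).
    have LC : L * C = `|(B x).1| + `|(B x).2|.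
      by rewrite /C mulrC divfK // gt_eqF.
    apply: lerD; [apply: w1|apply: w2] => [s||s|]; try exact: prim0.
      by rewrite LC -[leLHS]mulr1; apply: ler_pM => //; [rewrite lerDl|exact: W1].
    by rewrite LC -[leLHS]mulr1; apply: ler_pM => //; [rewrite lerDr|exact: W1].
  have : 0 <= C * W t by rewrite mulr_ge0 // ltW.
  by lra.
have lim t : exists l : R * R, forall n, `|(it n t).1 - l.1| <= 2 * (C * W t) * 2^-1 ^+ n /\
    `|(it n t).2 - l.2| <= 2 * (C * W t) * 2^-1 ^+ n.
  have [l1 h1] := @geometric_limit _ (fun n => (it n t).1) (C * W t)
    (fun n => le_trans (dist1_fst _ _) (eq_ind _ (fun z => _ <= z) (dit n t) _ (mulrAC _ _ _))).
  have [l2 h2] := @geometric_limit _ (fun n => (it n t).2) (C * W t)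
    (fun n => le_trans (dist1_snd _ _) (eq_ind _ (fun z => _ <= z) (dit n t) _ (mulrAC _ _ _))).
  by exists (l1, l2) => n; split; [exact: h1|exact: h2].
have {lim}[y yP] : exists y : R -> R * R, forall t n,
    `|(it n t).1 - (y t).1| <= 2 * (C * W t) * 2^-1 ^+ n /\
    `|(it n t).2 - (y t).2| <= 2 * (C * W t) * 2^-1 ^+ n.
  by exists (fun t => projT1 (cid (lim t))) => t; exact: (projT2 (cid (lim t))).
have ulim (a : nat -> R -> R) (l : R -> R) : (forall n, continuous (a n)) ->
    (forall t n, `|a n t - l t| <= 2 * (C * W t) * 2^-1 ^+ n) -> continuous l.
  move=> ca al t; apply/cont_eps1P => e e0.
  have e3 : 0 < e / 3 by rewrite divr_gt0.
  have [n nP] := half_pow_small (2 * (C * W (`|t| + 1))) e3.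
  have [d d0 dP] := (cont_eps1P _ t).1 (ca n t) _ e3.
  exists (Num.min d 1); first by rewrite lt_min d0 ltr01.
  move=> s; rewrite lt_min => /andP[/dP ats ts1].
  have bnd r : `|r| <= `|t| + 1 -> `|a n r - l r| < e / 3.
    move=> rt; apply: le_lt_trans (al _ _) _; apply: le_lt_trans nP.
    rewrite ler_wpM2r // ler_wpM2l // ler_wpM2l // Wle //.
    by rewrite (ger0_norm (_ : 0 <= `|t| + 1)) ?addr_ge0.
  have h1 := bnd t ltac:(by rewrite lerDl).
  have h2 : `|a n s - l s| < e / 3.
    apply: bnd; have := ler_normB t (t - s); rewrite opprB addrC subrK; lra.
  have -> : l t - l s = - (a n t - l t) + (a n s - l s) + (a n t - a n s) by ring.
  apply: le_lt_trans (ler_normD _ _) _.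
  by have := ler_normD (- (a n t - l t)) (a n s - l s); rewrite normrN; lra.
have yg : good y.
  split.
    exact: (ulim (fun n t => (it n t).1) _ (fun n => (git n).1) (fun t n => (yP t n).1)).
  exact: (ulim (fun n t => (it n t).2) _ (fun n => (git n).2) (fun t n => (yP t n).2)).
have dy n t : dist1 (it n t) (y t) <= 4 * (C * W t) * 2^-1 ^+ n.
  by have [] := yP t n; rewrite /dist1; lra.
have eq0 (a t : R) : (forall n, `|a| <= (2 + L * 4 * `|t|) * (C * W t) * 2^-1 ^+ n) -> a = 0.
  move=> aP; apply/eqP; rewrite -normr_le0 leNgt; apply/negP => a0.
  by have [n] := half_pow_small ((2 + L * 4 * `|t|) * (C * W t)) a0; rewrite ltNge aP.
have pd n t s : `|s| <= `|t| -> L * dist1 (it n s) (y s) <= L * (4 * (C * W t) * 2^-1 ^+ n).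
  move=> st; rewrite ler_pM2l //; apply: le_trans (dy _ _) _.
  by rewrite ler_wpM2r // !ler_wpM2l // Wle.
have Ey : y = pic y.
  apply/funext => t; suff [E1 E2] : (y t).1 - (x.1 + prim (b1 y) t) = 0 /\
      (y t).2 - (x.2 + prim (b2 y) t) = 0.
    rewrite [LHS]surjective_pairing.
    by move/eqP: E1; rewrite subr_eq0 => /eqP ->; move/eqP: E2; rewrite subr_eq0 => /eqP ->.
  have hp n : 2 * (C * W t) * 2^-1 ^+ n.+1 <= 2 * (C * W t) * 2^-1 ^+ n.
    rewrite exprS; have : 0 <= 2 * (C * W t) * 2^-1 ^+ n.
      by apply: mulr_ge0 (p0 n); apply: mulr_ge0 => //; exact: mulr_ge0 C0 (ltW (W0 t)).
    by lra.
  split; apply: (eq0 _ t) => n.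
    have h1 := (yP t n.+1).1; rewrite /= in h1.
    have h2 := prim_dist (gb1 _ (git n)) (gb1 _ yg)
      (fun s st => le_trans (BL (it n s) (y s)).1 (pd n t s st)).
    have -> : (y t).1 - (x.1 + prim (b1 y) t) =
      - (x.1 + prim (b1 (it n)) t - (y t).1) + (prim (b1 (it n)) t - prim (b1 y) t) by ring.
    apply: le_trans (ler_normD _ _) _; rewrite normrN.
    by have := hp n; lra.
  have h1 := (yP t n.+1).2; rewrite /= in h1.
  have h2 := prim_dist (gb2 _ (git n)) (gb2 _ yg)
    (fun s st => le_trans (BL (it n s) (y s)).2 (pd n t s st)).
  have -> : (y t).2 - (x.2 + prim (b2 y) t) =
    - (x.2 + prim (b2 (it n)) t - (y t).2) + (prim (b2 (it n)) t - prim (b2 y) t) by ring.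
  apply: le_trans (ler_normD _ _) _; rewrite normrN.
  by have := hp n; lra.
exists y; split.
  by rewrite Ey /pic !prim0 ?addr0 -?surjective_pairing //; [exact: gb2|exact: gb1].
move=> t; rewrite /dcurve; split.
  have := derD (derC x.1 t) (prim_der t (gb1 _ yg)); rewrite add0r.
  by apply: is_derive_ext => s; rewrite {2}Ey.
have := derD (derC x.2 t) (prim_der t (gb2 _ yg)); rewrite add0r.
by apply: is_derive_ext => s; rewrite {2}Ey.
Qed.

End picard.

(** * Flows *)

Section flows.
Context {R : realType}.
Implicit Types (x y z : R * R) (B : R * R -> R * R) (F : R -> R * R -> R * R).

Definition flow_of B F : Prop := forall x, F 0 x = x /\ trajectory B (F ^~ x).

Definition periodic_field B : Prop := forall y k, B (y + intvec k) = B y.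

Lemma flow_exists B (L : R) : 0 < L -> lipschitz1 L B -> exists F, flow_of B F.
Proof.
move=> L0 BL; have e x := picard x L0 BL.
exists (fun t x => projT1 (cid (e x)) t) => x.
by have [] := projT2 (cid (e x)).
Qed.

Lemma C1per_lipschitz1 f f1 f2 g g1 g2 : C1per f f1 f2 -> C1per g g1 g2 ->
  exists2 L : R, 0 < L & lipschitz1 L (fun y => (f y, g y)).
Proof.
move=> /C1per_lip[L1 L10 h1] /C1per_lip[L2 L20 h2].
exists (L1 + L2) => [|y z /=]; first exact: addr_gt0.
by split; [apply: le_trans (h1 y z) _|apply: le_trans (h2 y z) _];
  rewrite ler_wpM2r ?dist1_ge0 //; lra.
Qed.

Section properties.
Context (B : R * R -> R * R) (L : R) (F : R -> R * R -> R * R).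
Context (L0 : 0 < L) (BL : lipschitz1 L B) (FB : flow_of B F).

Lemma flow0 x : F 0 x = x. Proof. by have [] := FB x. Qed.

Lemma flow_der x t : dcurve (F ^~ x) t (B (F t x)).
Proof. by have [_] := FB x; exact. Qed.

Lemma flowD s t x : F (s + t) x = F s (F t x).
Proof.
have h1 : trajectory B (fun r => F (r + t) x).
  by move=> r; have [h1 h2] := flow_der x (r + t); split; exact: derShift.
by apply: (trajectory_unique (ltW L0) BL h1 (flow_der _)); rewrite flow0 add0r.
Qed.

Lemma flow_periodic : periodic_field B ->
  forall t x k, F t (x + intvec k) = F t x + intvec k.
Proof.
move=> Bp t x k.
have h : trajectory B (fun r => F r x + intvec k).
  by move=> r; rewrite Bp; apply: dcurve_shift; exact: flow_der.
by apply: (trajectory_unique (ltW L0) BL (flow_der _) h); rewrite !flow0.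
Qed.

Definition flow_growth (t : R) : R := 2 * expR ((4 * L + 2) * `|t|) + 1.

Lemma flow_growth_ge1 t : 1 <= flow_growth t.
Proof. by rewrite lerDr mulr_ge0 // expR_ge0. Qed.

Lemma flow_growth_le (s t : R) : `|s| <= `|t| -> flow_growth s <= flow_growth t.
Proof.
move=> st; rewrite lerD2r ler_pM2l // ler_expR ler_wpM2l //.
by rewrite addr_ge0 // mulr_ge0 // ltW.
Qed.

Lemma flow_lip t x y : dist1 (F t x) (F t y) <= flow_growth t * dist1 x y.
Proof.
have := trajectory_lip t (ltW L0) BL (flow_der x) (flow_der y).
rewrite !flow0; set e := expR _ => h.
have e0 : 0 < e := expR_gt0 _.
rewrite -(@ler_pXn2r _ 2) ?nnegrE ?dist1_ge0 //; last first.
  by rewrite mulr_ge0 ?dist1_ge0 // (le_trans ler01) // flow_growth_ge1.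
apply: le_trans h _; rewrite exprMn mulrAC ler_wpM2r ?sqr_ge0 //.
by rewrite /flow_growth -/e; nra.
Qed.

Lemma flow_cont t : continuous (fun x => (F t x).1) /\ continuous (fun x => (F t x).2).
Proof.
have G0 : 0 < flow_growth t := lt_le_trans ltr01 (flow_growth_ge1 t).
split=> x; apply/cont_epsP => e e0; exists (e / flow_growth t);
  rewrite ?divr_gt0 // => z; rewrite ltr_pdivlMr // mulrC => h;
  apply: le_lt_trans h; apply: le_trans (flow_lip t x z).
- exact: dist1_fst.
- exact: dist1_snd.
Qed.

End properties.

Lemma per_comp_flow B (L : R) F f t : 0 < L -> lipschitz1 L B ->
  flow_of B F -> periodic_field B -> C0sharp f -> C0sharp (fun x => f (F t x) : R).
Proof.
move=> L0 BL FB Bp [fp fc]; split=> [x k|x].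
  by rewrite (flow_periodic L0 BL FB Bp) fp.
have [c1 c2] := flow_cont L0 BL FB t.
have -> : (fun x => f (F t x)) = f \o (fun x => ((F t x).1, (F t x).2)).
  by apply/funext => z /=; rewrite -surjective_pairing.
apply: continuous_comp; last exact: fc.
exact: (cvg_pair (c1 x) (c2 x)).
Qed.

End flows.

(** * The leaf flow and the transversal flow *)

Section leaves.
Context {R : realType} (u u1 u2 u11 u12 u22 : R * R -> R).
Context (uC : C1 u u1 u2) (u1C : C1per u1 u11 u12) (u2C : C1per u2 u12 u22).
Context (gu0 : forall y, 0 < u1 y * u1 y + u2 y * u2 y).
Context (xi : R * R).
Context (u_shift : forall y k, u (y + intvec k) = u y + dot xi (intvec k)).
Context (xi_irr : forall k : int * int, k != 0 -> dot xi (intvec k) != 0).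

(** Its orbits are the level lines of [u], called leaves. *)
Definition leaf_field y : R * R := (u2 y, - u1 y).

Definition nsq y : R := u1 y * u1 y + u2 y * u2 y.

(** The gradient of [u] divided by its squared length, so that [u] grows at unit
    speed along the flow. *)
Definition trans_field y : R * R := (u1 y * (nsq y)^-1, u2 y * (nsq y)^-1).

Definition nsq1 y := u11 y * u1 y + u1 y * u11 y + (u12 y * u2 y + u2 y * u12 y).
Definition nsq2 y := u12 y * u1 y + u1 y * u12 y + (u22 y * u2 y + u2 y * u22 y).

Lemma nsq_C1 : C1per nsq nsq1 nsq2.
Proof. exact: C1perD (C1perM u1C u1C) (C1perM u2C u2C). Qed.

Lemma nsq_neq0 y : nsq y != 0. Proof. by rewrite gt_eqF // gu0. Qed.

Definition trans_field11 y := u11 y * (nsq y)^-1 + u1 y * (- nsq1 y / nsq y ^+ 2).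
Definition trans_field12 y := u12 y * (nsq y)^-1 + u1 y * (- nsq2 y / nsq y ^+ 2).
Definition trans_field21 y := u12 y * (nsq y)^-1 + u2 y * (- nsq1 y / nsq y ^+ 2).
Definition trans_field22 y := u22 y * (nsq y)^-1 + u2 y * (- nsq2 y / nsq y ^+ 2).

Lemma trans1_C1 : C1per (fun y => (trans_field y).1) trans_field11 trans_field12.
Proof. exact: C1perM u1C (C1perV nsq_C1 nsq_neq0). Qed.

Lemma trans2_C1 : C1per (fun y => (trans_field y).2) trans_field21 trans_field22.
Proof. exact: C1perM u2C (C1perV nsq_C1 nsq_neq0). Qed.

Lemma leaf_lipschitz : exists2 L : R, 0 < L & lipschitz1 L leaf_field.
Proof. exact: C1per_lipschitz1 u2C (C1perN u1C). Qed.

Lemma trans_lipschitz : exists2 L : R, 0 < L & lipschitz1 L trans_field.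
Proof. exact: C1per_lipschitz1 trans1_C1 trans2_C1. Qed.

Lemma leaf_periodic : periodic_field leaf_field.
Proof.
have [[p1 _] _ _ _] := u1C; have [[p2 _] _ _ _] := u2C.
by move=> y k; rewrite /leaf_field p1 p2.
Qed.

Lemma leaf_bounded : exists2 M : R, 0 < M &
  forall y, `|u1 y| <= M /\ `|u2 y| <= M.
Proof.
have [/per_bounded[M1 M10 h1] _ _ _] := u1C.
have [/per_bounded[M2 M20 h2] _ _ _] := u2C.
exists (M1 + M2) => [|y]; first exact: addr_gt0.
by have := h1 y; have := h2 y; split; lra.
Qed.

Lemma trans_bounded : exists2 M : R, 0 < M &
  forall y, `|(trans_field y).1| <= M /\ `|(trans_field y).2| <= M.
Proof.
have [/per_bounded[M1 M10 h1] _ _ _] := trans1_C1.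
have [/per_bounded[M2 M20 h2] _ _ _] := trans2_C1.
exists (M1 + M2) => [|y]; first exact: addr_gt0.
by have := h1 y; have := h2 y; split => /=; lra.
Qed.

Context (S T : R -> R * R -> R * R).
Context (S_flow : flow_of leaf_field S) (T_flow : flow_of trans_field T).

Lemma u_leaf t x : u (S t x) = u x.
Proof.
rewrite -[in RHS](flow0 S_flow x); apply/eqP; rewrite -subr_eq0 -normr_le0.
have := @der_lip _ (fun s => u (S s x)) (fun=> 0) 0 _ _ 0 t.
rewrite mul0r; apply => [s|s]; last by rewrite normr0.
have := dcurve_chain uC (flow_der S_flow x s).
by rewrite /= mulrN mulrC subrr.
Qed.

Lemma u_trans c x : u (T c x) = u x + c.
Proof.
have h s : is_derive s (1 : R) (fun s => u (T s x)) 1.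
  have := dcurve_chain uC (flow_der T_flow x s).
  by rewrite /= !mulrA -mulrDl mulfV // nsq_neq0.
have h' s : is_derive s (1 : R) (fun s => u x + s) 1.
  by rewrite -[X in is_derive _ _ _ X]add0r; exact: derD (derC (u x) s) (derI s).
by apply: (der_eq h h'); rewrite (flow0 T_flow) addr0.
Qed.

Lemma leaf_speed a b x : forall M, (forall y, `|u1 y| <= M /\ `|u2 y| <= M) ->
  dist1 (S a x) (S b x) <= 2 * M * `|a - b|.
Proof.
move=> M uM; apply: dcurve_dist1 (fun t => flow_der S_flow x t) _ => t /=.
by have [h1 h2] := uM (S t x); rewrite normrN.
Qed.

Lemma trans_speed a b x : forall M,
  (forall y, `|(trans_field y).1| <= M /\ `|(trans_field y).2| <= M) ->
  dist1 (T a x) (T b x) <= 2 * M * `|a - b|.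
Proof.
move=> M uM.
exact: (dcurve_dist1 a b (fun t => flow_der T_flow x t) (fun t => uM _)).
Qed.

(** Inside a small ball the gradient is nearly constant, so the leaf through
    [z] crosses the normal line through any nearby point [z'], and [u] is
    injective on that line inside the ball.  The uniform constants come from
    periodicity. *)
Lemma leaf_local : exists2 r0 : R, 0 < r0 & forall z z', u z' = u z ->
  dist1 z z' < r0 -> exists t : R, `|t| <= 1 /\ z' = S t z.
Proof.
have [M M0 uM] := leaf_bounded.
have [n0 n00 n0P] : exists2 m, 0 < m & forall y, m <= nsq y.
  by have [nC _ _ _] := nsq_C1; apply: per_pos_min nC _ => y; exact: gu0.
pose e := Num.min (Num.min 1 (n0 / 4)) (n0 / (8 * M)).
have e0 : 0 < e by rewrite !lt_min ltr01 !divr_gt0 // mulr_gt0.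
have e1 : e <= 1 by rewrite !ge_min lexx.
have en : e <= n0 / 4 by rewrite !ge_min lexx orbT.
have eM : e * (8 * M) <= n0 by rewrite -ler_pdivlMr ?mulr_gt0 // ge_min lexx orbT.
have [u1c _ _ _] := u1C; have [u2c _ _ _] := u2C.
have [d1 d10 d1P] := per_ucont u1c e0; have [d2 d20 d2P] := per_ucont u2c e0.
pose d := Num.min d1 d2.
have d0 : 0 < d by rewrite lt_min d10 d20.
pose t0 := Num.min 1 (d / (8 * M)).
have t00 : 0 < t0 by rewrite lt_min ltr01 divr_gt0 // mulr_gt0.
have t01 : t0 <= 1 by rewrite ge_min lexx.
have t0M : t0 * (8 * M) <= d by rewrite -ler_pdivlMr ?mulr_gt0 // ge_min lexx orbT.
pose r0 := Num.min (d / 4) (t0 * n0 / (4 * M)).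
have r00 : 0 < r0 by rewrite lt_min !divr_gt0 // mulr_gt0.
have r0d : r0 <= d / 4 by rewrite ge_min lexx.
have r0M : r0 * (4 * M) <= t0 * n0.
  by rewrite -ler_pdivlMr ?mulr_gt0 // ge_min lexx orbT.
exists r0 => // z z' uzz' zz'.
have near y : dist1 z y < d -> `|u1 z - u1 y| < e /\ `|u2 z - u2 y| < e.
  by rewrite lt_min => /andP[/d1P ? /d2P ?].
pose p1 := u1 z; pose p2 := u2 z.
have [p1M p2M] : `|p1| <= M /\ `|p2| <= M := uM z.
have pn : n0 <= p1 * p1 + p2 * p2 := n0P z.
have Sz t : `|t| <= t0 -> dist1 z (S t z) <= d / 4.
  move=> tt; have := leaf_speed 0 t z uM; rewrite (flow0 S_flow) sub0r normrN.
  move=> h; apply: le_trans h _.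
  have : 2 * M * `|t| <= 2 * M * t0 by rewrite ler_wpM2l // mulr_ge0 // ltW.
  by lra.
pose f t := (z'.1 - (S t z).1) * p2 - (z'.2 - (S t z).2) * p1.
pose f' t := - (u2 (S t z) * p2 + u1 (S t z) * p1).
have fd t : is_derive t (1 : R) f (f' t).
  have [h1 h2] := flow_der S_flow z t.
  have := derB (derM (derB (derC z'.1 t) h1) (derC p2 t))
               (derM (derB (derC z'.2 t) h2) (derC p1 t)).
  rewrite /f; congr (is_derive _ _ _ _); rewrite /f' /=; ring.
have f'n t : `|t| <= t0 -> f' t <= - (n0 / 2).
  move=> tt; have [] := near (S t z); first by apply: le_lt_trans (Sz t tt) _; lra.
  rewrite -/p1 -/p2 => q1 q2.
  have h1 : `|(p1 - u1 (S t z)) * p1| <= e * M by rewrite normrM ler_pM // ltW.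
  have h2 : `|(p2 - u2 (S t z)) * p2| <= e * M by rewrite normrM ler_pM // ltW.
  have := ler_norm ((p1 - u1 (S t z)) * p1).
  have := ler_norm ((p2 - u2 (S t z)) * p2).
  by rewrite /f'; lra.
have f0 : `|f 0| <= t0 * n0 / 4.
  rewrite /f (flow0 S_flow); apply: le_trans (ler_normB _ _) _; rewrite !normrM.
  have h1 : `|z'.1 - z.1| * `|p2| <= `|z'.1 - z.1| * M by rewrite ler_wpM2l.
  have h2 : `|z'.2 - z.2| * `|p1| <= `|z'.2 - z.2| * M by rewrite ler_wpM2l.
  have h3 : dist1 z z' * M <= r0 * M by rewrite ler_wpM2r // ltW.
  rewrite /dist1 (distrC z.1) (distrC z.2) in h3; lra.
have tn x : - t0 <= x <= t0 -> `|x| <= t0 by rewrite ler_norml.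
have fp : f t0 <= 0.
  have [c [/andP[c1 c2] E]] := der_MVT (ltW t00) (fun x _ => fd x).
  have := f'n c ltac:(apply: tn; lra).
  have := ler_norm (f 0); rewrite subr0 in E; nra.
have fm : 0 <= f (- t0).
  have mt : - t0 <= 0 by rewrite oppr_le0 ltW.
  have [c [/andP[c1 c2] E]] := der_MVT mt (fun x _ => fd x).
  have := f'n c ltac:(apply: tn; lra).
  have := ler_norm (- f 0); rewrite normrN; nra.
have fc : {within `[- t0, t0], continuous f}.
  by apply: continuous_subspaceT => x; exact: der_cont (fd x).
have [||t tt ft] := IVT (v := 0) _ fc; first by lra.
  by rewrite ge_min le_max fp fm orbT.
rewrite in_itv /= in tt; have {}tt := tn _ tt.
exists t; split; first exact: le_trans tt t01.
pose w := S t z; pose v1 := z'.1 - w.1; pose v2 := z'.2 - w.2.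
have vp : v1 * p2 = v2 * p1 by apply/eqP; rewrite -subr_eq0; apply/eqP.
have [c [c' [wc wc' E]]] := C1_incr w z' uC.
move: E; rewrite uzz' /w u_leaf subrr -/w -/v1 -/v2 => /esym E.
have wz' : dist1 w z' <= d / 2.
  by have := dist1_tri w z z'; have := Sz t tt; rewrite (dist1C z) -/w; lra.
have [q1 _] : `|u1 z - u1 c| < e /\ `|u2 z - u2 c| < e.
  by apply: near; have := dist1_tri z w c; have := Sz t tt; rewrite -/w; lra.
have [_ q2] : `|u1 z - u1 c'| < e /\ `|u2 z - u2 c'| < e.
  by apply: near; have := dist1_tri z w c'; have := Sz t tt; rewrite -/w; lra.
have pv : `|p1 * v1 + p2 * v2| <= e * (`|v1| + `|v2|).
  have -> : p1 * v1 + p2 * v2 = (p1 - u1 c) * v1 + (p2 - u2 c') * v2.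
    by rewrite !mulrBl addrACA -opprD E subr0.
  apply: le_trans (ler_normD _ _) _; rewrite !normrM mulrDr.
  by apply: lerD; apply: ler_wpM2r => //; exact: ltW.
have sq : (p1 * v1 + p2 * v2) ^+ 2 = (p1 * p1 + p2 * p2) * (v1 ^+ 2 + v2 ^+ 2).
  have : (v1 * p2 - v2 * p1) ^+ 2 = 0 by rewrite vp subrr expr0n.
  by rewrite !expr2; lra.
have : (p1 * v1 + p2 * v2) ^+ 2 <= e ^+ 2 * (2 * (v1 ^+ 2 + v2 ^+ 2)).
  rewrite -real_normK ?num_real //; apply: le_trans (_ : (e * (`|v1| + `|v2|)) ^+ 2 <= _).
    by rewrite ler_pXn2r ?nnegrE // mulr_ge0 ?addr_ge0 // ltW.
  rewrite exprMn ler_wpM2l ?sqr_ge0 // -(real_normK (num_real v1)) -(real_normK (num_real v2)).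
  have := sqr_ge0 (`|v1| - `|v2|); rewrite !expr2; lra.
rewrite sq => h; have v0 : v1 ^+ 2 + v2 ^+ 2 <= 0.
  rewrite leNgt; apply/negP => vpos.
  have : (p1 * p1 + p2 * p2) * (v1 ^+ 2 + v2 ^+ 2) <= (e ^+ 2 * 2) * (v1 ^+ 2 + v2 ^+ 2) by rewrite -mulrA.
  rewrite ler_pM2r // => h'; have : e ^+ 2 <= e by rewrite expr2 ler_piMr // ltW.
  by lra.
have v10 : v1 = 0.
  apply/eqP; rewrite -sqrf_eq0; have := sqr_ge0 v1; have := sqr_ge0 v2.
  by move=> ? ?; apply/eqP; lra.
have v20 : v2 = 0.
  apply/eqP; rewrite -sqrf_eq0; have := sqr_ge0 v1; have := sqr_ge0 v2.
  by move=> ? ?; apply/eqP; lra.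
rewrite -/w [z']surjective_pairing [w]surjective_pairing.
by move/eqP: v10; rewrite subr_eq0 => /eqP ->; move/eqP: v20; rewrite subr_eq0 => /eqP ->.
Qed.

End leaves.

(** * Level sets as leaves *)

Section leaf_space.
Context {R : realType} (u u1 u2 u11 u12 u22 : R * R -> R).
Context (uC : C1 u u1 u2) (u1C : C1per u1 u11 u12) (u2C : C1per u2 u12 u22).
Context (gu0 : forall y, 0 < u1 y * u1 y + u2 y * u2 y).
Context (xi : R * R).
Context (u_shift : forall y k, u (y + intvec k) = u y + dot xi (intvec k)).
Context (xi_irr : forall k : int * int, k != 0 -> dot xi (intvec k) != 0).
Context (S T : R -> R * R -> R * R).
Context (S_flow : flow_of (leaf_field u1 u2) S).
Context (T_flow : flow_of (trans_field u1 u2) T).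

(** Level sets of [u] are single leaves: pushing the segment from [y] to [y']
    into the level set along the transversal flow gives a path in that level
    set, which is covered by finitely many small balls.  Their number, hence
    the time needed, depends on the distance only. *)
Lemma leaf_connected (D : R) : exists2 C : R, 0 <= C & forall y y',
  u y' = u y -> dist1 y y' <= D -> exists t : R, `|t| <= C /\ y' = S t y.
Proof.
have [r0 r00 loc] := leaf_local uC u1C u2C gu0 S_flow.
have [M M0 uM] := leaf_bounded u1C u2C.
have [K K0 tK] := trans_bounded u1C u2C gu0.
have [L L0 TL] := trans_lipschitz u1C u2C gu0.
pose E := flow_growth L (M * D).
have E1 : 1 <= E := flow_growth_ge1 _ _.
pose Q := (E + 2 * K * M) * `|D| + 1.
have Q0 : 0 < Q.
  by rewrite ltr_wpDl // mulr_ge0 // addr_ge0 ?(le_trans ler01 E1) // !mulr_ge0 // ltW.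
pose m := (Num.truncn (Q / r0)).+1.
have mQ : Q < m%:R * r0 by rewrite -ltr_pdivrMr // truncnS_gt.
exists m%:R => // y y' uyy' yy'.
have D0 : 0 <= D := le_trans (dist1_ge0 _ _) yy'.
pose z (th : R) : R * R := (y.1 + th * (y'.1 - y.1), y.2 + th * (y'.2 - y.2)).
have zd a b : dist1 (z a) (z b) <= D * `|a - b|.
  rewrite /dist1 /z /=.
  have e (p q : R) : p + a * q - (p + b * q) = q * (a - b) by ring.
  rewrite !e !normrM -mulrDl ler_wpM2r //.
  by rewrite (distrC y'.1) (distrC y'.2); exact: yy'.
have uz a b : `|u (z a) - u (z b)| <= M * D * `|a - b|.
  have [c [c' [_ _ ->]]] := C1_incr (z b) (z a) uC.
  rewrite -mulrA; apply: le_trans (_ : M * dist1 (z a) (z b) <= _).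
    apply: le_trans (ler_normD _ _) _; rewrite !normrM /dist1 mulrDr.
    by apply: lerD; apply: ler_wpM2r => //; [have [] := uM c|have [] := uM c'].
  by rewrite ler_wpM2l // ltW.
pose q th := T (u y - u (z th)) (z th).
have uq th : u (q th) = u y by rewrite /q (u_trans uC gu0 T_flow) addrC subrK.
have z0 : z 0 = y by rewrite /z !mul0r !addr0 -surjective_pairing.
have z1 : z 1 = y'.
  have e (p r : R) : p + 1 * (r - p) = r by ring.
  by rewrite /z !e -surjective_pairing.
have q0 : q 0 = y by rewrite /q z0 subrr (flow0 T_flow).
have q1 : q 1 = y' by rewrite /q z1 uyy' subrr (flow0 T_flow).
have qd a b : 0 <= a <= 1 -> dist1 (q a) (q b) <= (E + 2 * K * M) * D * `|a - b|.
  move=> a01; apply: le_trans (dist1_tri _ (T (u y - u (z a)) (z b)) _) _.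
  rewrite mulrDl mulrDl; apply: lerD.
    apply: le_trans (flow_lip L0 TL T_flow _ _ _) _.
    rewrite -mulrA; apply: ler_pM => //.
    - by rewrite (le_trans ler01) // flow_growth_ge1.
    - exact: dist1_ge0.
    - apply: flow_growth_le => //; rewrite -z0.
      apply: le_trans (uz _ _) _; rewrite sub0r normrN.
      rewrite (ger0_norm (_ : 0 <= M * D)) ?mulr_ge0 ?(ltW M0) // ler_piMr ?mulr_ge0 ?(ltW M0) //.
      by rewrite ger0_norm; case/andP: a01.
  apply: le_trans (trans_speed T_flow _ _ _ tK) _.
  have -> : u y - u (z a) - (u y - u (z b)) = - (u (z a) - u (z b)) by ring.
  by rewrite normrN -!mulrA !ler_pM2l // mulrA; exact: uz.
have m0 : 0 < m%:R :> R by rewrite ltr0n.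
have chain j : (j <= m)%N -> exists t : R, `|t| <= j%:R /\ q (j%:R / m%:R) = S t y.
  elim: j => [|j IH] jm; first by exists 0; rewrite mul0r q0 (flow0 S_flow) normr0.
  have [t [tj qt]] := IH (ltnW jm).
  have [||s [s1 qs]] := loc (q (j%:R / m%:R)) (q (j.+1%:R / m%:R)).
  - by rewrite !uq.
  - apply: le_lt_trans (qd _ _ _) _.
      by rewrite divr_ge0 //= ler_pdivrMr // mul1r ler_nat ltnW.
    have -> : j%:R / m%:R - j.+1%:R / m%:R = - m%:R^-1 :> R by rewrite -natr1; ring.
    rewrite normrN ger0_norm ?invr_ge0 ?ler0n // ltr_pdivrMr // mulrC (mulrC r0).
    by apply: le_lt_trans mQ; rewrite mulrC /Q (ger0_norm D0) lerDl.
  have [SL SL0 SLP] := leaf_lipschitz u1C u2C.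
  exists (s + t); split; last by rewrite (flowD SL0 SLP S_flow) -qt.
  by rewrite -natr1 addrC; apply: le_trans (ler_normD _ _) _; rewrite lerD.
have [t [tm]] := chain m (leqnn m).
by rewrite mulfV ?gt_eqF // q1 => e; exists t.
Qed.

(** A periodic leaf would be bounded, whereas irrationality produces points of
    the same level set arbitrarily far away. *)
Lemma leaf_injective x a b : S a x = S b x -> a = b.
Proof.
have [SL SL0 SLP] := leaf_lipschitz u1C u2C.
have Sadd := flowD SL0 SLP S_flow.
have [M M0 uM] := leaf_bounded u1C u2C.
have [K K0 tK] := trans_bounded u1C u2C gu0.
move=> Sab; apply/eqP; rewrite -subr_eq0; apply/negPn/negP => p0.
pose p := a - b; pose x0 := S b x.
have Sp : S p x0 = x0 by rewrite /x0 -Sadd subrK.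
have SpN : S (- p) x0 = x0 by rewrite -{1}Sp -Sadd addNr (flow0 S_flow).
have Spn (n : nat) : S (n%:R * p) x0 = x0.
  elim: n => [|n IH]; first by rewrite mul0r (flow0 S_flow).
  by rewrite -natr1 mulrDl mul1r Sadd Sp.
have Spm (n : nat) : S (n%:R * - p) x0 = x0.
  elim: n => [|n IH]; first by rewrite mul0r (flow0 S_flow).
  by rewrite -natr1 mulrDl mul1r Sadd SpN.
have Spz (n : int) : S (n%:~R * p) x0 = x0.
  by case: n => n; [exact: Spn|rewrite NegzE mulrNz mulNr -mulrN; exact: Spm].
have bnd t : dist1 (S t x0) x0 <= 2 * M * `|p|.
  pose n := Num.floor (t / p).
  have -> : S t x0 = S (t - n%:~R * p) x0.
    by rewrite -{2}(Spz n) -Sadd subrK.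
  rewrite -{2}(flow0 S_flow x0); apply: le_trans (leaf_speed S_flow _ _ _ uM) _.
  rewrite subr0 ler_wpM2l ?mulr_ge0 ?(ltW M0) //.
  have /andP[n1 n2] := floor_itv (t / p); rewrite -/n intrD in n1 n2.
  have -> : t - n%:~R * p = (t / p - n%:~R) * p by rewrite mulrBl divfK.
  rewrite normrM -[leRHS]mul1r ler_wpM2r // ger0_norm ?subr_ge0 //; lra.
have xi1 : xi.1 != 0.
  have := xi_irr (k := (1, 0)) isT; rewrite /dot /intvec /= mulr1 mulr0 addr0.
  exact.
(* Integer vectors of length at least [n] along which [u] changes by at most
   [|xi.1|]. *)
pose far (n : nat) : int * int := (- Num.floor (n%:R * xi.2 / xi.1), n%:Z).
have farb n : `|dot xi (intvec (far n))| <= `|xi.1|.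
  have /andP[n1 n2] := floor_itv (n%:R * xi.2 / xi.1); rewrite intrD in n2.
  have -> : dot xi (intvec (far n)) =
      xi.1 * (n%:R * xi.2 / xi.1 - (Num.floor (n%:R * xi.2 / xi.1))%:~R).
    by rewrite /dot /intvec /= rmorphN /=; field.
  rewrite normrM -[leRHS]mulr1 ler_wpM2l // ger0_norm ?subr_ge0 //; lra.
pose C := 2 * M * `|p| + 2 * K * `|xi.1|.
pose n := (Num.truncn C).+1.
have nC : C < n%:R := truncnS_gt C.
pose y1 := x0 + intvec (far n); pose c := dot xi (intvec (far n)).
pose y2 := T (- c) y1.
have uy2 : u y2 = u x0 by rewrite (u_trans uC gu0 T_flow) u_shift addrK.
have [C' _ con] := leaf_connected (dist1 x0 y2).
have [t [_ y2t]] := con x0 y2 uy2 (lexx _).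
have h1 : dist1 y2 x0 <= 2 * M * `|p| by rewrite y2t; exact: bnd.
have h2 : dist1 y1 y2 <= 2 * K * `|xi.1|.
  rewrite -{1}(flow0 T_flow y1); apply: le_trans (trans_speed T_flow _ _ _ tK) _.
  by rewrite sub0r opprK ler_wpM2l ?mulr_ge0 ?(ltW K0) //; exact: farb.
have h3 : n%:R <= dist1 y1 x0.
  by apply: le_trans (dist1_snd _ _); rewrite /y1 /= addrC addKr ger0_norm.
have := dist1_tri y1 y2 x0; move: nC h1 h2 h3; rewrite /C; clear; lra.
Qed.

(** Both points lie on the same level set of [u], at a distance bounded
    independently of [y]; [leaf_connected] bounds the time between them. *)
Lemma trans_by_period k : exists2 C : R, 0 <= C & forall y, exists t : R,
  `|t| <= C /\ T (dot xi (intvec k)) y = S t y + intvec k.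
Proof.
have [SL SL0 SLP] := leaf_lipschitz u1C u2C.
have [K K0 tK] := trans_bounded u1C u2C gu0.
set s := dot xi (intvec k).
have [C C0 con] := leaf_connected
  (dist1 0 (intvec k : R * R) + 2 * K * `|s|).
exists C => // y; have [||t [tC yt]] := con (y + intvec k) (T s y).
- by rewrite (u_trans uC gu0 T_flow) u_shift.
- apply: le_trans (dist1_tri _ y _) _; apply: lerD.
    by rewrite dist1C -{1}[y]add0r (addrC y) dist1D.
  rewrite -{1}(flow0 T_flow y); apply: le_trans (trans_speed T_flow _ _ _ tK) _.
  by rewrite sub0r normrN.
exists t; split=> //; rewrite yt.
by rewrite (flow_periodic SL0 SLP S_flow (leaf_periodic u1C u2C)).
Qed.

End leaf_space.

(** * Transport of leaves by the transversal flow *)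

Section transverse.
Context {R : realType} (u u1 u2 u11 u12 u22 : R * R -> R).
Context (uC : C1 u u1 u2) (u1C : C1per u1 u11 u12) (u2C : C1per u2 u12 u22).
Context (gu0 : forall y, 0 < u1 y * u1 y + u2 y * u2 y).
Context (xi : R * R).
Context (u_shift : forall y k, u (y + intvec k) = u y + dot xi (intvec k)).
Context (xi_irr : forall k : int * int, k != 0 -> dot xi (intvec k) != 0).
Context (S T : R -> R * R -> R * R).
Context (S_flow : flow_of (leaf_field u1 u2) S).
Context (T_flow : flow_of (trans_field u1 u2) T).

Local Notation trans_field11 := (trans_field11 u1 u2 u11 u12).
Local Notation trans_field12 := (trans_field12 u1 u2 u12 u22).
Local Notation trans_field21 := (trans_field21 u1 u2 u11 u12).
Local Notation trans_field22 := (trans_field22 u1 u2 u12 u22).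

Lemma dot_intvecD (k l : int * int) :
  dot xi (intvec (k + l)) = dot xi (intvec k) + dot xi (intvec l) :> R.
Proof. by rewrite /dot /intvec /= !intrD; ring. Qed.

Lemma dot_intvecZ (k : int * int) (n : int) :
  dot xi (intvec (k.1 * n, k.2 * n)) = dot xi (intvec k) * n%:~R :> R.
Proof. by rewrite /dot /intvec /= !intrM; ring. Qed.

Lemma dot_intvecN (k : int * int) :
  dot xi (intvec (- k)) = - dot xi (intvec k) :> R.
Proof. by rewrite /dot intvecN /= !mulrN opprD. Qed.

(** Euclid's algorithm: a value [s] of the group generated by the coordinates
    of [xi] is never a generator, and a nonzero remainder modulo [s], or its
    complement to [s], is at most [s / 2]. *)
Lemma small_period (e : R) : 0 < e -> exists k : int * int,
  0 < dot xi (intvec k) < e.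
Proof.
have half k : 0 < dot xi (intvec k) -> exists l : int * int,
    0 < dot xi (intvec l) <= dot xi (intvec k) / 2.
  set s := dot xi (intvec k) => s0.
  pose rem l := dot xi (intvec l) - (Num.floor (dot xi (intvec l) / s))%:~R * s.
  have remE l : exists l', dot xi (intvec l') = rem l.
    exists (l + - (k.1 * Num.floor (dot xi (intvec l) / s), k.2 * Num.floor (dot xi (intvec l) / s))).
    by rewrite dot_intvecD dot_intvecN dot_intvecZ -/s mulrC.
  have rem_itv l : 0 <= rem l < s.
    have /andP[n1 n2] := floor_itv (dot xi (intvec l) / s); rewrite intrD in n2.
    have E : rem l = (dot xi (intvec l) / s - (Num.floor (dot xi (intvec l) / s))%:~R) * s.
      by rewrite /rem mulrBl divfK // gt_eqF.
    rewrite E mulr_ge0 ?(ltW s0) ?subr_ge0 //= -[ltRHS]mul1r ltr_pM2r //.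
    by rewrite ltrBlDr addrC.
  have [l l0] : exists l, rem l != 0.
    apply: contrapT => /forallNP z.
    have {}z l : rem l = 0 by have /negP/negPn/eqP := z l.
    have zE l : dot xi (intvec l) = (Num.floor (dot xi (intvec l) / s))%:~R * s.
      by apply/eqP; rewrite -subr_eq0; apply/eqP; exact: z.
    have e1 := zE (1, 0); have e2 := zE (0, 1).
    set m1 := Num.floor _ in e1; set m2 := Num.floor _ in e2.
    have x1 : xi.1 = m1%:~R * s.
      by rewrite -e1 /dot /intvec /= mulr1 mulr0 addr0.
    have x2 : xi.2 = m2%:~R * s.
      by rewrite -e2 /dot /intvec /= mulr1 mulr0 add0r.
    have : dot xi (intvec (m2, - m1)) = 0.
      by rewrite /dot /intvec /= x1 x2 rmorphN /=; ring.
    apply/eqP; have [[m20 m10]|] := eqVneq (m2, - m1) 0; last exact: xi_irr.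
    move/eqP: m10; rewrite oppr_eq0 => /eqP m10.
    have := xi_irr (k := (1, 0)) isT.
    by rewrite /dot /intvec /= x1 m10 mul0r mulr0 mul0r addr0 eqxx.
  have [l' l'E] := remE l; have /andP[r0 rs] := rem_itv l.
  have rpos : 0 < rem l by rewrite lt_neqAle eq_sym l0.
  have [rle|rgt] := leP (rem l) (s / 2).
    by exists l'; rewrite l'E rpos.
  exists (k + - l'); rewrite dot_intvecD dot_intvecN l'E -/s.
  by apply/andP; split; lra.
have [k0 k00] : exists k, 0 < dot xi (intvec k).
  have := xi_irr (k := (1, 0)) isT; rewrite neq_lt => /orP[h|h].
    by exists (- (1, 0)); rewrite dot_intvecN oppr_gt0.
  by exists (1, 0).
have pw n : exists k, 0 < dot xi (intvec k) <= dot xi (intvec k0) * 2^-1 ^+ n.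
  elim: n => [|n [k /andP[k1 k2]]]; first by exists k0; rewrite k00 expr0 mulr1 lexx.
  have [l /andP[l0 lk]] := half k k1; exists l; rewrite l0 /=.
  apply: le_trans lk _; rewrite exprSr mulrA ler_wpM2r // invr_ge0 //.
move=> /(half_pow_small (dot xi (intvec k0)))[n nP].
by have [k /andP[k1 k2]] := pw n; exists k; rewrite k1 (le_lt_trans k2).
Qed.

(** The divergence of the transversal field is the rate at which its flow
    stretches the time parameter of the leaves. *)
Definition stretch y : R := trans_field11 y + trans_field22 y.

Definition jac c y : R := expR (prim (fun r => stretch (T r y)) c).

Lemma stretch_per : C0sharp stretch.
Proof.
have [_ h1 _ _] := trans1_C1 u1C u2C gu0; have [_ _ h2 _] := trans2_C1 u1C u2C gu0.
exact: perD.
Qed.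

Lemma stretch_cont y : continuous (fun r => stretch (T r y)).
Proof.
have [_ sc] := stretch_per; have [c1 c2] := dcurve_cont (flow_der T_flow y).
exact: (cont_curve sc).
Qed.

Lemma jac0 y : jac 0 y = 1.
Proof. by rewrite /jac (prim0 (@stretch_cont y)) expR0. Qed.

Lemma jac_der c y : is_derive c (1 : R) (fun r => jac r y) (jac c y * stretch (T c y)).
Proof. exact: derExp (prim_der c (@stretch_cont y)). Qed.

Lemma prim_norm (f : R -> R) k c : continuous f -> (forall x, `|f x| <= k) ->
  `|prim f c| <= k * `|c|.
Proof.
move=> cf fk; have := @der_lip _ (prim f) f k (fun t => prim_der t cf) fk 0 c.
by rewrite prim0 // !subr0.
Qed.

Lemma jac_bound (K : R) : (forall y, `|stretch y| <= K) -> forall c y,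
  `|jac c y - 1| <= expR (K * `|c|) - 1.
Proof.
move=> sK c y; set a := prim (fun r => stretch (T r y)) c.
have : `|a| <= K * `|c| by apply: prim_norm (@stretch_cont y) _ => r; exact: sK.
rewrite /jac -/a; set m := K * _ => am.
have /andP[a1 a2] : - m <= a <= m by rewrite -ler_norml.
rewrite ler_norml; apply/andP; split; last by rewrite lerD2r ler_expR.
have h : expR (- m) <= expR a by rewrite ler_expR.
have := expR_ge1Dx a; have := expR_ge1Dx m.
have e1 : expR (- m) * expR m = 1 by rewrite -expRD addNr expR0.
have := expR_gt0 (- m); have := expR_gt0 m; move: h e1; clear.
set p := expR (- m); set q := expR m; set r := expR a => h e1 q0 p0 _ _.
have := sqr_ge0 (q - p); rewrite expr2 => sq.
have : 2 <= p + q by nra.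
by lra.
Qed.

(** [jac] is integrated along leaves to obtain the change of parameter. *)
Lemma jac_cont c x : continuous (fun t => jac c (S t x)).
Proof.
have [M M0 uM] := leaf_bounded u1C u2C.
have [L L0 TL] := trans_lipschitz u1C u2C gu0.
have h : continuous (fun t => prim (fun r => stretch (T r (S t x))) c).
  move=> t; apply/cont_eps1P => e e0.
  have c1 : 0 < `|c| + 1 by rewrite ltr_wpDl.
  have e'0 : 0 < e / (`|c| + 1) by rewrite divr_gt0.
  have [d d0 dP] := per_ucont stretch_per e'0.
  pose E := flow_growth L c.
  have E1 : 1 <= E := flow_growth_ge1 _ _.
  have E0 : 0 < E := lt_le_trans ltr01 E1.
  exists (d / (E * (2 * M))); first by rewrite divr_gt0 // !mulr_gt0.
  move=> s; rewrite ltr_pdivlMr ?mulr_gt0 // => ts.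
  have k0 : 0 < e / (`|c| + 1) := e'0.
  apply: le_lt_trans (_ : e / (`|c| + 1) * `|c| < e); last first.
    by rewrite mulrAC ltr_pdivrMr // ltr_pM2l // ltrDl.
  apply: prim_dist; [exact: stretch_cont|exact: stretch_cont|move=> r rc].
  apply/ltW/dP; apply: le_lt_trans (flow_lip L0 TL T_flow _ _ _) _.
  apply: le_lt_trans ts; rewrite mulrCA ler_pM // ?dist1_ge0 //.
  - by rewrite (le_trans ler01) // flow_growth_ge1.
  - exact: flow_growth_le.
  - by rewrite mulrC; exact: (leaf_speed S_flow).
move=> t; apply: (@continuous_comp _ _ _
  (fun t => prim (fun r => stretch (T r (S t x))) c) expR t (h t)).
exact: continuous_expR.
Qed.

(* [fld1] and [fld2] are the two components of the commutation identity
   [stretch B + DB N = DN B] between the leaf field [B] and the transversal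
   field [N]. *)
Let fld1 y : stretch y * u2 y + (u12 y * (trans_field u1 u2 y).1 + u22 y * (trans_field u1 u2 y).2)
   = trans_field11 y * u2 y + trans_field12 y * - u1 y.
Proof.
have n0 : nsq u1 u2 y != 0 by rewrite gt_eqF // gu0.
rewrite /stretch /trans_field11 /trans_field12 /trans_field22 /trans_field /nsq1 /nsq2 /=.
rewrite /nsq in n0 *; field; exact: n0.
Qed.

Let fld2 y : stretch y * - u1 y + - (u11 y * (trans_field u1 u2 y).1 + u12 y * (trans_field u1 u2 y).2)
   = trans_field21 y * u2 y + trans_field22 y * - u1 y.
Proof.
have n0 : nsq u1 u2 y != 0 by rewrite gt_eqF // gu0.
rewrite /stretch /trans_field11 /trans_field21 /trans_field22 /trans_field /nsq1 /nsq2 /=.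
rewrite /nsq in n0 *; field; exact: n0.
Qed.

(** The transversal flow maps leaves to leaves, stretching time by [jac].  The
    first-order approximation [T c y + h jac B(T c y)] of the image of
    [S h y] satisfies the same differential equation up to [o(h)], because the
    two fields satisfy [stretch B + DB N = DN B]; Gronwall concludes. *)
Lemma jac_leaf c x t : dcurve (fun s => T c (S s x)) t
  (jac c (S t x) * u2 (T c (S t x)), jac c (S t x) * - u1 (T c (S t x))).
Proof.
set y := S t x.
have [SL SL0 SLP] := leaf_lipschitz u1C u2C.
have [M M0 uM] := leaf_bounded u1C u2C.
have [L L0 TL] := trans_lipschitz u1C u2C gu0.
have [_ /[dup] p11 /per_bounded[K1 K10 k1] /[dup] p12 /per_bounded[K2 K20 k2] C1N] :=
  trans1_C1 u1C u2C gu0.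
have [_ /[dup] p21 /per_bounded[K3 K30 k3] /[dup] p22 /per_bounded[K4 K40 k4] C2N] :=
  trans2_C1 u1C u2C gu0.
pose K := K1 + K2 + K3 + K4.
have K0 : 0 < K by rewrite !addr_gt0.
pose A := 2 * expR ((4 * K + 2) * `|c|).
have A0 : 0 < A by rewrite mulr_gt0 // expR_gt0.
pose E := flow_growth L c.
have E1 : 1 <= E := flow_growth_ge1 _ _.
have E0 : 0 < E := lt_le_trans ltr01 E1.
have Sh h : S (t + h) x = S h y by rewrite addrC (flowD SL0 SLP S_flow).
suff key : forall e : R, 0 < e -> exists2 r : R, 0 < r & forall h : R, `|h| < r ->
    dist1 (T c (S h y)) ((T c y).1 + h * (jac c y * u2 (T c y)),
                         (T c y).2 + h * (jac c y * - u1 (T c y))) <= e * `|h|.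
  split; apply/is_derive_epsP => e /key[r r0 rP]; exists r => // h /rP;
    apply: le_trans; rewrite Sh -/y.
    apply: le_trans (dist1_fst _ _) => /=.
    by rewrite le_eqVlt; apply/orP; left; apply/eqP; congr `|_|; ring.
  apply: le_trans (dist1_snd _ _) => /=.
  by rewrite le_eqVlt; apply/orP; left; apply/eqP; congr `|_|; ring.
move=> e e0; pose om0 := e / (A + 1).
have A10 : 0 < A + 1 by rewrite addr_gt0.
have om00 : 0 < om0 by rewrite divr_gt0.
pose om := om0 / (E * (2 * M)).
have EM0 : 0 < E * (2 * M) by rewrite !mulr_gt0.
have om_0 : 0 < om by rewrite divr_gt0.
have [d1 d10 d1P] := per_ucont p11 om_0; have [d2 d20 d2P] := per_ucont p12 om_0.
have [d3 d30 d3P] := per_ucont p21 om_0; have [d4 d40 d4P] := per_ucont p22 om_0.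
pose d := Num.min (Num.min d1 d2) (Num.min d3 d4).
have d0 : 0 < d by rewrite !lt_min d10 d20 d30 d40.
have om02 : 0 < om0 / 2 by rewrite divr_gt0.
have [i1 i2] := flow_der S_flow y 0; rewrite (flow0 S_flow) in i1 i2.
have [r1 r10 r1P] := (is_derive_epsP _ _ _).1 i1 _ om02.
have [r2 r20 r2P] := (is_derive_epsP _ _ _).1 i2 _ om02.
exists (Num.min (Num.min r1 r2) (d / (E * (2 * M)))).
  by rewrite !lt_min r10 r20 divr_gt0.
move=> h; rewrite !lt_min => /andP[/andP[/r1P h1 /r2P h2]].
rewrite ltr_pdivlMr // => hd.
rewrite add0r (flow0 S_flow) /= in h1 h2.
pose g r := T r (S h y).
pose hc r := ((T r y).1 + h * (jac r y * u2 (T r y)), (T r y).2 + h * (jac r y * - u1 (T r y))).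
pose v r := trans_field u1 u2 (T r (S h y)).
pose w r := ((trans_field u1 u2 (T r y)).1 +
               h * (jac r y * (trans_field11 (T r y) * u2 (T r y) + trans_field12 (T r y) * - u1 (T r y))),
             (trans_field u1 u2 (T r y)).2 +
               h * (jac r y * (trans_field21 (T r y) * u2 (T r y) + trans_field22 (T r y) * - u1 (T r y)))).
have gd r : dcurve g r (v r) := flow_der T_flow (S h y) r.
have [_ _ _ u1C'] := u1C; have [_ _ _ u2C'] := u2C.
have hcd r : dcurve hc r (w r).
  have [t1 t2] := flow_der T_flow y r.
  have b1 := dcurve_chain u2C' (flow_der T_flow y r).
  have b2 := derN (dcurve_chain u1C' (flow_der T_flow y r)).
  have := derD t1 (derZ h (derM (jac_der r y) b1)).
  have := derD t2 (derZ h (derM (jac_der r y) b2)).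
  rewrite -!(mulrA (jac r y)) -!mulrDr fld1 fld2 => w2 w1.
  by split; [exact: w1|exact: w2].
pose kappa := om * (E * (2 * M) * `|h|).
have kappa0 : 0 <= kappa by rewrite mulr_ge0 ?(ltW om_0) // mulr_ge0 // ltW.
have Dl r : `|r| <= `|c| -> dist1 (T r y) (g r) <= E * (2 * M) * `|h|.
  move=> rc; apply: le_trans (flow_lip L0 TL T_flow _ _ _) _.
  rewrite -mulrA; apply: ler_pM.
  - by rewrite (le_trans ler01) // flow_growth_ge1.
  - exact: dist1_ge0.
  - exact: flow_growth_le.
  - rewrite -{1}(flow0 S_flow y) -normrN -[- h]sub0r.
    exact: (leaf_speed S_flow).
have est (F F1 F2 : R * R -> R) r (dF1 dF2 : R) : C1 F F1 F2 ->
    (forall z z', dist1 z z' < dF1 -> `|F1 z - F1 z'| < om) ->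
    (forall z z', dist1 z z' < dF2 -> `|F2 z - F2 z'| < om) ->
    (forall z, `|F1 z| <= K) -> (forall z, `|F2 z| <= K) ->
    d <= dF1 -> d <= dF2 -> `|r| <= `|c| ->
    `|F (g r) - (F (T r y) + h * (jac r y * (F1 (T r y) * u2 (T r y) + F2 (T r y) * - u1 (T r y))))|
      <= K * dist1 (g r) (hc r) + kappa.
  move=> FC ou1 ou2 F1K F2K dd1 dd2 rc; have Dr := Dl r rc.
  have [c0 [c1 [yc0 yc1 E']]] := C1_incr (T r y) (g r) FC.
  have q1 : `|F1 (T r y) - F1 c0| < om.
    apply: ou1; apply: le_lt_trans yc0 _; apply: le_lt_trans Dr _.
    by rewrite mulrC; exact: lt_le_trans hd dd1.
  have q2 : `|F2 (T r y) - F2 c1| < om.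
    apply: ou2; apply: le_lt_trans yc1 _; apply: le_lt_trans Dr _.
    by rewrite mulrC; exact: lt_le_trans hd dd2.
  set D1 := (g r).1 - (T r y).1 in E'; set D2 := (g r).2 - (T r y).2 in E'.
  have -> : F (g r) - (F (T r y) + h * (jac r y * (F1 (T r y) * u2 (T r y) + F2 (T r y) * - u1 (T r y))))
    = (- ((F1 (T r y) - F1 c0) * D1) - (F2 (T r y) - F2 c1) * D2)
      + (F1 (T r y) * ((g r).1 - (hc r).1) + F2 (T r y) * ((g r).2 - (hc r).2)).
    by rewrite opprD addrA E' /hc /D1 /D2 /=; ring.
  rewrite addrC; apply: le_trans (ler_normD _ _) _; apply: lerD.
    apply: le_trans (ler_normD _ _) _; rewrite !normrM /dist1 mulrDr.
    by apply: lerD; apply: ler_wpM2r.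
  apply: le_trans (ler_normB _ _) _; rewrite normrN !normrM.
  apply: le_trans (_ : om * dist1 (T r y) (g r) <= _); last by rewrite ler_pM2l.
  rewrite /dist1 mulrDr (distrC (T r y).1) (distrC (T r y).2).
  by apply: lerD; apply: ler_wpM2r => //; exact: ltW.
have bK (f : R * R -> R) Ki : (forall z, `|f z| <= Ki) -> Ki <= K -> forall z, `|f z| <= K.
  by move=> fK KK z; exact: le_trans (fK z) KK.
have [KK1 KK2 KK3 KK4] : [/\ K1 <= K, K2 <= K, K3 <= K & K4 <= K].
  by rewrite /K; split; lra.
have [dd1 dd2 dd3 dd4] : [/\ d <= d1, d <= d2, d <= d3 & d <= d4].
  by rewrite /d; split; rewrite !ge_min lexx ?orbT.
have := curve_gronwall (ltW K0) kappa0 gd hcd _ (lexx `|c|).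
rewrite /g /hc !(flow0 T_flow) jac0 !mul1r -/(hc c) => G.
have {}G := G _; set d00 := dist1 (S h y) _ in G.
have d00P : d00 <= om0 * `|h|.
  rewrite /d00 /dist1 /= (splitr om0) mulrDl; apply: lerD.
    by apply: le_trans h1; rewrite le_eqVlt; apply/orP; left; apply/eqP; congr `|_|; ring.
  by apply: le_trans h2; rewrite le_eqVlt; apply/orP; left; apply/eqP; congr `|_|; ring.
have kP : kappa = om0 * `|h|.
  by rewrite /kappa /om mulrA divfK // gt_eqF.
have d000 : 0 <= d00 := dist1_ge0 _ _.
rewrite -(@ler_pXn2r _ 2) ?nnegrE ?dist1_ge0 ?mulr_ge0 ?(ltW e0) //.
apply: le_trans (G _) _.
  move=> r rc; split.
    exact: (est _ _ _ r _ _ C1N d1P d2P (bK _ _ k1 KK1) (bK _ _ k2 KK2) dd1 dd2 rc).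
  exact: (est _ _ _ r _ _ C2N d3P d4P (bK _ _ k3 KK3) (bK _ _ k4 KK4) dd3 dd4 rc).
rewrite kP mulrAC -/A.
have hq : d00 ^+ 2 <= (om0 * `|h|) ^+ 2.
  by rewrite ler_pXn2r ?nnegrE // mulr_ge0 // ltW.
apply: le_trans (_ : A * (2 * (om0 * `|h|) ^+ 2) <= _).
  by rewrite ler_pM2l // mulr2n mulrDl mul1r lerD2r.
have -> : e * `|h| = (A + 1) * (om0 * `|h|).
  by rewrite /om0 mulrA (mulrC (A + 1)) divfK // gt_eqF.
rewrite [leRHS]exprMn mulrA ler_wpM2r ?sqr_ge0 //.
by have := sqr_ge0 A; rewrite !expr2; lra.
Qed.

End transverse.

(** * Divergences have zero mean along leaves *)

Section equidistribution.
Context {R : realType} (u u1 u2 u11 u12 u22 : R * R -> R).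
Context (uC : C1 u u1 u2) (u1C : C1per u1 u11 u12) (u2C : C1per u2 u12 u22).
Context (gu0 : forall y, 0 < u1 y * u1 y + u2 y * u2 y).
Context (xi : R * R).
Context (u_shift : forall y k, u (y + intvec k) = u y + dot xi (intvec k)).
Context (xi_irr : forall k : int * int, k != 0 -> dot xi (intvec k) != 0).
Context (S T : R -> R * R -> R * R).
Context (S_flow : flow_of (leaf_field u1 u2) S).
Context (T_flow : flow_of (trans_field u1 u2) T).

Local Notation stretch := (stretch u1 u2 u11 u12 u22).
Local Notation jac := (jac u1 u2 u11 u12 u22 T).
Local Notation N y := (trans_field u1 u2 y).

(** Zero mean along leaves, with a sublinear bound that is uniform in the leaf.
    Integrals are represented by arbitrary antiderivatives [P]. *)
Definition leaf_negligible (f : R * R -> R) : Prop := forall e : R, 0 < e ->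
  exists2 C : R, 0 <= C & forall x (P : R -> R),
    (forall t, is_derive t (1 : R) P (f (S t x))) ->
    forall t, `|P t - P 0| <= e * `|t| + C.

Section divergence.
Context (beta b1 b2 : R * R -> R) (bC : C1per beta b1 b2).

(** The divergence of the field [beta N]. *)
Definition trans_div y : R := b1 y * (N y).1 + b2 y * (N y).2 + beta y * stretch y.

Lemma trans_div_per : C0sharp trans_div.
Proof.
have [h0 h1 h2 _] := bC; have [n1 _ _ _] := trans1_C1 u1C u2C gu0.
have [n2 _ _ _] := trans2_C1 u1C u2C gu0.
have st := stretch_per u1C u2C gu0.
by apply: perD; [apply: perD; apply: perM|apply: perM].
Qed.

Lemma transported_der c y : is_derive c (1 : R) (fun r => beta (T r y) * jac r y)
  (trans_div (T c y) * jac c y).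
Proof.
have [_ _ _ bC'] := bC.
have := derM (dcurve_chain bC' (flow_der T_flow y c))
  (jac_der u1C u2C gu0 T_flow c y).
by congr (is_derive _ _ _ _); rewrite /trans_div; ring.
Qed.

(** The integrand of the transported leaf integral, to first order in the time
    [s] of the transversal flow. *)
Lemma transported_first_order (e : R) : 0 < e -> exists2 s0 : R, 0 < s0 & forall s y, `|s| < s0 ->
  `|beta (T s y) * jac s y - beta y - s * trans_div y| <= e * `|s|.
Proof.
move=> e0; have Gp := trans_div_per.
have [Gm Gm0 GmP] := per_bounded Gp.
have [K K0 tK] := trans_bounded u1C u2C gu0.
have [K' K'0 sK] := per_bounded (stretch_per u1C u2C gu0).
have e2 : 0 < e / 2 by rewrite divr_gt0.
have [d d0 dP] := per_ucont Gp e2.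
have e3 : 0 < e / 2 / Gm by rewrite divr_gt0.
have [r r0 rP] := (cont_eps1P _ (0 : R)).1 (@continuous_expR R 0) _ e3.
exists (Num.min (d / (2 * K)) (r / K')); first by rewrite lt_min !divr_gt0 // mulr_gt0.
move=> s y; rewrite lt_min !ltr_pdivlMr ?mulr_gt0 // => /andP[sd sr].
have [c [cs]] := der_between 0 s (transported_der ^~ y).
rewrite !subr0 in cs; rewrite !subr0 (flow0 T_flow) (jac0 u1C u2C gu0 T_flow) mulr1 => ->.
have -> : trans_div (T c y) * jac c y * s - s * trans_div y
  = ((trans_div (T c y) - trans_div y) + trans_div (T c y) * (jac c y - 1)) * s by ring.
rewrite normrM ler_wpM2r //; apply: le_trans (ler_normD _ _) _.
rewrite (splitr e); apply: lerD.
  apply/ltW/dP; rewrite -{2}(flow0 T_flow y).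
  apply: le_lt_trans (trans_speed T_flow _ _ _ tK) _.
  by rewrite subr0; apply: le_lt_trans sd; rewrite mulrC ler_wpM2r // mulr_ge0 // ltW.
rewrite normrM; apply: (@le_trans _ _ (Gm * (e / 2 / Gm))); last first.
  by rewrite mulrCA mulfV ?gt_eqF // mulr1.
apply: ler_pM => //; apply: le_trans (jac_bound u1C u2C gu0 T_flow sK c y) _.
apply: le_trans (_ : expR (K' * `|s|) - 1 <= _).
  by rewrite lerD2r ler_expR ler_pM2l.
have := rP (K' * `|s|); rewrite expR0 sub0r normrN normrM normr_id (gtr0_norm K'0).
rewrite mulrC => /(_ sr); rewrite distrC => /ltW; apply: le_trans; exact: ler_norm.
Qed.

(** The transversal flow for time [s = dot xi k] carries each leaf to its
    translate by [k], so it changes leafwise integrals of [beta] by bounded end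
    terms only; on the other hand it changes them at rate [trans_div].  Hence
    [s] times the integral of [trans_div] is bounded up to [o(s)] times the
    length, and [s] can be taken as small as desired. *)
Lemma trans_div_negligible : leaf_negligible trans_div.
Proof.
move=> e e0.
have [s0 s00 first_order] := transported_first_order e0.
have [k /andP[sk ks0]] := small_period xi_irr s00.
(* [r] is the parameter change for which the leaf through [x], transported by
   [T s], is the leaf itself translated by [k]. *)
set s := dot xi (intvec k) in sk ks0.
have [C C0 slide] := trans_by_period uC u1C u2C gu0 u_shift S_flow T_flow k.
have [bp _ _ _] := bC; have [Bm Bm0 BmP] := per_bounded bp.
have [SL SL0 SLP] := leaf_lipschitz u1C u2C.
have Sper := flow_periodic SL0 SLP S_flow (leaf_periodic u1C u2C).
have [K' K'0 sK] := per_bounded (stretch_per u1C u2C gu0).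
have jb c y : `|jac c y| <= expR (K' * `|c|).
  rewrite ger0_norm ?expR_ge0 //.
  have := jac_bound u1C u2C gu0 T_flow sK c y.
  by move=> /(le_trans (ler_norm _)); rewrite lerD2r.
exists (2 * Bm * C / s); first by rewrite divr_ge0 ?mulr_ge0 // ltW.
move=> x P Pd t.
have [sig0 [sig0C Ts0]] := slide x; rewrite -/s in Ts0.
have jc : continuous (fun a => jac s (S a x)) := @jac_cont _ _ _ _ _ _ u1C u2C gu0 _ _ S_flow T_flow s x.
pose r a := sig0 + prim (fun a => jac s (S a x)) a.
have rd a : is_derive a (1 : R) r (jac s (S a x)).
  by rewrite -[jac _ _]add0r; exact: derD (derC sig0 a) (prim_der a jc).
have r0 : r 0 = sig0 by rewrite /r (prim0 jc) addr0.
pose p a := T s (S a x); pose q a := S (r a) x + intvec k.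
have pd a := jac_leaf u1C u2C gu0 S_flow T_flow s x a.
have qd a : dcurve q a (jac s (S a x) * u2 (q a), jac s (S a x) * - u1 (q a)).
  have := dcurve_shift (intvec k) (dcurve_reparam (flow_der S_flow x (r a)) (rd a)).
  rewrite /= -[u2 _]/(leaf_field u1 u2 _).1 -[- u1 _]/(leaf_field u1 u2 _).2.
  by rewrite -(leaf_periodic u1C u2C _ k) mulrC (mulrC (leaf_field _ _ _).2).
have pq a : p a = q a.
  pose L := expR (K' * `|s|) * SL.
  have L0 : 0 <= L by rewrite mulr_ge0 ?expR_ge0 // ltW.
  apply: (curve_unique L0 pd qd _ _ (lexx `|a|)); last first.
    by rewrite /p /q r0 !(flow0 S_flow).
  move=> b _ /=; rewrite -!mulrBr !normrM /L -!mulrA.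
  split; apply: ler_pM => //; [exact: (SLP (p b) (q b)).1|exact: (SLP (p b) (q b)).2].
have rN a : `|r a - a| <= C.
  have [sig [sigC Ts]] := slide (S a x).
  have : S (r a) x = S (sig + a) x.
    rewrite (flowD SL0 SLP S_flow); apply: (addIr (intvec k)).
    by rewrite -Ts -/s -/(q a) -pq.
  move/(leaf_injective uC u1C u2C gu0 u_shift xi_irr S_flow T_flow) => ->.
  by rewrite addrK.
have bS : continuous (fun a => beta (S a x)).
  have [c1 c2] := dcurve_cont (flow_der S_flow x).
  by have [_ bc] := bp; exact: (cont_curve bc).
pose Q := prim (fun a => beta (S a x)).
have Qd a : is_derive a (1 : R) Q (beta (S a x)) := prim_der a bS.
have Qlip a b : `|Q b - Q a| <= Bm * `|b - a| by apply: (der_lip Qd) => c; exact: BmP.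
have Hd a : is_derive a (1 : R) (fun a => Q (r a) - Q a - s * P a)
    (beta (T s (S a x)) * jac s (S a x) - beta (S a x) - s * trans_div (S a x)).
  have bpq : beta (S (r a) x) = beta (T s (S a x)).
    by rewrite -/(p a) pq /q; have [-> _] := bp.
  have := derB (derB (derComp (Qd (r a)) (rd a)) (Qd a)) (derZ s (Pd a)).
  by rewrite bpq.
have Hb a : `|beta (T s (S a x)) * jac s (S a x) - beta (S a x) - s * trans_div (S a x)| <= e * s.
  by have := first_order s (S a x); rewrite (gtr0_norm sk); apply.
have := der_lip Hd Hb 0 t; rewrite subr0.
have q1 : `|Q (r t) - Q t| <= Bm * C.
  by apply: le_trans (Qlip _ _) _; rewrite ler_pM2l.
have q0 : `|Q (r 0) - Q 0| <= Bm * C.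
  by apply: le_trans (Qlip _ _) _; rewrite ler_pM2l.
set D := Q (r t) - Q t in q1 *; set D0 := Q (r 0) - Q 0 in q0 *.
move=> H; rewrite -(@ler_pM2l _ s) // -{1}(gtr0_norm sk) -normrM.
have -> : s * (P t - P 0) = (D - D0) - (D - s * P t - (D0 - s * P 0)) by ring.
apply: le_trans (ler_normB _ _) _.
have -> : s * (e * `|t| + 2 * Bm * C / s) = 2 * Bm * C + e * s * `|t|.
  by field; rewrite gt_eqF.
apply: lerD => //; apply: le_trans (ler_normB _ _) _.
by apply: le_trans (lerD q1 q0) _; rewrite -mulrA mulr2n mulrDl mul1r.
Qed.

End divergence.

Lemma leaf_negligibleD f g : leaf_negligible f -> C0sharp f -> leaf_negligible g ->
  leaf_negligible (fun y => f y + g y).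
Proof.
move=> fn [_ fc] gn e e0; have e2 : 0 < e / 2 by rewrite divr_gt0.
have [C C0 CP] := fn _ e2; have [D D0 DP] := gn _ e2.
exists (C + D) => [|x P Pd t]; first exact: addr_ge0.
have [c1 c2] := dcurve_cont (flow_der S_flow x).
have cf : continuous (fun a => f (S a x)) := cont_curve fc c1 c2.
have h1 := CP x _ (fun t => prim_der t cf) t.
have h2 := DP x (fun s => P s - prim (fun a => f (S a x)) s) _ t.
have {}h2 := h2 (fun s => _).
have gd s : is_derive s (1 : R) (fun s => P s - prim (fun a => f (S a x)) s) (g (S s x)).
  have := derB (Pd s) (prim_der s cf).
  by rewrite addrC addKr.
have {}h2 := h2 gd.
have -> : P t - P 0 = (prim (fun a => f (S a x)) t - prim (fun a => f (S a x)) 0)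
  + (P t - prim (fun a => f (S a x)) t - (P 0 - prim (fun a => f (S a x)) 0)) by ring.
apply: le_trans (ler_normD _ _) _; apply: le_trans (lerD h1 h2) _.
by rewrite addrACA -mulrDl -splitr.
Qed.

Lemma leaf_derivative_negligible (al a1 a2 : R * R -> R) : C1per al a1 a2 ->
  leaf_negligible (fun y => a1 y * u2 y - a2 y * u1 y).
Proof.
move=> [/per_bounded[M M0 MP] _ _ aC] e e0; exists (2 * M) => [|x P Pd t].
  by rewrite mulr_ge0 // ltW.
have h s : is_derive s (1 : R) (fun s => al (S s x) + (P 0 - al (S 0 x)))
    (a1 (S s x) * u2 (S s x) - a2 (S s x) * u1 (S s x)).
  have := derD (dcurve_chain aC (flow_der S_flow x s)) (derC (P 0 - al (S 0 x)) s).
  by rewrite addr0 /= mulrN.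
have PE := der_eq Pd h.
have -> : P t - P 0 = al (S t x) - al (S 0 x).
  by rewrite PE; [ring|rewrite addrC subrK].
apply: le_trans (ler_normB _ _) _; apply: le_trans (lerD (MP _) (MP _)) _.
by rewrite mulr2n mulrDl mul1r lerDr mulr_ge0 // ltW.
Qed.

(** A divergence splits into a derivative along the leaves and a transversal
    divergence, because [leaf_field] is divergence-free. *)
Lemma divergence_negligible (V1 V11 V12 V2 V21 V22 : R * R -> R) :
  C1per V1 V11 V12 -> C1per V2 V21 V22 -> leaf_negligible (fun y => V11 y + V22 y).
Proof.
move=> V1C V2C.
have bC := C1perD (C1perM V1C u1C) (C1perM V2C u2C).
(* In the basis of the two fields, [V = (V . grad u) N + alpha R_perp grad u],
   with [alpha = (V1 u2 - V2 u1) / |grad u|^2]. *)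
have aC := C1perM (C1perD (C1perM V1C u2C) (C1perN (C1perM V2C u1C)))
  (C1perV (nsq_C1 u1C u2C) (nsq_neq0 gu0)).
have h1 := trans_div_negligible bC; have h2 := leaf_derivative_negligible aC.
have := leaf_negligibleD h1 (trans_div_per bC) h2.
congr (leaf_negligible _); apply/funext => y.
have n0 : nsq u1 u2 y != 0 by rewrite gt_eqF // gu0.
rewrite /trans_div /stretch /trans_field11 /trans_field22 /trans_field /nsq1 /nsq2 /=.
rewrite /nsq in n0 *; field; exact: n0.
Qed.

End equidistribution.

(** * Approximation by divergences *)

Section steklov.
Context {R : realType}.

Lemma intvec10 (y : R * R) : y + intvec (1, 0) = (y.1 + 1, y.2).
Proof. by rewrite /intvec /= [LHS]surjective_pairing /= addr0. Qed.

Lemma intvec01 (y : R * R) : y + intvec (0, 1) = (y.1, y.2 + 1).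
Proof. by rewrite /intvec /= [LHS]surjective_pairing /= addr0. Qed.

(** Periodicity with respect to the two unit vectors is what antiderivatives
    give directly. *)
Lemma unit_periodic (f : R * R -> R) : (forall a b, f (a + 1, b) = f (a, b)) ->
  (forall a b, f (a, b + 1) = f (a, b)) -> Z2periodic f.
Proof.
move=> f1 f2.
have n1 (n : nat) a b : f (a + n%:R, b) = f (a, b).
  by elim: n a => [|n IH] a; rewrite ?addr0 // -natr1 addrA f1.
have n2 (n : nat) a b : f (a, b + n%:R) = f (a, b).
  by elim: n b => [|n IH] b; rewrite ?addr0 // -natr1 addrA f2.
have z1 (n : int) a b : f (a + n%:~R, b) = f (a, b).
  case: n => n; first exact: n1.
  by rewrite NegzE mulrNz -[LHS](n1 n.+1) subrK.
have z2 (n : int) a b : f (a, b + n%:~R) = f (a, b).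
  case: n => n; first exact: n2.
  by rewrite NegzE mulrNz -[LHS](n2 n.+1) subrK.
by move=> y k; rewrite [y + _]surjective_pairing /= z1 z2 -surjective_pairing.
Qed.

Lemma C1_periodic (f f1 f2 : R * R -> R) : C1 f f1 f2 -> Z2periodic f ->
  Z2periodic f1 /\ Z2periodic f2.
Proof.
move=> [_ _ d1 d2] fp; have E a b k : f (a + k.1%:~R, b + k.2%:~R) = f (a, b) := fp (a, b) k.
split=> y k.
  have h1 := derShift (d1 (y.1 + k.1%:~R) (y.2 + k.2%:~R)).
  have {h1}h1 := is_derive_ext (fun s => E s y.2 k) h1.
  have h2 := d1 y.1 y.2; rewrite -surjective_pairing in h2.
  by rewrite [y + _]surjective_pairing /= -(@derive_val _ _ _ _ _ _ _ h1) (@derive_val _ _ _ _ _ _ _ h2).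
have h1 := derShift (d2 (y.1 + k.1%:~R) (y.2 + k.2%:~R)).
have {h1}h1 := is_derive_ext (fun s => E y.1 s k) h1.
have h2 := d2 y.1 y.2; rewrite -surjective_pairing in h2.
by rewrite [y + _]surjective_pairing /= -(@derive_val _ _ _ _ _ _ _ h1) (@derive_val _ _ _ _ _ _ _ h2).
Qed.

Lemma C1_C1per (f f1 f2 : R * R -> R) : C1 f f1 f2 -> Z2periodic f -> C1per f f1 f2.
Proof.
move=> fC fp; have [p1 p2] := C1_periodic fC fp; have [c1 c2 _ _] := fC.
by split; [split=> //; exact: C1_cont fC|split|split|].
Qed.

Lemma prim_joint_cont (G : R -> R -> R) (M : R) : (forall a, continuous (G a)) ->
    (forall a b, `|G a b| <= M) ->
    (forall e : R, 0 < e -> exists2 d : R, 0 < d &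
      forall a a' b, `|a - a'| < d -> `|G a b - G a' b| <= e) ->
  continuous (fun y : R * R => prim (G y.1) y.2).
Proof.
move=> Gc GM Ge y; apply/cont_epsP => e e0.
have M0 : 0 <= M := le_trans (normr_ge0 _) (GM 0 0).
have y1 : 0 < `|y.2| + 1 by rewrite ltr_wpDl.
have e2 : 0 < e / 2 / (`|y.2| + 1) by rewrite !divr_gt0.
have [d d0 dP] := Ge _ e2.
have M10 : 0 < M + 1 by rewrite ltr_wpDl.
exists (Num.min d (e / 2 / (M + 1))); first by rewrite lt_min d0 !divr_gt0.
move=> z; rewrite lt_min => /andP[yz1 yz2].
have h1 : `|prim (G y.1) y.2 - prim (G z.1) y.2| <= e / 2.
  apply: le_trans (prim_dist (k := e / 2 / (`|y.2| + 1)) _ _ _) _ => //.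
    by move=> s _; apply: dP; apply: le_lt_trans yz1; exact: dist1_fst.
  by rewrite mulrAC ler_pdivrMr // ler_pM2l ?divr_gt0 // lerDl.
have h2 : `|prim (G z.1) y.2 - prim (G z.1) z.2| < e / 2.
  apply: le_lt_trans (der_lip (fun t => prim_der t (Gc z.1)) (GM z.1) _ _) _.
  apply: le_lt_trans (_ : (M + 1) * dist1 y z < _); last by rewrite mulrC -ltr_pdivlMr.
  by apply: ler_pM => //; [rewrite lerDl|exact: dist1_snd].
have -> : prim (G y.1) y.2 - prim (G z.1) z.2 =
  (prim (G y.1) y.2 - prim (G z.1) y.2) + (prim (G z.1) y.2 - prim (G z.1) z.2) by ring.
by apply: le_lt_trans (ler_normD _ _) _; rewrite (splitr e) ler_ltD.
Qed.

Section primitives.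
Context (F : R * R -> R) (Fp : C0sharp F).

Definition primV (y : R * R) : R := prim (fun q => F (y.1, q)) y.2.
Definition primH (y : R * R) : R := prim (fun r => F (r, y.2)) y.1.
Definition prim2 (y : R * R) : R := prim (fun r => primV (r, y.2)) y.1.

Let cV a : continuous (fun q => F (a, q)).
Proof. by have [_ cF] := Fp; exact: cont_slice_v. Qed.

Let cH b : continuous (fun r => F (r, b)).
Proof. by have [_ cF] := Fp; exact: cont_slice_h. Qed.

Lemma primV_cont : continuous primV.
Proof.
have [M _ FM] := per_bounded Fp.
apply: (prim_joint_cont (G := fun a q => F (a, q)) (M := M)) => //.
move=> e e0; have [d d0 dP] := per_ucont Fp e0.
exists d => // a a' b aa; apply/ltW/dP.
by rewrite /dist1 /= subrr normr0 addr0.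
Qed.

Lemma primH_cont : continuous primH.
Proof.
have [M _ FM] := per_bounded Fp.
have h : continuous (fun y : R * R => prim (fun r => F (r, y.1)) y.2).
  apply: (prim_joint_cont (G := fun b q => F (q, b)) (M := M)) => //.
  move=> e e0; have [d d0 dP] := per_ucont Fp e0.
  exists d => // a a' b aa; apply/ltW/dP.
  by rewrite /dist1 /= subrr normr0 add0r.
move=> y; have /cont_epsP hy := h (y.2, y.1); apply/cont_epsP => e /hy[d d0 dP].
exists d => // z yz; apply: (dP (z.2, z.1)).
by rewrite /dist1 /= addrC.
Qed.

Let cVr b : continuous (fun r => primV (r, b)).
Proof. exact: cont_slice_h primV_cont. Qed.

(** Differentiation under the integral sign, for the derivative in the second
    variable. *)
Lemma prim2_C1 : C1 prim2 primV primH.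
Proof.
split; [exact: primV_cont|exact: primH_cont|move=> a b|move=> a b].
  exact: (prim_der a (@cVr b)).
apply/is_derive_epsP => e e0.
have a1 : 0 < `|a| + 1 by rewrite ltr_wpDl.
have e'0 : 0 < e / (`|a| + 1) by rewrite divr_gt0.
have [d d0 dP] := per_ucont Fp e'0.
exists d => // h hd; rewrite /prim2 /primH /=.
pose g r := primV (r, b) + h * F (r, b).
have cg : continuous g.
  by move=> r; apply: cvgD; [exact: cVr|apply: cvgM; [exact: cvg_cst|exact: cH]].
have -> : prim (fun r => primV (r, b + h)) a - prim (fun r => primV (r, b)) a -
    prim (fun r => F (r, b)) a * h = prim (fun r => primV (r, b + h)) a - prim g a.
  have -> : prim g = fun s => prim (fun r => primV (r, b)) s + h * prim (fun r => F (r, b)) s.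
    apply: prim_uniq => //.
      by rewrite !prim0 ?mulr0 ?addr0.
    by move=> s; exact: derD (prim_der s (@cVr b)) (derZ h (prim_der s (@cH b))).
  by ring.
apply: le_trans (prim_dist (k := e / (`|a| + 1) * `|h|) _ cg _) _ => //.
  move=> r _; rewrite /g /primV /=.
  have [c [ch E]] := der_between b (b + h) (fun s => prim_der s (@cV r)).
  rewrite opprD addrA E addrAC subrr add0r in ch *.
  rewrite mulrC -mulrBr normrM mulrC ler_wpM2r //; apply/ltW/dP.
  by rewrite /dist1 /= subrr normr0 add0r; exact: le_lt_trans ch hd.
have -> : e / (`|a| + 1) * `|h| * `|a| = e * `|h| * (`|a| / (`|a| + 1)) by ring.
by rewrite ler_piMr ?mulr_ge0 ?(ltW e0) // ler_pdivrMr // mul1r lerDl.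
Qed.

Let Fh a b : F (a + 1, b) = F (a, b).
Proof. by have [fp _] := Fp; rewrite -(fp (a, b) (1, 0)) intvec10. Qed.

Let Fv a b : F (a, b + 1) = F (a, b).
Proof. by have [fp _] := Fp; rewrite -(fp (a, b) (0, 1)) intvec01. Qed.

Let prim0fun (f : R -> R) : f =1 (fun=> 0) -> prim f = fun=> 0.
Proof.
move=> /funext ->.
have c0 : continuous (fun _ : R => 0 : R) by move=> t; exact: cst_continuous.
exact: (prim_uniq c0 erefl (fun t => derC 0 t)).
Qed.

Lemma prim2_0h b : prim2 (0, b) = 0. Proof. exact: prim0 (@cVr b). Qed.

Lemma prim2_0v a : prim2 (a, 0) = 0.
Proof. by rewrite /prim2 /= prim0fun // => r; exact: prim0 (@cV r). Qed.

Lemma prim2_periodh a b : prim2 (a + 1, b) = prim2 (a, b) + prim2 (1, b).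
Proof.
have [_ _ d1 _] := prim2_C1.
have h1 s : is_derive s (1 : R) (fun a => prim2 (a + 1, b)) (primV (s, b)).
  have <- : primV (s + 1, b) = primV (s, b).
    by rewrite /primV /=; congr (prim _ _); apply/funext => q; exact: Fh.
  exact: derShift (d1 (s + 1) b).
have h2 s : is_derive s (1 : R) (fun a => prim2 (a, b) + prim2 (1, b)) (primV (s, b)).
  by rewrite -[primV _]addr0; exact: derD (d1 s b) (derC _ s).
by apply: (der_eq h1 h2); rewrite add0r prim2_0h add0r.
Qed.

Lemma prim2_periodv a b : prim2 (a, b + 1) = prim2 (a, b) + prim2 (a, 1).
Proof.
have [_ _ _ d2] := prim2_C1.
have h1 s : is_derive s (1 : R) (fun b => prim2 (a, b + 1)) (primH (a, s)).
  have <- : primH (a, s + 1) = primH (a, s).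
    by rewrite /primH /=; congr (prim _ _); apply/funext => q; exact: Fv.
  exact: derShift (d2 a (s + 1)).
have h2 s : is_derive s (1 : R) (fun b => prim2 (a, b) + prim2 (a, 1)) (primH (a, s)).
  by rewrite -[primH _]addr0; exact: derD (d2 a s) (derC _ s).
by apply: (der_eq h1 h2); rewrite add0r prim2_0v add0r.
Qed.

(** The mean over the unit square, as an iterated integral: this form is
    amenable to differential calculus, and Fubini's theorem identifies it with
    the Lebesgue integral. *)
Definition mean2 : R := prim2 (1, 1).

(** The average of [F] over vertical segments of length [h] is close to [F].
    Minus the mean it is the divergence of [(V1, V2)]: the difference quotient
    in [y.2] of the double antiderivative is differentiated in [y.1], the term
    linear in [y.1] restores horizontal periodicity, and [V2] compensates its
    divergence. *)
Lemma steklov (e : R) : 0 < e -> exists V1 V11 V12 V2 V21 V22,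
  [/\ C1per V1 V11 V12, C1per V2 V21 V22 &
    forall y, `|F y - mean2 - (V11 y + V22 y)| <= e].
Proof.
move=> e0; have [d d0 dP] := per_ucont Fp e0.
pose h := d / 2; have h0 : 0 < h by rewrite divr_gt0.
have hd : h < d by rewrite /h; lra.
have [cA cC d1 d2] := prim2_C1; have c2 := C1_cont prim2_C1.
have c1s : continuous (fun q => prim2 (1, q)) := cont_slice_v c2.
pose G := prim (fun q => prim2 (1, q)).
pose V1 (y : R * R) := (prim2 (y.1, y.2 + h) - prim2 y - y.1 * (prim2 (1, y.2 + h) - prim2 (1, y.2))) / h.
pose V11 (y : R * R) := (primV (y.1, y.2 + h) - primV y - (prim2 (1, y.2 + h) - prim2 (1, y.2))) / h.
pose V12 (y : R * R) := (primH (y.1, y.2 + h) - primH y - y.1 * (primH (1, y.2 + h) - primH (1, y.2))) / h.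
pose V2 (y : R * R) := (G (y.2 + h) - G y.2) / h - mean2 * y.2.
pose V22 (y : R * R) := (prim2 (1, y.2 + h) - prim2 (1, y.2)) / h - mean2.
have cfst : continuous (fun y : R * R => y.1) by move=> y; exact: cvg_fst.
have csnd : continuous (fun y : R * R => y.2) by move=> y; exact: cvg_snd.
have csh : continuous (fun y : R * R => y.2 + h).
  by move=> y; apply: cvgD; [exact: csnd|exact: cvg_cst].
have c1 : continuous (fun y : R * R => 1 : R) by move=> y; exact: cst_continuous.
have cp (f : R * R -> R) (g1 g2 : R * R -> R) : continuous f -> continuous g1 ->
    continuous g2 -> continuous (fun y => f (g1 y, g2 y)).
  move=> cf k1 k2 y; apply: (@continuous_comp _ _ _ (fun s => (g1 s, g2 s)) f).
    exact: (cvg_pair (k1 y) (k2 y)).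
  exact: cf.
have cB (f g : R * R -> R) : continuous f -> continuous g -> continuous (fun y => f y - g y).
  by move=> cf cg y; apply: cvgB; [exact: cf|exact: cg].
have cM (f g : R * R -> R) : continuous f -> continuous g -> continuous (fun y => f y * g y).
  by move=> cf cg y; apply: cvgM; [exact: cf|exact: cg].
have cK (c : R) : continuous (fun y : R * R => c) by move=> y; exact: cst_continuous.
have V1C : C1 V1 V11 V12.
  split.
  - apply: (cM _ _) => //; apply: (cB _ _); first by apply: (cB _ _) => //; exact: (cp primV).
    by apply: (cB _ _); exact: (cp prim2).
  - apply: (cM _ _) => //; apply: (cB _ _); first by apply: (cB _ _) => //; exact: (cp primH).
    by apply: (cM _ _) => //; apply: (cB _ _); exact: (cp primH).
  - move=> a b; rewrite /V1 /V11 /=.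
    have := derM (derB (derB (d1 a (b + h)) (d1 a b))
      (derM (derI a) (derC (prim2 (1, b + h) - prim2 (1, b)) a))) (derC h^-1 a).
    by congr (is_derive _ _ _ _); rewrite /=; ring.
  - move=> a b; rewrite /V1 /V12 /=.
    have := derM (derB (derB (derShift (d2 a (b + h))) (d2 a b))
      (derZ a (derB (derShift (d2 1 (b + h))) (d2 1 b)))) (derC h^-1 b).
    by congr (is_derive _ _ _ _); rewrite /=; ring.
have V2C : C1 V2 (fun=> 0) V22.
  split => //.
  - by apply: (cB _ _) => //; apply: (cM _ _) => //; apply: (cB _ _); exact: (cp prim2).
  - by move=> a b; rewrite /V2 /=; exact: derC.
  - move=> a b; rewrite /V2 /V22 /=.
    have := derB (derM (derB (derShift (prim_der (b + h) c1s)) (prim_der b c1s)) (derC h^-1 b))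
      (derZ mean2 (derI b)).
    by congr (is_derive _ _ _ _); rewrite /=; ring.
have V1p : Z2periodic V1.
  apply: unit_periodic => a b; rewrite /V1 /=.
    by rewrite !(prim2_periodh a); congr (_ / _); ring.
  have s : b + 1 + h = b + h + 1 by ring.
  by rewrite s !(prim2_periodv _ b) !(prim2_periodv _ (b + h)); congr (_ / _); ring.
have Gp x y : G (x + 1) - G x - (G (y + 1) - G y) = mean2 * (x - y).
  have k t : is_derive t (1 : R) (fun s => G (s + 1) - G s) mean2.
    have := derB (derShift (prim_der (t + 1) c1s)) (prim_der t c1s).
    by rewrite prim2_periodv addrC addKr.
  by have [c [_ ->]] := der_between y x k.
have V2p : Z2periodic V2.
  apply: unit_periodic => a b; rewrite /V2 //=.
  have s : b + 1 + h = b + h + 1 by ring.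
  have := Gp (b + h) b; rewrite s => E.
  have -> : G (b + h + 1) = mean2 * h + G (b + h) + G (b + 1) - G b by lra.
  by field; rewrite gt_eqF.
exists V1, V11, V12, V2, (fun=> 0), V22; split.
- exact: C1_C1per.
- exact: C1_C1per.
move=> y; have -> : V11 y + V22 y = (primV (y.1, y.2 + h) - primV y) / h - mean2.
  by rewrite /V11 /V22; ring.
have [c [ch]] := der_between y.2 (y.2 + h) (fun s => prim_der s (@cV y.1)).
rewrite (addrC y.2) addrK in ch *; rewrite (gtr0_norm h0) in ch.
rewrite -/(primV (y.1, h + y.2)) -/(primV y) => ->.
rewrite mulfK ?gt_eqF // opprB addrA subrK; apply/ltW/dP.
by rewrite /dist1 /= subrr normr0 add0r distrC; exact: le_lt_trans ch hd.
Qed.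

End primitives.

End steklov.

(** * Unique ergodicity of the leaf flow *)

Section leaf_average.
Context {R : realType} (u u1 u2 u11 u12 u22 : R * R -> R).
Context (uC : C1 u u1 u2) (u1C : C1per u1 u11 u12) (u2C : C1per u2 u12 u22).
Context (gu0 : forall y, 0 < u1 y * u1 y + u2 y * u2 y).
Context (xi : R * R).
Context (u_shift : forall y k, u (y + intvec k) = u y + dot xi (intvec k)).
Context (xi_irr : forall k : int * int, k != 0 -> dot xi (intvec k) != 0).
Context (S : R -> R * R -> R * R) (S_flow : flow_of (leaf_field u1 u2) S).

(** Up to a uniformly small error [F - mean2 F] is a divergence, and divergences
    are negligible. *)
Lemma leaf_mean F : C0sharp F -> leaf_negligible S (fun y => F y - mean2 F).
Proof.
move=> Fp e e0; have e2 : 0 < e / 2 by rewrite divr_gt0.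
have [L L0 TL] := trans_lipschitz u1C u2C gu0.
have [T T_flow] := flow_exists L0 TL.
have [V1 [V11 [V12 [V2 [V21 [V22 [V1C V2C FV]]]]]]] := steklov Fp e2.
have [C C0 CP] := divergence_negligible uC u1C u2C gu0 u_shift xi_irr S_flow T_flow
  V1C V2C e2.
exists C => // x P Pd t.
have [_ [_ c1] _ _] := V1C; have [_ _ [_ c2] _] := V2C.
have [s1 s2] := dcurve_cont (flow_der S_flow x).
have cV : continuous (fun a => V11 (S a x) + V22 (S a x)).
  by move=> a; apply: cvgD; [exact: (cont_curve c1)|exact: (cont_curve c2)].
pose Q := prim (fun a => V11 (S a x) + V22 (S a x)).
have Qd a : is_derive a (1 : R) Q (V11 (S a x) + V22 (S a x)) := prim_der a cV.
have h1 := CP x Q Qd t.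
have h2 := der_lip (fun a => derB (Pd a) (Qd a)) (fun a => FV (S a x)) 0 t.
rewrite subr0 in h2.
have -> : P t - P 0 = (P t - Q t - (P 0 - Q 0)) + (Q t - Q 0) by ring.
apply: le_trans (ler_normD _ _) _; apply: le_trans (lerD h2 h1) _.
by rewrite addrA -mulrDl -splitr.
Qed.

End leaf_average.

(** * Means as Lebesgue integrals *)

Section measure.
Context {R : realType}.
Local Notation mu1 := (@lebesgue_measure R).

(** Boxes with rational centres and sizes form a countable base, which makes
    open sets measurable for the product of the Borel sigma-algebras. *)
Lemma open_box (U : set (R * R)) : open U -> U = \bigcup_(q : rat * rat * rat)
  [set y | `|ratr q.1.1 - y.1| < ratr q.2 /\ `|ratr q.1.2 - y.2| < ratr q.2 /\
     (forall z : R * R, `|ratr q.1.1 - z.1| < ratr q.2 -> `|ratr q.1.2 - z.2| < ratr q.2 -> U z)].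
Proof.
move=> oU; apply/seteqP; split=> [y Uy|y [q _ [h1 [h2]]]]; last exact.
have /(@nbhs_ballP R (R * R)%type)[e /= e0 eU] : nbhs y U by exact: open_nbhs_nbhs.
have e2 : 0 < e / 2 by rewrite divr_gt0.
have [r] := rat_in_itvoo e2; rewrite in_itv /= => /andP[r0 re].
have [p1] := @rat_in_itvoo R (y.1 - ratr r) (y.1 + ratr r) ltac:(lra).
have [p2] := @rat_in_itvoo R (y.2 - ratr r) (y.2 + ratr r) ltac:(lra).
rewrite !in_itv /= => /andP[a1 a2] /andP[b1 b2].
have k1 : `|ratr p1 - y.1| < ratr r by rewrite ltr_norml; lra.
have k2 : `|ratr p2 - y.2| < ratr r by rewrite ltr_norml; lra.
exists ((p1, p2), r) => //=; split=> //; split=> // z h1 h2; apply: eU; split => /=.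
  have := ler_normB (ratr p1 - z.1) (ratr p1 - y.1).
  by rewrite /ball /= (_ : _ - _ - (_ - _) = y.1 - z.1); [lra|ring].
have := ler_normB (ratr p2 - z.2) (ratr p2 - y.2).
by rewrite /ball /= (_ : _ - _ - (_ - _) = y.2 - z.2); [lra|ring].
Qed.

Lemma open_measurable2 (U : set (R * R)) : open U -> measurable (U : set (mplane R)).
Proof.
move=> /open_box ->; apply: countable_bigcupT_measurable => [|q]; first exact: countableP.
have [h|h] := pselect (forall z : R * R, `|ratr q.1.1 - z.1| < ratr q.2 ->
    `|ratr q.1.2 - z.2| < ratr q.2 -> U z); last first.
  rewrite (_ : [set _ | _] = set0); first exact: measurable0.
  by apply/seteqP; split=> // y [_ []].
rewrite (_ : [set _ | _] = `]ratr q.1.1 - ratr q.2, ratr q.1.1 + ratr q.2[ `*`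
    `]ratr q.1.2 - ratr q.2, ratr q.1.2 + ratr q.2[).
  by apply: measurableX; exact: measurable_itv.
apply/seteqP; split=> y /=.
  by rewrite !in_itv /= !ltr_norml => -[h1 [h2 _]]; split; lra.
rewrite !in_itv /= !ltr_norml => -[h1 h2]; split; first lra.
by split; [lra|exact: h].
Qed.

Lemma cont_measurable (f : R * R -> R) : continuous f ->
  measurable_fun [set: mplane R] (f : mplane R -> R).
Proof.
move=> cf mT; apply: (measurability _ (measurable_realfun.RGenOInfty.measurableE R)) => //.
move=> /= _ [_ [x ->] <-]; apply: measurableI => //; apply: open_measurable2.
apply: open_comp => [y _|]; [exact: cf|exact: rray_open].
Qed.

Lemma measurable_Y2 : measurable (Y2 : set (mplane R)).
Proof. by apply: measurableX; exact: measurable_itv. Qed.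

Lemma leb2_Y2 : leb2 (Y2 : set (mplane R)) = 1%E.
Proof.
have mI : measurable (`[0, 1[ : set (measurableTypeR R)) by exact: measurable_itv.
have l1 : mu1 (`[0, 1[%classic : set R) = 1%E.
  by rewrite lebesgue_measure_itv /= lte_fin ltr01 oppr0 adde0.
by apply: (etrans (product_measure1E mu1 mu1 mI mI)); rewrite -[RHS]mule1; congr (_ * _)%E; exact: l1.
Qed.

Lemma per_integrable (mu : {measure set (mplane R) -> \bar R}) (f : R * R -> R) :
  (mu Y2 < +oo)%E -> C0sharp f -> mu.-integrable Y2 (EFin \o f).
Proof.
move=> muY fp; apply: measurable_bounded_integrable => //.
- exact: measurable_Y2.
- by apply: measurable_funTS; apply: cont_measurable; case: fp.
have [M M0 fM] := per_bounded fp.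
exists M; split; first exact: num_real.
by move=> x Mx y _ /=; apply: le_trans (fM y) _; exact: ltW.
Qed.

Lemma cont_integral01 (f : R -> R) : continuous f ->
  (\int[mu1]_(x in `[0%R, 1%R[) (f x)%:E = (prim f 1)%:E)%E.
Proof.
move=> cf.
rewrite integral_itv_bndo_bndc; last first.
  apply/measurable_EFinP; apply: measurable_funTS; exact: continuous_measurable_fun.
rewrite (@continuous_FTC2 R f (prim f) 0 1 ltr01).
- by rewrite prim0 // sube0.
- exact: continuous_subspaceT.
- split.
  + by move=> x _; have [] := prim_der x cf.
  + by apply: cvg_at_right_filter; exact: der_cont (prim_der 0 cf).
  + by apply: cvg_at_left_filter; exact: der_cont (prim_der 1 cf).
- by move=> x _; rewrite derive1E; have [_ ->] := prim_der x cf.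
Qed.

Lemma integral_mean2 (F : R * R -> R) : C0sharp F ->
  (\int[leb2]_(y in Y2) (F y)%:E = (mean2 F)%:E)%E.
Proof.
move=> Fp; have [_ cF] := Fp.
have int : leb2.-integrable (Y2 : set (mplane R)) (EFin \o F).
  by apply: per_integrable Fp; rewrite leb2_Y2 ltry.
have {}int := (integrable_mkcond _ measurable_Y2).1 int.
rewrite integral_mkcond; apply: (etrans (esym (integral12_prod_meas1 int))).
have E : fubini_F mu1 ((EFin \o F) \_ Y2) =
    (fun x => (primV F (x, 1))%:E) \_ `[0, 1[%classic.
  apply/funext => x; rewrite /fubini_F.
  have [x01|x01] := boolP (x \in (`[0, 1[%classic : set R)).
    rewrite [RHS]/patch x01 -cont_integral01; last exact: cont_slice_v.
    rewrite [RHS]integral_mkcond; apply: eq_integral => y _.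
    rewrite /patch; congr (if _ then _ else _).
    by rewrite in_setX /= x01.
  rewrite [RHS]/patch (negbTE x01) integral0_eq // => y _.
  by rewrite /patch in_setX /= (negbTE x01).
apply: (etrans (congr1 (fun h => (\int[mu1]_x h x)%E) E)).
rewrite -integral_mkcond cont_integral01 //.
exact: cont_slice_h (primV_cont Fp).
Qed.

Lemma Rintegral_mean2 (F : R * R -> R) : C0sharp F ->
  \int[leb2]_(y in Y2) F y = mean2 F.
Proof. by move=> Fp; rewrite /Rintegral integral_mean2. Qed.

End measure.

(** * Measures with a density *)

Section density.
Local Open Scope ereal_scope.
Context d (T : measurableType d) (R : realType).
Context (mu : {measure set T -> \bar R}) (g : T -> R).
Context (g0 : forall x, (0 <= g x)%R) (mg : measurable_fun setT g).

(** The proofs are parameters, so that the measure structure attached to the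
    set function can be inferred from the term alone. *)
Definition density (_ : forall x, (0 <= g x)%R) (_ : measurable_fun setT g)
  (A : set T) : \bar R := \int[mu]_(x in A) (g x)%:E.

Let density0 : density g0 mg set0 = 0.
Proof. by rewrite /density integral_set0. Qed.

Let density_ge0 A : 0 <= density g0 mg A.
Proof. by apply: integral_ge0 => x _; rewrite lee_fin. Qed.

Let density_sigma_additive : semi_sigma_additive (density g0 mg).
Proof.
move=> A mA tA mUA; rewrite /density ge0_integral_bigcup //.
- apply: is_cvg_ereal_nneg_natsum_cond => n _ _.
  by apply: integral_ge0 => x _; rewrite lee_fin.
- by apply: measurable_funTS; exact/measurable_EFinP.
- by move=> x _; rewrite lee_fin.
Qed.

HB.instance Definition _ := isMeasure.Build _ _ _ (density g0 mg)
  density0 density_ge0 density_sigma_additive.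

Import HBNNSimple.

Lemma ge0_integral_density (D : set T) (f : T -> \bar R) : measurable D ->
    measurable_fun D f -> (forall x, D x -> 0 <= f x) ->
  \int[density g0 mg]_(x in D) f x = \int[mu]_(x in D) (f x * (g x)%:E).
Proof.
move=> mD mf f0; pose h := nnsfun_approx mD mf.
have hf x : D x -> (h n x)%:E @[n --> \oo] --> f x by exact: cvg_nnsfun_approx.
have nd x a b : (a <= b)%N -> (h a x <= h b x)%R by move=> ab; exact/lefP/nd_nnsfun_approx.
have mh n : measurable_fun D (fun x => (h n x)%:E).
  by apply/measurable_EFinP; apply: measurable_funTS; exact: measurable_funP.
have mgD : measurable_fun D (fun x => (g x)%:E).
  by apply/measurable_EFinP; exact: measurable_funTS.
have -> : \int[density g0 mg]_(x in D) f x = limn (fun n => \int[density g0 mg]_(x in D) (h n x)%:E).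
  rewrite -monotone_convergence //.
  - by apply: eq_integral => x /[!inE] /hf /cvg_lim ->.
  - by move=> n x _; rewrite lee_fin.
  - by move=> x _ a b ab; rewrite lee_fin nd.
have -> : \int[mu]_(x in D) (f x * (g x)%:E) = limn (fun n => \int[mu]_(x in D) ((h n x)%:E * (g x)%:E)).
  rewrite -monotone_convergence //.
  - apply: eq_integral => x /[!inE] xD; apply/esym/cvg_lim => //.
    by apply: cvgeZr => //; exact: hf.
  - by move=> n; exact: emeasurable_funM.
  - by move=> n x _; rewrite mule_ge0 ?lee_fin.
  - by move=> x _ a b ab; rewrite lee_wpmul2r ?lee_fin ?nd.
congr (limn _); apply/funext => n.
have mind r : measurable (h n @^-1` [set r]) by exact: measurable_sfunP.
have step r x : 0 <= (r * \1_(h n @^-1` [set r]) x)%:E by exact: nnfun_muleindic_ge0.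
have E x : (h n x)%:E = \sum_(r \in range (h n)) (r * \1_(h n @^-1` [set r]) x)%:E.
  by rewrite [in LHS]fimfunE -fsumEFin.
have mstep r : measurable_fun D (fun x => (r * \1_(h n @^-1` [set r]) x)%:E).
  by apply/measurable_EFinP; apply: measurable_funM => //; exact: measurable_funTS.
rewrite [LHS](eq_integral (fun x => \sum_(r \in range (h n)) (r * \1_(h n @^-1` [set r]) x)%:E)); last first.
  by move=> x _; rewrite E.
rewrite [RHS](eq_integral (fun x => \sum_(r \in range (h n))
  ((r * \1_(h n @^-1` [set r]) x)%:E * (g x)%:E))); last first.
  by move=> x _; rewrite -ge0_mule_fsuml // -E.
rewrite !ge0_integral_fsum //; last 2 first.
- by move=> r; exact: emeasurable_funM.
- move=> r x _; rewrite mule_ge0 ?lee_fin ?step //; exact: step.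
apply: eq_fsbigr => r /[!inE] -[t _ rE].
have r0 : (0 <= r)%R by rewrite -rE.
under eq_integral do rewrite EFinM; rewrite ge0_integralZl //; last first.
  by apply/measurable_EFinP; exact: measurable_funTS.
rewrite integral_indic //; under [RHS]eq_integral do rewrite EFinM -muleA.
rewrite ge0_integralZl //; last 2 first.
- by apply: emeasurable_funM => //; apply/measurable_EFinP; exact: measurable_funTS.
- by move=> x _; rewrite mule_ge0 ?lee_fin.
congr (_ * _); rewrite /= /density setIC integral_mkcondr; apply: eq_integral => x _.
by rewrite epatch_indic muleC.
Qed.

End density.

(** * Orbits as reparametrised leaves *)

Section time_change.
Context {R : realType} (u u1 u2 u11 u12 u22 : R * R -> R).
Context (uC : C1 u u1 u2) (u1C : C1per u1 u11 u12) (u2C : C1per u2 u12 u22).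
Context (gu0 : forall y, 0 < u1 y * u1 y + u2 y * u2 y).
Context (xi : R * R).
Context (u_shift : forall y k, u (y + intvec k) = u y + dot xi (intvec k)).
Context (xi_irr : forall k : int * int, k != 0 -> dot xi (intvec k) != 0).
Context (w : R * R -> R) (wp : C0sharp w).

Definition weighted_field (y : R * R) : R * R := (w y * u2 y, w y * - u1 y).

Context (X : R -> R * R -> R * R) (X_flow : flow_of weighted_field X).

Lemma cont_along (f : R * R -> R) x : C0sharp f -> continuous (fun s => f (X s x)).
Proof.
move=> [_ cf]; have [c1 c2] := dcurve_cont (flow_der X_flow x).
exact: (cont_curve cf).
Qed.

(** The parameter of the leaf flow, as a function of the time of [X]. *)
Definition clock x : R -> R := prim (fun s => w (X s x)).

Lemma clock_der x t : is_derive t (1 : R) (clock x) (w (X t x)).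
Proof. exact: (prim_der t (cont_along (x := x) wp)). Qed.

Lemma clock0 x : clock x 0 = 0.
Proof. exact: (prim0 (cont_along (x := x) wp)). Qed.

Lemma clock_le (W : R) x t : (forall y, w y <= W) -> 0 <= t -> clock x t <= W * t.
Proof.
move=> wW t0; have := @der_le _ (clock x) (fun s => W * s) _ _ 0 t t0
  (fun s _ => clock_der x s) (fun s _ => derZ W (derI s)) _.
by rewrite clock0 !subr0 mulr0 subr0; apply => s _; rewrite mulr1.
Qed.

Lemma clock_ge (W : R) x t : (forall y, W <= w y) -> 0 <= t -> W * t <= clock x t.
Proof.
move=> wW t0; have := @der_le _ (fun s => W * s) (clock x) _ _ 0 t t0
  (fun s _ => derZ W (derI s)) (fun s _ => clock_der x s) _.
by rewrite clock0 !subr0 mulr0 subr0; apply => s _; rewrite mulr1.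
Qed.

(** Both sides solve the same equation with a time-dependent speed [w (X t x)]. *)
Lemma orbit_on_leaf (S : R -> R * R -> R * R) : flow_of (leaf_field u1 u2) S ->
  forall x t, X t x = S (clock x t) x.
Proof.
move=> S_flow x t; have [SL SL0 SLP] := leaf_lipschitz u1C u2C.
have [W W0 wW] := per_bounded wp.
have Sd s := dcurve_reparam (flow_der S_flow x (clock x s)) (clock_der x s).
have WL : 0 <= W * SL by rewrite mulr_ge0 // ltW.
apply: (curve_unique WL (flow_der X_flow x) Sd _ _ (lexx `|t|)); last first.
  by rewrite clock0 (flow0 X_flow) (flow0 S_flow).
move=> s _ /=; rewrite !(mulrC (w (X s x))) -!mulrBl !normrM !(mulrC _ `|w _|) -!mulrA.
by split; apply: ler_pM => //; [exact: (SLP _ _).1|exact: (SLP _ _).2].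
Qed.

(** Orbit averages, with respect to the clock: any two orbits see the same
    mean of [F], up to a bounded error and an arbitrarily small rate. *)
Lemma orbit_mean F (e : R) : C0sharp F -> 0 < e -> exists2 C : R, 0 <= C &
  forall x (P : R -> R), (forall t, is_derive t (1 : R) P (w (X t x) * F (X t x))) ->
  forall t, `|P t - P 0 - mean2 F * clock x t| <= e * `|clock x t| + C.
Proof.
move=> Fp e0; have [L L0 SL] := leaf_lipschitz u1C u2C.
have [S S_flow] := flow_exists L0 SL.
have [C C0 CP] := leaf_mean uC u1C u2C gu0 u_shift xi_irr S_flow Fp e0.
exists C => // x P Pd t.
have [c1 c2] := dcurve_cont (flow_der S_flow x).
have Fm : C0sharp (fun y => F y - mean2 F) by apply: perD => //; exact: perC.
have cF : continuous (fun s => F (S s x) - mean2 F).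
  by have [_ cf] := Fm; exact: (cont_curve cf c1 c2).
pose Q := prim (fun s => F (S s x) - mean2 F).
have Qd s : is_derive s (1 : R) Q (F (S s x) - mean2 F) := prim_der s cF.
have E s : is_derive s (1 : R) (fun s => Q (clock x s) + (mean2 F * clock x s + P 0))
    (w (X s x) * F (X s x)).
  have := derD (derComp (Qd (clock x s)) (clock_der x s))
    (derD (derZ (mean2 F) (clock_der x s)) (derC (P 0) s)).
  by rewrite -(orbit_on_leaf S_flow); congr (is_derive _ _ _ _); ring.
have PE := der_eq Pd E; rewrite PE; last first.
  by rewrite clock0 mulr0 add0r /Q prim0 // add0r.
have -> : Q (clock x t) + (mean2 F * clock x t + P 0) - P 0 - mean2 F * clock x t
  = Q (clock x t) - Q 0 by rewrite [Q 0]prim0 //; ring.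
exact: CP.
Qed.

End time_change.

(** * The harmonic mean *)

Section mean_facts.
Context {R : realType}.
Implicit Types F G : R * R -> R.

Lemma leb2_Y2_fin : (leb2 (Y2 : set (mplane R)) < +oo)%E.
Proof. by rewrite leb2_Y2 ltry. Qed.

Lemma le_mean2 F G : C0sharp F -> C0sharp G -> (forall y, F y <= G y) ->
  mean2 F <= mean2 G.
Proof.
move=> Fp Gp FG; rewrite -!Rintegral_mean2 //; apply: le_Rintegral => //.
- exact: measurable_Y2.
- exact: per_integrable leb2_Y2_fin Fp.
- exact: per_integrable leb2_Y2_fin Gp.
Qed.

Lemma mean2_cst (c : R) : mean2 (fun _ : R * R => c) = c.
Proof.
rewrite -Rintegral_mean2; last exact: perC.
by rewrite Rintegral_cst; [rewrite [X in fine X]leb2_Y2 mulr1|exact: measurable_Y2].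
Qed.

Lemma mean2_pos F : C0sharp F -> (forall y, 0 < F y) -> 0 < mean2 F.
Proof.
move=> Fp F0; have [m m0 mF] := per_pos_min Fp F0.
by rewrite (lt_le_trans m0) // -(mean2_cst m); apply: le_mean2 => //; exact: perC.
Qed.

Context (w : R * R -> R) (wp : C0sharp w) (w0 : forall y, 0 <= w y).

(** The weight made positive: its inverses increase to the inverse of [w]. *)
Definition wreg (n : nat) y : R := w y + n.+1%:R^-1.

Lemma wreg_per n : C0sharp (wreg n).
Proof. by apply: perD => //; exact: perC. Qed.

Lemma wreg_pos n y : 0 < wreg n y.
Proof. by rewrite /wreg ltr_wpDl // invr_gt0 ltr0n. Qed.

Lemma wregV_per n : C0sharp (fun y => (wreg n y)^-1).
Proof. by apply: perV => [|y]; [exact: wreg_per|rewrite gt_eqF // wreg_pos]. Qed.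

Definition inv_integral : \bar R := (\int[leb2]_(y in Y2) ((w y)%:E)^-1)%E.

Lemma wreg_cvg y : ((wreg n y)^-1)%:E @[n --> \oo] --> (((w y)%:E)^-1)%E.
Proof.
rewrite inver; have [wy|wy] := eqVneq (w y) 0.
  rewrite /wreg wy; under eq_fun do rewrite add0r invrK.
  apply/cvgeyPge => A; near=> n.
  by rewrite lee_fin (le_trans (_ : A <= n%:R)) //; [near: n; exact: nbhs_infty_ger|rewrite ler_nat].
apply: cvg_EFin; first by near=> n.
apply: cvgV => //; rewrite -[X in _ --> X]addr0.
by apply: cvgD; [exact: cvg_cst|exact: cvg_harmonic].
Unshelve. all: by end_near. Qed.

Lemma wreg_nd y m n : (m <= n)%N -> (wreg m y)^-1 <= (wreg n y)^-1.
Proof.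
move=> mn; rewrite lef_pV2 ?posrE ?wreg_pos // lerD2l.
by rewrite lef_pV2 ?posrE ?ltr0n // ler_nat.
Qed.

Lemma wregV_measurable n : measurable_fun (Y2 : set (mplane R)) (fun y => ((wreg n y)^-1)%:E).
Proof.
apply/measurable_EFinP; apply: measurable_funTS; apply: cont_measurable.
by case: (wregV_per n).
Qed.

Lemma inv_measurable :
  measurable_fun (Y2 : set (mplane R)) (fun y : mplane R => ((w y)%:E)^-1)%E.
Proof.
apply: (emeasurable_fun_cvg (fun n (y : mplane R) => ((wreg n y)^-1)%:E)) => [n|y _].
  exact: wregV_measurable.
exact: wreg_cvg.
Qed.

(** Monotone convergence gives the possibly infinite integral of the inverse
    as the limit of means of continuous functions. *)
Lemma mean_wreg_cvg : (mean2 (fun y => (wreg n y)^-1))%:E @[n --> \oo] --> inv_integral.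
Proof.
have -> : inv_integral = (\int[leb2]_(y in Y2) (limn (fun n => ((wreg n y)^-1)%:E)))%E.
  by apply: eq_integral => y _; apply/esym/cvg_lim => //; exact: wreg_cvg.
have -> : (fun n => (mean2 (fun y => (wreg n y)^-1))%:E) =
    (fun n => \int[leb2]_(y in Y2) ((wreg n y)^-1)%:E)%E.
  by apply/funext => n; rewrite integral_mean2 //; exact: wregV_per.
apply: cvg_monotone_convergence.
- exact: measurable_Y2.
- exact: wregV_measurable.
- by move=> n y _; rewrite lee_fin invr_ge0 ltW // wreg_pos.
- by move=> y _ m n mn; rewrite lee_fin wreg_nd.
Qed.

Lemma mean_wreg_le n : ((mean2 (fun y => (wreg n y)^-1))%:E <= inv_integral)%E.
Proof.
rewrite -integral_mean2; last exact: wregV_per.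
apply: ge0_le_integral => //.
- exact: measurable_Y2.
- by move=> y _; rewrite lee_fin invr_ge0 ltW // wreg_pos.
- exact: wregV_measurable.
- exact: inv_measurable.
- move=> y _; rewrite inver; case: eqP => [_|/eqP wy]; first exact: leey.
  rewrite lee_fin lef_pV2 ?posrE ?wreg_pos // ?lerDl ?invr_ge0 //.
  by rewrite lt_neqAle eq_sym wy w0.
Qed.

Lemma mean_wreg_pos n : 0 < mean2 (fun y => (wreg n y)^-1).
Proof. by apply: mean2_pos => [|y]; [exact: wregV_per|rewrite invr_gt0 wreg_pos]. Qed.

Lemma inv_integral_gt0 : (0 < inv_integral)%E.
Proof. by apply: lt_le_trans (mean_wreg_le 0); rewrite lte_fin mean_wreg_pos. Qed.

Lemma harmonic_meanE : harmonic_mean_Y2 w = fine (inv_integral^-1)%E.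
Proof. by []. Qed.

Lemma harmonic_mean_eq0 : harmonic_mean_Y2 w = 0 -> inv_integral = +oo%E.
Proof.
rewrite harmonic_meanE; have := inv_integral_gt0.
case: inv_integral => [r||] //; rewrite lte_fin => r0.
by rewrite inver gt_eqF //= => /eqP; rewrite invr_eq0 gt_eqF.
Qed.

Lemma harmonic_mean_gt0 : 0 < harmonic_mean_Y2 w ->
  inv_integral = ((harmonic_mean_Y2 w)^-1)%:E.
Proof.
rewrite harmonic_meanE; have := inv_integral_gt0.
case: inv_integral => [r||] //; last by rewrite /inve /= ltxx.
by rewrite lte_fin => r0; rewrite inver gt_eqF //= invrK.
Qed.

(** The inverse of a positive periodic function is continuous, so its integral
    is finite. *)
Lemma harmonic_mean_pos : (forall y, 0 < w y) ->
  harmonic_mean_Y2 w = (mean2 (fun y => (w y)^-1))^-1.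
Proof.
move=> wpos; have wn y : w y != 0 by rewrite gt_eqF.
have iv : C0sharp (fun y => (w y)^-1) by exact: perV.
rewrite harmonic_meanE; have -> : inv_integral = (mean2 (fun y => (w y)^-1))%:E.
  rewrite -integral_mean2 //; apply: eq_integral => y _.
  by rewrite inver (negbTE (wn y)).
by rewrite inver gt_eqF // mean2_pos // => y; rewrite invr_gt0.
Qed.

Lemma mean_wreg_unbounded : inv_integral = +oo%E -> forall A : R,
  exists n, A <= mean2 (fun y => (wreg n y)^-1).
Proof.
move=> J A; have := mean_wreg_cvg; rewrite J => /cvgeyPge/(_ A)[n _ nP].
by exists n; have := nP n (leqnn n); rewrite /= lee_fin.
Qed.

End mean_facts.

(** * Limits of orbits *)

Section rotation.
Context {R : realType} (u u1 u2 u11 u12 u22 : R * R -> R).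
Context (uC : C1 u u1 u2) (u1C : C1per u1 u11 u12) (u2C : C1per u2 u12 u22).
Context (gu0 : forall y, 0 < u1 y * u1 y + u2 y * u2 y).
Context (xi : R * R).
Context (u_shift : forall y k, u (y + intvec k) = u y + dot xi (intvec k)).
Context (xi_irr : forall k : int * int, k != 0 -> dot xi (intvec k) != 0).
Context (w : R * R -> R) (wp : C0sharp w) (w0 : forall y, 0 <= w y).
Context (X : R -> R * R -> R * R) (X_flow : flow_of (weighted_field u1 u2 w) X).

Local Notation clock := (clock w X).
Local Notation mean := (orbit_mean uC u1C u2C gu0 u_shift xi_irr wp X_flow).

Definition leaf_drift : R * R := (mean2 u2, mean2 (fun y => - u1 y)).

Lemma clock_ge0 x t : 0 <= t -> 0 <= clock x t.
Proof. by move=> t0; have := clock_ge wp X_flow x w0 t0; rewrite mul0r. Qed.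

Lemma displacement (e : R) : 0 < e -> exists2 C : R, 0 <= C & forall x t, 0 <= t ->
  `|(X t x).1 - x.1 - leaf_drift.1 * clock x t| <= e * clock x t + C /\
  `|(X t x).2 - x.2 - leaf_drift.2 * clock x t| <= e * clock x t + C.
Proof.
move=> e0; have [u2p _ _ _] := u2C; have [/perN u1p _ _ _] := u1C.
have [C C0 CP] := mean u2p e0; have [D D0 DP] := mean u1p e0.
exists (C + D) => [|x t t0]; first exact: addr_ge0.
have h1 := CP x (fun s => (X s x).1) (fun s => (flow_der X_flow x s).1) t.
have h2 := DP x (fun s => (X s x).2) (fun s => (flow_der X_flow x s).2) t.
rewrite (flow0 X_flow) (ger0_norm (clock_ge0 x t0)) in h1.
rewrite (flow0 X_flow) (ger0_norm (clock_ge0 x t0)) in h2.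
by split; [apply: le_trans h1 _|apply: le_trans h2 _]; rewrite lerD2l ?lerDl ?lerDr.
Qed.

(** If [f] follows [eta] times the clock [c] and the clock follows [m] times
    time, then [f] has speed [m eta].  The bound on [c] turns errors relative to
    the clock into errors relative to time. *)
Lemma scaled_limit (f c : R -> R) (x0 eta m W : R) :
    (forall t, 0 <= t -> 0 <= c t <= W * t) ->
    (forall e : R, 0 < e -> exists2 C : R, 0 <= C & forall t, 0 <= t ->
       `|f t - x0 - eta * c t| <= e * c t + C) ->
    (forall e : R, 0 < e -> exists2 t0 : R, 0 < t0 & forall t, t0 <= t ->
       `|c t - m * t| <= e * t) ->
  t^-1 * f t @[t --> +oo] --> m * eta.
Proof.
move=> cW fc cm; apply/cvgrPdist_le => e e0.
have W1 : 0 < `|W| + 1 by rewrite ltr_wpDl.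
have E1 : 0 < `|eta| + 1 by rewrite ltr_wpDl.
have ea : 0 < e / 3 / (`|W| + 1) by rewrite !divr_gt0.
have eb : 0 < e / 3 / (`|eta| + 1) by rewrite !divr_gt0.
have [C C0 CP] := fc _ ea; have [t0 t00 t0P] := cm _ eb.
pose t1 := 3 * (C + `|x0|) / e.
near=> t; have tt0 : t0 <= t by near: t; apply: nbhs_pinfty_ge; exact: num_real.
have tt1 : t1 <= t by near: t; apply: nbhs_pinfty_ge; exact: num_real.
have tpos : 0 < t := lt_le_trans t00 tt0.
have /andP[c0 c1] := cW t (ltW tpos).
have h1 := CP t (ltW tpos); have h2 := t0P t tt0.
have -> : m * eta - t^-1 * f t =
    - ((f t - x0 - eta * c t) + x0 + eta * (c t - m * t)) / t by field; rewrite gt_eqF.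
rewrite normrM normrN normfV (gtr0_norm tpos) ler_pdivrMr //.
have k1 : e / 3 / (`|W| + 1) * c t <= e / 3 * t.
  rewrite mulrAC ler_pdivrMr // -(mulrA _ t) ler_pM2l ?divr_gt0 // mulrC.
  apply: le_trans c1 _; rewrite ler_pM2r //.
  by rewrite (le_trans (ler_norm _)) // lerDl.
have k2 : C + `|x0| <= e / 3 * t.
  by have := tt1; rewrite /t1 ler_pdivrMr //; lra.
have k3 : `|eta * (c t - m * t)| <= e / 3 * t.
  rewrite normrM; apply: le_trans (ler_wpM2l (normr_ge0 _) h2) _.
  rewrite mulrA ler_wpM2r ?(ltW tpos) // mulrC mulrAC ler_pdivrMr //.
  by rewrite ler_pM2l ?divr_gt0 // lerDl.
apply: le_trans (ler_normD _ _) _; apply: le_trans (lerD (ler_normD _ _) k3) _.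
have -> : e * t = e / 3 * t + e / 3 * t + e / 3 * t by field.
rewrite lerD2r; apply: le_trans (lerD h1 (lexx _)) _.
by rewrite -addrA lerD.
Unshelve. all: by end_near. Qed.

Lemma drift_limit (m : R) x :
    (forall e : R, 0 < e -> exists2 t0 : R, 0 < t0 & forall t, t0 <= t ->
       `|clock x t - m * t| <= e * t) ->
  t^-1 *: X t x @[t --> +oo] --> m *: leaf_drift.
Proof.
move=> cm; have [W _ wW] := per_bounded wp.
have wW' y : w y <= W := le_trans (ler_norm _) (wW y).
have cW t : 0 <= t -> 0 <= clock x t <= W * t.
  by move=> t0; rewrite clock_ge0 //= (clock_le wp X_flow).
have d1 (e : R) : 0 < e -> exists2 C : R, 0 <= C & forall t, 0 <= t ->
    `|(X t x).1 - x.1 - leaf_drift.1 * clock x t| <= e * clock x t + C.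
  by move=> /displacement[C C0 CP]; exists C => // t t0; have [] := CP x t t0.
have d2 (e : R) : 0 < e -> exists2 C : R, 0 <= C & forall t, 0 <= t ->
    `|(X t x).2 - x.2 - leaf_drift.2 * clock x t| <= e * clock x t + C.
  by move=> /displacement[C C0 CP]; exists C => // t t0; have [] := CP x t t0.
have h1 := @scaled_limit (fun t => (X t x).1) (clock x) x.1 leaf_drift.1 m W cW d1 cm.
have h2 := @scaled_limit (fun t => (X t x).2) (clock x) x.2 leaf_drift.2 m W cW d2 cm.
have E : (fun t : R => t^-1 *: X t x) = (fun t => (t^-1 * (X t x).1, t^-1 * (X t x).2)).
  by apply/funext => t; rewrite [LHS]surjective_pairing.
by rewrite E; exact: (cvg_pair h1 h2).
Qed.

(** Time is the integral of [1 / w] along the leaf, so it is asymptotic to the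
    clock times the mean of [1 / w]. *)
Lemma positive_limit x : (forall y, 0 < w y) ->
  t^-1 *: X t x @[t --> +oo] --> harmonic_mean_Y2 w *: leaf_drift.
Proof.
move=> wpos; apply: drift_limit => e e0.
have iv : C0sharp (fun y => (w y)^-1) by apply: perV => // y; rewrite gt_eqF.
set m := harmonic_mean_Y2 w; pose I := mean2 (fun y => (w y)^-1).
have I0 : 0 < I by apply: mean2_pos => // y; rewrite invr_gt0.
have mI : m = I^-1 := harmonic_mean_pos wp wpos.
have [W W0 wW] := per_bounded wp.
have wW' y : w y <= W := le_trans (ler_norm _) (wW y).
have e1 : 0 < e * I / 2 / W by rewrite !divr_gt0 // mulr_gt0.
have [C C0 CP] := mean iv e1.
exists (2 * (C + 1) / (e * I)).
  by rewrite divr_gt0 ?mulr_gt0 // ltr_wpDl.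
move=> t tt; have tpos : 0 < t.
  by apply: lt_le_trans tt; rewrite divr_gt0 ?mulr_gt0 // ltr_wpDl.
have Pd s : is_derive s (1 : R) (fun s : R => s) (w (X s x) * (w (X s x))^-1).
  by rewrite mulfV ?gt_eqF //; exact: derI.
have := CP x _ Pd t; rewrite subr0 -/I (ger0_norm (clock_ge0 x (ltW tpos))) => h.
have -> : clock x t - m * t = - (t - I * clock x t) / I.
  by rewrite mI; field; rewrite gt_eqF.
rewrite normrM normrN normfV (gtr0_norm I0) ler_pdivrMr //; apply: le_trans h _.
have k1 : e * I / 2 / W * clock x t <= e * I / 2 * t.
  rewrite mulrAC ler_pdivrMr // -(mulrA _ t) ler_pM2l ?divr_gt0 ?mulr_gt0 // mulrC.
  by apply: (clock_le wp X_flow x wW'); exact: ltW.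
have k2 : C <= e * I / 2 * t.
  by move: tt; rewrite ler_pdivrMr ?mulr_gt0 //; lra.
have -> : e * t * I = e * I / 2 * t + e * I / 2 * t by field.
exact: lerD.
Qed.

(** The integral of [w / (w + 1/n)] bounds time from below by the clock times
    a mean which is as large as desired. *)
Lemma degenerate_limit x : inv_integral w = +oo%E ->
  t^-1 *: X t x @[t --> +oo] --> (0 : R * R).
Proof.
move=> J; rewrite -(scale0r leaf_drift); apply: drift_limit => e e0.
have [n nA] := mean_wreg_unbounded wp w0 J (4 / e).
set F := fun y => (wreg w n y)^-1 in nA.
have Fp : C0sharp F := wregV_per wp w0 n.
have I0 : 0 < mean2 F := mean_wreg_pos wp w0 n.
set I := mean2 F in nA I0.
have e1 : 0 < I / 2 by rewrite divr_gt0.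
have [C C0 CP] := mean Fp e1.
exists (C + 1) => [|t tC]; first by rewrite ltr_wpDl.
have tpos : 0 < t by apply: lt_le_trans tC; rewrite ltr_wpDl.
have cF : continuous (fun s => w (X s x) * F (X s x)).
  exact: (cont_along X_flow (x := x) (perM wp Fp)).
pose P := prim (fun s => w (X s x) * F (X s x)).
have Pd s : is_derive s (1 : R) P (w (X s x) * F (X s x)) := prim_der s cF.
have := CP x P Pd t; rewrite [P 0]prim0 // subr0 (ger0_norm (clock_ge0 x (ltW tpos))) -/I.
rewrite ler_norml => /andP[h _].
have Pt : P t <= t.
  have := @der_le _ P (fun s => s) _ _ 0 t (ltW tpos) (fun s _ => Pd s) (fun s _ => derI s) _.
  rewrite [P 0]prim0 // !subr0; apply => s _.
  by rewrite /F ler_pdivrMr ?wreg_pos // mul1r /wreg lerDl invr_ge0.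
rewrite mul0r subr0 ger0_norm ?clock_ge0 ?(ltW tpos) //.
have h2 : I / 2 * clock x t <= 2 * t by lra.
have h3 : 4 <= I * e by move: nA; rewrite ler_pdivrMr.
have : 4 * clock x t <= I * e * clock x t by rewrite ler_wpM2r ?clock_ge0 ?(ltW tpos).
have : e * (I / 2 * clock x t) <= e * (2 * t) by rewrite ler_pM2l.
have -> : e * (I / 2 * clock x t) = I * e * clock x t / 2 by field.
by lra.
Qed.

(** * Rotation vectors of invariant measures *)

Context (mu : probability (mplane R) R) (mu_inv : invariant_probability X mu).

Lemma mu_Y2_fin : (mu (Y2 : set (mplane R)) < +oo)%E.
Proof. by have [E _] := mu_inv; rewrite [X in (X < _)%E]E ltry. Qed.

Lemma mu_bound f (K : R) : C0sharp f -> (forall y, `|f y| <= K) ->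
  `|\int[mu]_(y in Y2) f y| <= K.
Proof.
move=> fp fK; have mY := @measurable_Y2 R.
have i1 := per_integrable mu_Y2_fin fp.
have nf : C0sharp (fun y => `|f y|).
  have [p c] := fp; split=> [y k|y]; first by rewrite p.
  by apply: cvg_norm; exact: c.
apply: le_trans (le_normr_Rintegral mY i1) _.
have h := le_Rintegral mY (per_integrable mu_Y2_fin nf)
  (per_integrable mu_Y2_fin (perC K)) (fun y _ => fK y).
apply: le_trans h _; rewrite Rintegral_cst //.
by have [E _] := mu_inv; rewrite [X in fine X]E mulr1.
Qed.

Lemma weighted_lipschitz1 : (exists w1 w2, C1per w w1 w2) ->
  exists2 L : R, 0 < L & lipschitz1 L (weighted_field u1 u2 w).
Proof.
move=> [w1 [w2 wC]].
exact: C1per_lipschitz1 (C1perM wC u2C) (C1perM wC (C1perN u1C)).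
Qed.

Lemma weighted_periodic : periodic_field (weighted_field u1 u2 w).
Proof.
have [[p1 _] _ _ _] := u1C; have [[p2 _] _ _ _] := u2C; have [p _] := wp.
by move=> y k; rewrite /weighted_field p1 p2 p.
Qed.

Context (wC : exists w1 w2, C1per w w1 w2).

Lemma flow_average f t n : C0sharp f ->
  \int[mu]_(y in Y2) (\sum_(j < n) f (X (j%:R * t) y)) = n%:R * \int[mu]_(y in Y2) f y.
Proof.
move=> fp; have [L L0 XL] := weighted_lipschitz1 wC.
have fX s : C0sharp (fun y => f (X s y)).
  exact: (per_comp_flow s L0 XL X_flow weighted_periodic fp).
have mY := @measurable_Y2 R; have [_ inv] := mu_inv.
elim: n => [|n IH].
  under eq_Rintegral do rewrite big_ord0.
  by rewrite Rintegral_cst // !mul0r.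
under eq_Rintegral do rewrite big_ord_recr /=.
have sp : C0sharp (fun y => \sum_(j < n) f (X (j%:R * t) y)).
  elim: {IH}n => [|n IH]; first by under eq_fun do rewrite big_ord0; exact: perC.
  by under eq_fun do rewrite big_ord_recr /=; exact: perD.
rewrite RintegralD //; last 2 first.
- exact: (per_integrable mu_Y2_fin sp).
- exact: (per_integrable mu_Y2_fin (fX _)).
by rewrite IH inv // -natr1 mulrDl mul1r.
Qed.

(** The integral of [f] equals that of its time averages, which are uniformly
    small.  Time averages are replaced by Riemann sums, so that invariance is
    applied to finitely many times and no double integral occurs. *)
Lemma sublinear_integral0 f : C0sharp f ->
    (forall e : R, 0 < e -> exists2 C : R, 0 <= C & forall y t, 0 <= t ->
       `|prim (fun s => f (X s y)) t| <= e * t + C) ->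
  \int[mu]_(y in Y2) f y = 0.
Proof.
move=> fp sub; apply/eqP; rewrite -normr_le0; apply/ler_addgt0Pr => e e0; rewrite add0r.
have e3 : 0 < e / 3 by rewrite divr_gt0.
have [C C0 CP] := sub _ e3; have [d d0 dP] := per_ucont fp e3.
have [L L0 XL] := weighted_lipschitz1 wC.
have fX s : C0sharp (fun y => f (X s y)).
  exact: (per_comp_flow s L0 XL X_flow weighted_periodic fp).
have [w1 [w2 wC']] := wC.
have [/per_bounded[V1 V10 V1P] _ _ _] := C1perM wC' u2C.
have [/per_bounded[V2 V20 V2P] _ _ _] := C1perM wC' (C1perN u1C).
have speed a b y : dist1 (X a y) (X b y) <= 2 * (V1 + V2) * `|a - b|.
  apply: (dcurve_dist1 a b (fun t => flow_der X_flow y t)) => t /=.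
  split; [apply: le_trans (V1P (X t y)) _|apply: le_trans (V2P (X t y)) _]; lra.
have V0 : 0 < 2 * (V1 + V2) by rewrite mulr_gt0 // addr_gt0.
have [h h0 hV] : exists2 h : R, 0 < h & 2 * (V1 + V2) * h < d.
  exists (d / 2 / (2 * (V1 + V2))); first by rewrite !divr_gt0.
  by rewrite mulrC divfK ?gt_eqF // ltr_pdivrMr //; lra.
have cf y : continuous (fun s => f (X s y)) := cont_along X_flow (x := y) fp.
have riemann y (n : nat) : `|prim (fun s => f (X s y)) (n%:R * h)
    - h * \sum_(j < n) f (X (j%:R * h) y)| <= e / 3 * (n%:R * h).
  elim: n => [|n IH]; first by rewrite mul0r prim0 // big_ord0 mulr0 subr0 normr0 mulr0.
  rewrite big_ord_recr /= mulrDr opprD addrA.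
  set a := n%:R * h; have nh : n.+1%:R * h = a + h by rewrite -natr1 mulrDl mul1r.
  rewrite nh.
  have step : `|prim (fun s => f (X s y)) (a + h) - prim (fun s => f (X s y)) a - h * f (X a y)| <= e / 3 * h.
    have [c [ch ->]] := der_between a (a + h) (fun s => prim_der s (cf y)).
    rewrite (addrC a) addrK in ch *; rewrite (gtr0_norm h0) in ch.
    rewrite (mulrC h) -mulrBl normrM (gtr0_norm h0).
    rewrite ler_pM2r //; apply/ltW/dP; apply: le_lt_trans (speed _ _ _) _.
    by apply: le_lt_trans hV; rewrite ler_pM2l.
  rewrite mulrDr; have -> : prim (fun s => f (X s y)) (a + h) - h * \sum_(j < n) f (X (j%:R * h) y) - h * f (X a y)
    = (prim (fun s => f (X s y)) a - h * \sum_(j < n) f (X (j%:R * h) y)) +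
      (prim (fun s => f (X s y)) (a + h) - prim (fun s => f (X s y)) a - h * f (X a y)) by ring.
  by apply: le_trans (ler_normD _ _) _; exact: lerD.
pose n := (Num.truncn (3 * C / (e * h))).+1.
have nC : C <= e / 3 * (n%:R * h).
  have : 3 * C / (e * h) < n%:R := truncnS_gt _.
  rewrite ltr_pdivrMr ?mulr_gt0 // => /ltW nC.
  have -> : e / 3 * (n%:R * h) = n%:R * (e * h) / 3 by ring.
  by rewrite ler_pdivlMr // mulrC.
have n0 : 0 < n%:R :> R by rewrite ltr0n.
have sp : C0sharp (fun y => \sum_(j < n) f (X (j%:R * h) y)).
  elim: {nC n0}n => [|n IH]; first by under eq_fun do rewrite big_ord0; exact: perC.
  by under eq_fun do rewrite big_ord_recr /=; exact: perD.
rewrite -(@ler_pM2l _ n%:R) // -{1}(ger0_norm (ltW n0)) -normrM -(flow_average h n fp).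
apply: mu_bound => // y.
rewrite -(@ler_pM2l _ h) // -{1}(gtr0_norm h0) -normrM.
set s := h * _; have -> : s = prim (fun s => f (X s y)) (n%:R * h) -
    (prim (fun s => f (X s y)) (n%:R * h) - s) by ring.
apply: le_trans (ler_normB _ _) _.
have := riemann y n; have := CP y (n%:R * h) (mulr_ge0 (ltW n0) (ltW h0)).
by rewrite -/s; lra.
Qed.

(** Unique ergodicity seen by invariant measures: [w mu] is a multiple of
    Lebesgue measure, because [w (F - mean2 F)] has sublinear integrals along
    the orbits of [X]. *)
Lemma invariant_mean F : C0sharp F ->
  \int[mu]_(y in Y2) (w y * F y) = mean2 F * \int[mu]_(y in Y2) w y.
Proof.
move=> Fp; have mY := @measurable_Y2 R.
have Gp : C0sharp (fun y => w y * F y + - mean2 F * w y).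
  by apply: perD; apply: perM => //; exact: perC.
have := sublinear_integral0 Gp _.
rewrite RintegralD //; last 2 first.
- exact: (per_integrable mu_Y2_fin (perM wp Fp)).
- exact: (per_integrable mu_Y2_fin (perM (perC _) wp)).
rewrite RintegralZl //; last exact: (per_integrable mu_Y2_fin wp).
rewrite mulNr => H; apply/eqP; rewrite -subr_eq0; apply/eqP; apply: H => e e0.
have [W W0 wW] := per_bounded wp.
have wW' y : w y <= W := le_trans (ler_norm _) (wW y).
have e1 : 0 < e / W by rewrite divr_gt0.
have [C C0 CP] := mean Fp e1; exists C => // y t t0.
have cF : continuous (fun s => w (X s y) * F (X s y)) := cont_along X_flow (x := y) (perM wp Fp).
have -> : prim (fun s => w (X s y) * F (X s y) + - mean2 F * w (X s y)) =
    (fun s => prim (fun s => w (X s y) * F (X s y)) s - mean2 F * clock y s).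
  apply: prim_uniq; first exact: (cont_along X_flow (x := y) Gp).
    by rewrite prim0 // (clock0 wp X_flow) mulr0 subr0.
  move=> s; rewrite mulNr.
  exact: derB (prim_der s cF) (derZ _ (clock_der wp X_flow y s)).
have := CP y _ (fun s => prim_der s cF) t.
rewrite prim0 // subr0 (ger0_norm (clock_ge0 y t0)) => h; apply: le_trans h _.
rewrite lerD2r mulrAC ler_pdivrMr // -(mulrA _ t) ler_pM2l // mulrC.
exact: (clock_le wp X_flow).
Qed.

(** With [c] the integral of [w], the rotation vector is [c] times the drift of
    the leaves.  Since [w / (w + 1/n) <= 1], the mean of [1 / (w + 1/n)] times
    [c] is at most 1, and [n] tends to infinity. *)
Lemma rotation_vector_segment : 0 < harmonic_mean_Y2 w ->
  exists2 s : R, 0 <= s <= 1 & vint mu (weighted_field u1 u2 w) =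
    s *: (harmonic_mean_Y2 w *: leaf_drift).
Proof.
set m := harmonic_mean_Y2 w => m0.
have J := harmonic_mean_gt0 wp w0 m0; rewrite -/m in J.
set c := \int[mu]_(y in Y2) w y.
have [u2p _ _ _] := u2C; have [/perN u1p _ _ _] := u1C.
have c0 : 0 <= c by apply: Rintegral_ge0.
have cn n : c * mean2 (fun y => (wreg w n y)^-1) <= 1.
  have vp := wregV_per wp w0 n.
  rewrite mulrC -invariant_mean //; apply: le_trans (ler_norm _) _.
  apply: mu_bound; first exact: perM.
  move=> y; rewrite ger0_norm ?mulr_ge0 ?invr_ge0 ?(ltW (wreg_pos w0 n y)) //.
  by rewrite ler_pdivrMr ?wreg_pos // mul1r /wreg lerDl invr_ge0.
have cm : c / m <= 1.
  have lim : c * mean2 (fun y => (wreg w n y)^-1) @[n --> \oo] --> c * m^-1.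
    apply: cvgM; first exact: cvg_cst.
    by have := mean_wreg_cvg wp w0; rewrite J => /fine_cvgP[].
  rewrite -(cvg_lim (@Rhausdorff R) lim); apply: limr_le.
    by apply/cvg_ex; exists (c * m^-1).
  by near=> n; exact: cn.
exists (c / m); first by rewrite cm divr_ge0 // ltW.
rewrite scalerA divfK ?gt_eqF // /vint /weighted_field /=.
rewrite invariant_mean // -/c invariant_mean // -/c.
by rewrite [RHS]surjective_pairing; congr pair; rewrite mulrC.
Unshelve. all: by end_near. Qed.

End rotation.

(** * The invariant density *)

Section invariant_density.
Context {R : realType} (u u1 u2 u11 u12 u22 : R * R -> R).
Context (uC : C1 u u1 u2) (u1C : C1per u1 u11 u12) (u2C : C1per u2 u12 u22).
Context (gu0 : forall y, 0 < u1 y * u1 y + u2 y * u2 y).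
Context (xi : R * R).
Context (u_shift : forall y k, u (y + intvec k) = u y + dot xi (intvec k)).
Context (xi_irr : forall k : int * int, k != 0 -> dot xi (intvec k) != 0).

(** For a positive weight, [1 / w] is an invariant density: the orbit averages
    of [f] and of its translate along the flow differ by bounded end terms, so
    the two functions have the same mean. *)
Lemma positive_invariant w w1 w2 X (f : R * R -> R) t : C1per w w1 w2 -> (forall y, 0 < w y) ->
  flow_of (weighted_field u1 u2 w) X -> C0sharp f ->
  mean2 (fun y => f (X t y) / w y) = mean2 (fun y => f y / w y).
Proof.
move=> wC wpos X_flow fp; have [wp _ _ _] := wC.
have iv : C0sharp (fun y => (w y)^-1) by apply: perV => // y; rewrite gt_eqF.
have [L L0 XL] := weighted_lipschitz1 u1C u2C (ex_intro _ w1 (ex_intro _ w2 wC)).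
have fX : C0sharp (fun y => f (X t y)).
  exact: (per_comp_flow t L0 XL X_flow (weighted_periodic u1C u2C wp) fp).
have Fp := perM fX iv; have Gp := perM fp iv.
have [c c0 cw] := per_pos_min wp wpos; have [K K0 fK] := per_bounded fp.
apply/eqP; rewrite -subr_eq0 -normr_le0; apply/ler_addgt0Pr => e e0; rewrite add0r.
have e3 : 0 < e / 3 by rewrite divr_gt0.
have [C C0 CP] := orbit_mean uC u1C u2C gu0 u_shift xi_irr wp X_flow Fp e3.
have [D D0 DP] := orbit_mean uC u1C u2C gu0 u_shift xi_irr wp X_flow Gp e3.
pose x : R * R := 0.
pose Q := prim (fun s => f (X s x)).
have cf : continuous (fun s => f (X s x)) := cont_along X_flow (x := x) fp.
have Qd s : is_derive s (1 : R) Q (f (X s x)) := prim_der s cf.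
have wK y z : w y * (z / w y) = z by rewrite mulrCA mulfV ?mulr1 // gt_eqF.
have d1 s : is_derive s (1 : R) (fun s => Q (s + t)) (w (X s x) * (f (X t (X s x)) / w (X s x))).
  by rewrite wK -(flowD L0 XL X_flow) addrC; exact: derShift (Qd (s + t)).
have d2 s : is_derive s (1 : R) Q (w (X s x) * (f (X s x) / w (X s x))) by rewrite wK.
pose A := C + D + 2 * K * `|t|.
have A0 : 0 <= A by rewrite !addr_ge0 // !mulr_ge0 // ltW.
pose s := 3 * (A + 1) / (e * c).
have A1 : 0 < A + 1 by rewrite ltr_wpDl.
have s0 : 0 < s by rewrite divr_gt0 ?mulr_gt0.
have cs : c * s <= clock w X x s := clock_ge wp X_flow x cw (ltW s0).
have clk : 0 < clock w X x s by apply: lt_le_trans cs; exact: mulr_gt0.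
have sE : c * s * (e / 3) = A + 1 by rewrite /s; field; rewrite !gt_eqF.
have h1 := CP x _ d1 s; have h2 := DP x _ d2 s.
rewrite (gtr0_norm clk) add0r in h1 h2.
have q a b : `|Q a - Q b| <= K * `|a - b| by apply: (der_lip Qd) => r; exact: fK.
have q1 : `|Q (s + t) - Q s| <= K * `|t|.
  by apply: le_trans (q _ _) _; rewrite addrC addKr.
have q2 : `|Q t - Q 0| <= K * `|t| by apply: le_trans (q _ _) _; rewrite subr0.
rewrite -(ler_pM2r clk) -{1}(gtr0_norm clk) -normrM.
set M1 := mean2 _ in h1 *; set M2 := mean2 _ in h2 *.
have -> : (M1 - M2) * clock w X x s =
   (Q s - Q 0 - M2 * clock w X x s) - (Q (s + t) - Q t - M1 * clock w X x s)
   + ((Q (s + t) - Q s) - (Q t - Q 0)) by ring.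
apply: le_trans (ler_normD _ _) _.
apply: le_trans (lerD (ler_normB _ _) (ler_normB _ _)) _.
apply: le_trans (lerD (lerD h2 h1) (lerD q1 q2)) _.
have : c * s * (e / 3) <= clock w X x s * (e / 3) by rewrite ler_pM2r.
rewrite sE /A; move: (clock w X x s) => z; move: (K * `|t|) (mulrA 2 K `|t|) => KT <- .
by lra.
Qed.

Context (w w1 w2 : R * R -> R) (wC : C1per w w1 w2) (w0 : forall y, 0 <= w y).
Context (X : R -> R * R -> R * R) (X_flow : flow_of (weighted_field u1 u2 w) X).
Context (m : R) (m0 : 0 < m) (J : inv_integral w = (m^-1)%:E).

Let wp : C0sharp w. Proof. by have [] := wC. Qed.

Definition regular_flow n : R -> R * R -> R * R :=
  xget (fun _ _ => 0) [set F | flow_of (weighted_field u1 u2 (wreg w n)) F].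

Lemma wreg_C1 n : C1per (wreg w n) w1 w2.
Proof.
have := C1perD wC (C1perC (n.+1%:R^-1)).
by congr (C1per _ _ _); apply/funext => y; rewrite addr0.
Qed.

Lemma regular_flowP n : flow_of (weighted_field u1 u2 (wreg w n)) (regular_flow n).
Proof.
have [L L0 XL] := weighted_lipschitz1 u1C u2C (ex_intro _ w1 (ex_intro _ w2 (wreg_C1 n))).
have [F FP] := flow_exists L0 XL.
by rewrite /regular_flow; case: xgetP => [G _ //|/(_ F)].
Qed.

(** The fields differ by [1/n] times a bounded field, and Gronwall's inequality
    compares the trajectories. *)
Lemma regular_flow_cvg t y (d : R) : 0 < d -> exists N, forall n, (N <= n)%N ->
  dist1 (regular_flow n t y) (X t y) < d.
Proof.
move=> d0; have [L L0 XL] := weighted_lipschitz1 u1C u2C (ex_intro _ w1 (ex_intro _ w2 wC)).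
have [M M0 uM] := leaf_bounded u1C u2C.
pose E := 2 * expR ((4 * L + 2) * `|t|).
have E0 : 0 < E by rewrite mulr_gt0 // expR_gt0.
pose N := Num.truncn (M * (E + 1) / d); exists N => n Nn.
pose kappa := n.+1%:R^-1 * M.
have n0 : 0 < n.+1%:R :> R by rewrite ltr0n.
have k0 : 0 <= kappa by rewrite mulr_ge0 ?invr_ge0 ?(ltW n0) // ltW.
have kd : kappa * (E + 1) < d.
  rewrite /kappa -mulrA mulrC ltr_pdivrMr // -ltr_pdivrMl // mulrC.
  by apply: lt_le_trans (truncnS_gt _) _; rewrite ler_nat.
have E10 : 0 < E + 1 by rewrite addr_gt0.
have G := curve_gronwall (ltW L0) k0 (flow_der (regular_flowP n) y) (flow_der X_flow y) _ (lexx `|t|).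
have {G} : dist1 (regular_flow n t y) (X t y) ^+ 2 <= E * kappa ^+ 2.
  apply: le_trans (G _) _; last first.
    rewrite (flow0 (regular_flowP n)) (flow0 X_flow) dist1xx expr0n /= add0r /E.
    by rewrite mulrAC.
  move=> s _; set p := regular_flow n s y; set q := X s y.
  have [l1 l2] := XL p q.
  have [m1 m2] := uM p.
  have split_ (a v z : R) : `|w p * a - v| <= z -> `|a| <= M -> `|wreg w n p * a - v| <= z + kappa.
    move=> h1 h2; have -> : wreg w n p * a - v = (w p * a - v) + n.+1%:R^-1 * a by rewrite /wreg; ring.
    apply: le_trans (ler_normD _ _) _; apply: lerD => //.
    by rewrite normrM ger0_norm ?invr_ge0 ?(ltW n0) // ler_pM2l ?invr_gt0.
  by split; apply: split_ => //; rewrite normrN.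
move=> h; rewrite ltNge; apply/negP => dd.
have : d ^+ 2 <= E * kappa ^+ 2.
  by apply: le_trans h; rewrite ler_pXn2r ?nnegrE ?dist1_ge0 // ltW.
have : (kappa * (E + 1)) ^+ 2 < d ^+ 2.
  by rewrite ltr_pXn2r ?nnegrE ?mulr_ge0 // ?ltW.
rewrite exprMn => h1 h2; have : kappa ^+ 2 * (E + 1) ^+ 2 < E * kappa ^+ 2 by exact: lt_le_trans h1 h2.
have : 0 <= kappa ^+ 2 * (E ^+ 2 + E + 1) by rewrite mulr_ge0 ?sqr_ge0 // !addr_ge0 ?sqr_ge0 // ltW.
by rewrite !expr2; lra.
Qed.

(** The integral of [f] for the probability measure of density [m / w].  The
    inverse is the one of [R], equal to 0 at the zeros of [w], which form a
    negligible set when [1 / w] is integrable. *)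
Definition density_mean (f : R * R -> R) : R := \int[leb2]_(y in Y2) (f y * (m * (w y)^-1)).

Lemma invw_integrable : leb2.-integrable (Y2 : set (mplane R)) (fun y => ((w y)%:E)^-1)%E.
Proof.
apply/integrableP; split; first exact: inv_measurable.
have <- : inv_integral w = (\int[leb2]_(y in Y2) `|((w y)%:E)^-1|)%E; last by rewrite J ltry.
apply: eq_integral.
move=> y _; rewrite gee0_abs // inver; case: eqP => // _.
by rewrite lee_fin invr_ge0.
Qed.

Lemma invw_measurable : measurable_fun (Y2 : set (mplane R)) (fun y : mplane R => m * (w y)^-1).
Proof.
apply: measurable_funM; first exact: measurable_cst.
have E : (fun y : mplane R => (w y)^-1) = fine \o (fun y => ((w y)%:E)^-1)%E.
  by apply/funext => y /=; rewrite fine_invr.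
rewrite E; apply: measurableT_comp; first exact: fine_measurable.
exact: inv_measurable.
Qed.

(** Dominated convergence, with the integrable majorant given by [1 / w]. *)
Lemma density_mean_limit (f_ : nat -> R * R -> R) f (K : R) :
    0 < K -> (forall n, C0sharp (f_ n)) -> C0sharp f -> (forall n y, `|f_ n y| <= K) ->
    (forall y, f_ n y @[n --> \oo] --> f y) ->
  [/\ leb2.-integrable (Y2 : set (mplane R)) (fun y => (f y * (m * (w y)^-1))%:E) &
    m * mean2 (fun y => f_ n y / wreg w n y) @[n --> \oo] --> density_mean f].
Proof.
move=> K0 f_p fp fK ff; have mY := @measurable_Y2 R.
pose h n y := (f_ n y * (m * (wreg w n y)^-1))%:E.
have hp n : C0sharp (fun y => f_ n y * (m * (wreg w n y)^-1)).
  by apply: perM => //; apply: perM; [exact: perC|exact: wregV_per].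
have mh n : measurable_fun (Y2 : set (mplane R)) (h n).
  by apply/measurable_EFinP; apply: measurable_funTS; apply: cont_measurable; case: (hp n).
have mf : measurable_fun (Y2 : set (mplane R)) (fun y => (f y * (m * (w y)^-1))%:E).
  apply/measurable_EFinP; apply: measurable_funM; last exact: invw_measurable.
  by apply: measurable_funTS; apply: cont_measurable; case: fp.
have ae : {ae leb2, forall y : mplane R, Y2 y -> ((w y)%:E)^-1%E \is a fin_num}.
  exact: (integrable_ae mY invw_integrable).
have ig : leb2.-integrable (Y2 : set (mplane R)) (fun y => ((K * m)%:E * ((w y)%:E)^-1)%E).
  exact: (integrableZl mY (K * m) invw_integrable).
have [||i1 _ i3] := dominated_convergence mY mh mf _ ig _.
- apply: filterS ae => y wy Yy; have := wy Yy; rewrite inver.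
  have [//|wy0 _] := eqVneq (w y) 0.
  apply: cvg_EFin; first by near=> n.
  apply: cvgM; first exact: ff.
  apply: cvgM; first exact: cvg_cst.
  apply: cvgV => //; rewrite /wreg -[X in _ --> X]addr0.
  by apply: cvgD; [exact: cvg_cst|exact: cvg_harmonic].
- apply: nearW => y n _; rewrite inver /h; have [wy|wy] := eqVneq (w y) 0.
    by rewrite gt0_muley ?leey // lte_fin mulr_gt0.
  rewrite -EFinM lee_fin normrM -mulrA; apply: ler_pM => //.
  rewrite ger0_norm ?mulr_ge0 ?invr_ge0 ?(ltW m0) ?(ltW (wreg_pos w0 n y)) //.
  rewrite ler_pM2l // lef_pV2 ?posrE ?wreg_pos // ?lerDl ?invr_ge0 //.
  by rewrite lt_neqAle eq_sym wy w0.
split; first exact: i1.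
have V : (\int[leb2]_(y in Y2) (f y * (m * (w y)^-1))%:E = (density_mean f)%:E)%E.
  by rewrite fineK //; exact: integrable_fin_num.
have H n : (\int[leb2]_(y in Y2) h n y = (m * mean2 (fun y => f_ n y / wreg w n y))%:E)%E.
  have q : C0sharp (fun y => f_ n y / wreg w n y) by apply: perM => //; exact: wregV_per.
  rewrite -(Rintegral_mean2 q) -RintegralZl //; last exact: (per_integrable leb2_Y2_fin q).
  rewrite (Rintegral_mean2 (perM (perC m) q)) -(integral_mean2 (perM (perC m) q)).
  by apply: eq_integral => y _; rewrite /h; congr (_%:E); ring.
move: i3; rewrite V; under eq_fun do rewrite H.
by move=> /fine_cvgP[].
Unshelve. all: by end_near. Qed.

End invariant_density.

(** * Realisation of the segment *)

Section mixture.
Context {R : realType} (u u1 u2 u11 u12 u22 : R * R -> R).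
Context (uC : C1 u u1 u2) (u1C : C1per u1 u11 u12) (u2C : C1per u2 u12 u22).
Context (gu0 : forall y, 0 < u1 y * u1 y + u2 y * u2 y).
Context (xi : R * R).
Context (u_shift : forall y k, u (y + intvec k) = u y + dot xi (intvec k)).
Context (xi_irr : forall k : int * int, k != 0 -> dot xi (intvec k) != 0).

Context (w w1 w2 : R * R -> R) (wC : C1per w w1 w2) (w0 : forall y, 0 <= w y).
Context (X : R -> R * R -> R * R) (X_flow : flow_of (weighted_field u1 u2 w) X).
Context (m : R) (m0 : 0 < m) (J : inv_integral w = (m^-1)%:E).


Let wp : C0sharp w. Proof. by have [] := wC. Qed.

Local Notation density_mean := (density_mean w m).
Local Notation nu_limit := (density_mean_limit wC w0 m0 J).

(** The densities [1 / (w + 1/n)] are invariant for the regularised flows, and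
    both the densities and the flows converge. *)
Lemma density_mean_flow f t : C0sharp f -> density_mean (fun y => f (X t y)) = density_mean f.
Proof.
move=> fp; have [L L0 XL] := weighted_lipschitz1 u1C u2C (ex_intro _ w1 (ex_intro _ w2 wC)).
have [K K0 fK] := per_bounded fp.
have fX : C0sharp (fun y => f (X t y)).
  exact: (per_comp_flow t L0 XL X_flow (weighted_periodic u1C u2C wp) fp).
pose F n := regular_flow u1 u2 w n.
have FP n := regular_flowP u1C u2C wC n : flow_of _ (F n).
have rC n := wreg_C1 wC n.
have fF n : C0sharp (fun y => f (F n t y)).
  have [Ln Ln0 FL] := weighted_lipschitz1 u1C u2C (ex_intro _ w1 (ex_intro _ w2 (rC n))).
  exact: (per_comp_flow t Ln0 FL (FP n) (weighted_periodic u1C u2C (wreg_per wp n)) fp).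
have cv y : f (F n t y) @[n --> \oo] --> f (X t y).
  apply/cvgrPdist_lt => e e0; have [d d0 dP] := per_ucont fp e0.
  have [N NP] := regular_flow_cvg u1C u2C wC X_flow t y d0.
  by exists N => // n /= Nn; apply: dP; rewrite dist1C; exact: NP.
have [_ l1] := nu_limit K0 fF fX (fun n y => fK _) cv.
have [_ l2] := nu_limit K0 (fun _ => fp) fp (fun n y => fK _) (fun y => cvg_cst _).
have E : (fun n => m * mean2 (fun y => f (F n t y) / wreg w n y)) =
    (fun n => m * mean2 (fun y => f y / wreg w n y)).
  apply/funext => n; congr (_ * _).
  by apply: (positive_invariant uC u1C u2C gu0 u_shift xi_irr t (rC n) _ (FP n) fp) => y; exact: wreg_pos.
rewrite E in l1; exact: (cvg_unique (@Rhausdorff R) l1 l2).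
Qed.

Lemma density_mean1 : density_mean (fun=> 1) = 1.
Proof.
have n1 : `|1 : R| <= 1 by rewrite normr1.
have [_ l1] := nu_limit ltr01 (fun _ => perC 1) (perC 1)
  (fun n y => n1) (fun y => cvg_cst _).
have l2 : m * mean2 (fun y => 1 / wreg w n y) @[n --> \oo] --> m * m^-1.
  apply: cvgM; first exact: cvg_cst.
  have -> : (fun n => mean2 (fun y => 1 / wreg w n y)) =
      (fun n => mean2 (fun y => (wreg w n y)^-1)).
    by apply/funext => n; congr mean2; apply/funext => y; rewrite div1r.
  by have := mean_wreg_cvg wp w0; rewrite J => /fine_cvgP[].
rewrite mulfV ?gt_eqF // in l2; exact: (cvg_unique (@Rhausdorff R) l1 l2).
Qed.

(** The weight cancels the density. *)
Lemma density_mean_weight F : C0sharp F -> density_mean (fun y => w y * F y) = m * mean2 F.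
Proof.
move=> Fp; have [K K0 FK] := per_bounded Fp; have [W W0 wW] := per_bounded wp.
have WK : 0 < (W + 1) * K by rewrite mulr_gt0 // addr_gt0.
have bnd n y : `|wreg w n y * F y| <= (W + 1) * K.
  rewrite normrM; apply: ler_pM => //; apply: le_trans (ler_normD _ _) _.
  apply: lerD => //; rewrite ger0_norm ?invr_ge0 ?ler0n //.
  by rewrite invf_le1 ?ltr0n // ler1n.
have cv y : wreg w n y * F y @[n --> \oo] --> w y * F y.
  apply: cvgM; last exact: cvg_cst.
  rewrite /wreg -[X in _ --> X]addr0.
  by apply: cvgD; [exact: cvg_cst|exact: cvg_harmonic].
have [_ l1] := nu_limit WK (fun n => perM (wreg_per wp n) Fp) (perM wp Fp) bnd cv.
have E : (fun n => m * mean2 (fun y => wreg w n y * F y / wreg w n y)) = (fun=> m * mean2 F).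
  apply/funext => n; congr (_ * mean2 _); apply/funext => y.
  by rewrite mulrAC mulfV ?mul1r // gt_eqF // wreg_pos.
rewrite E in l1; exact: (cvg_unique (@Rhausdorff R) l1 (cvg_cst _)).
Qed.

Lemma density_integrable (f : R * R -> R) : C0sharp f ->
  leb2.-integrable (Y2 : set (mplane R)) (fun y => (f y * (m * (w y)^-1))%:E).
Proof.
move=> fp; have [K K0 fK] := per_bounded fp.
by have [] := nu_limit K0 (fun _ => fp) fp (fun _ => fK) (fun y => cvg_cst _).
Qed.

Lemma density_meanD (f : R * R -> R) (K : R) : C0sharp f ->
  density_mean (fun y => f y + K) = density_mean f + K.
Proof.
move=> fp; have mY := @measurable_Y2 R.
rewrite -[in RHS](mulr1 K) -density_mean1 /density_mean.
rewrite -[in RHS]RintegralZl //; last exact: (density_integrable (perC 1)).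
rewrite -RintegralD //; first by apply: eq_Rintegral => y _; ring.
- exact: density_integrable.
- rewrite (_ : _ \o _ = fun y => (K * (m * (w y)^-1))%:E); first exact: density_integrable (perC K).
  by apply/funext => y; rewrite /= mul1r.
Qed.

Context (y0 : R * R) (y0Y : Y2 y0) (wy0 : w y0 = 0) (s : R) (s01 : 0 <= s <= 1).

Let g : mplane R -> R := (fun y : mplane R => m * (w y)^-1) \_ Y2.

Let g_ge0 y : 0 <= g y.
Proof.
by rewrite /g /patch; case: ifPn => // _; rewrite mulr_ge0 ?invr_ge0 ?(ltW m0).
Qed.

Let g_meas : measurable_fun setT g.
Proof.
exact: ((measurable_restrictT _ (@measurable_Y2 R)).1 (invw_measurable wC w0 m)).
Qed.

Let s_ge0 : 0 <= s. Proof. by case/andP: s01. Qed.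
Let s_le1 : 0 <= 1 - s. Proof. by rewrite subr_ge0; case/andP: s01. Qed.

(** The density is cut off outside the unit square, which carries the measures
    on the torus. *)
Definition mixture : {measure set (mplane R) -> \bar R} :=
  measure_add (mscale (NngNum s_le1) (dirac (y0 : mplane R)))
              (mscale (NngNum s_ge0) (density leb2 g_ge0 g_meas)).

Lemma mixture_ge0 (f : R * R -> R) : C0sharp f -> (forall y, 0 <= f y) ->
  (\int[mixture]_(y in Y2) (f y)%:E = ((1 - s) * f y0 + s * density_mean f)%:E)%E.
Proof.
move=> fp f0; have mY := @measurable_Y2 R.
have mf : measurable_fun (Y2 : set (mplane R)) (fun y => (f y)%:E).
  apply/measurable_EFinP; apply: measurable_funTS; apply: cont_measurable.
  by case: fp.
have f0' (y : mplane R) : Y2 y -> (0 <= (f y)%:E)%E by rewrite lee_fin.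
rewrite ge0_integral_measure_add // !ge0_integral_mscale //.
rewrite integral_dirac // diracE mem_set // mul1e.
rewrite ge0_integral_density //.
have -> : (\int[leb2]_(x in Y2) ((f x)%:E * (g x)%:E) = (density_mean f)%:E)%E.
  rewrite fineK; last exact: (integrable_fin_num _ (density_integrable fp)).
  by apply: eq_integral => y yY; rewrite /g /patch yY EFinM.
by rewrite /= -!EFinM -EFinD.
Qed.

Lemma mixture_Y2 : mixture Y2 = 1%E.
Proof.
have /= := mixture_ge0 (perC 1) (fun=> ler01).
rewrite density_mean1 !mulr1 subrK => <-.
by rewrite integral_cst ?mul1e //; exact: measurable_Y2.
Qed.

Lemma mixture_setT : mixture setT = 1%E.
Proof.
have mY := @measurable_Y2 R.
have nuT A : Y2 `<=` A -> density leb2 g_ge0 g_meas A = density leb2 g_ge0 g_meas Y2.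
  move=> YA; rewrite /density integral_mkcond [RHS]integral_mkcond.
  apply: eq_integral => y _; rewrite /patch; case: ifPn => yA; case: ifPn => yY //.
    by rewrite /g /patch (negbTE yY).
  by move: yA yY; rewrite notin_setE inE => yA /YA.
have E A : mixture A = ((1 - s)%:E * dirac (y0 : mplane R) A + s%:E * density leb2 g_ge0 g_meas A)%E.
  exact: measure_addE.
by rewrite -mixture_Y2 !E nuT // !diracE in_setT mem_set.
Qed.

(* Normalisation does not change a measure of total mass 1; the Dirac mass is
   only the fallback value of [mnormalize]. *)
Let mu : probability (mplane R) R := mnormalize mixture (dirac (y0 : mplane R)).

Let muE A : mu A = mixture A.
Proof.
rewrite /mu /= /mnormalize mixture_setT.
by rewrite ifF ?invr1 ?mule1 //; apply/negbTE; rewrite negb_or onee_eq0.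
Qed.

(* Adding the constant [K] reduces to nonnegative functions. *)
Let mu_integral (f : R * R -> R) : C0sharp f ->
  \int[mu]_(y in Y2) f y = (1 - s) * f y0 + s * density_mean f.
Proof.
move=> fp; have mY := @measurable_Y2 R; have [K K0 fK] := per_bounded fp.
have mu1 : mu Y2 = 1%E by rewrite muE mixture_Y2.
have fin : (mu (Y2 : set (mplane R)) < +oo)%E by rewrite [X in (X < _)%E]mu1 ltry.
have fKp : C0sharp (fun y => f y + K) := perD fp (perC K).
have f0 y : 0 <= f y + K by rewrite -lerBlDr sub0r; have := fK y; rewrite ler_norml => /andP[].
have I1 : \int[mu]_(y in Y2) (f y + K) = (1 - s) * (f y0 + K) + s * (density_mean f + K).
  rewrite /Rintegral (eq_measure_integral mixture) => [|A _ _]; last exact: muE.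
  by rewrite mixture_ge0 //= density_meanD.
have I2 : \int[mu]_(y in Y2) (f y + K) = \int[mu]_(y in Y2) f y + K.
  rewrite RintegralD ?Rintegral_cst //; [|exact: per_integrable fin fp|exact: per_integrable fin (perC K)].
  by rewrite [X in fine X]mu1 mulr1.
by apply: (addIr K); rewrite -I2 I1; ring.
Qed.

(** The zero [y0] of [w] is a fixed point, so the Dirac mass at [y0] is invariant
    and has zero rotation vector, and [s] weights the invariant density. *)
Lemma rotation_vector_mixture : exists mu : probability (mplane R) R,
  invariant_probability X mu /\
  vint mu (weighted_field u1 u2 w) = s *: (m *: leaf_drift u1 u2).
Proof.
have [L L0 XL] := weighted_lipschitz1 u1C u2C (ex_intro _ w1 (ex_intro _ w2 wC)).
have Xy0 t : X t y0 = y0.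
  have yd : trajectory (weighted_field u1 u2 w) (fun=> y0).
    by move=> r; rewrite /weighted_field wy0 !mul0r; split; exact: derC.
  by have := trajectory_unique (ltW L0) XL (flow_der X_flow y0) yd; apply; rewrite (flow0 X_flow).
exists mu; split.
  split=> [|t psi psip]; first by rewrite [LHS]muE mixture_Y2.
  have Xp : C0sharp (fun y => psi (X t y)).
    exact: (per_comp_flow t L0 XL X_flow (weighted_periodic u1C u2C wp) psip).
  by rewrite !mu_integral // density_mean_flow // Xy0.
have [u2p _ _ _] := u2C; have [/perN u1p _ _ _] := u1C.
rewrite /vint /weighted_field /= !mu_integral; try exact: perM.
by rewrite !density_mean_weight // wy0 !mul0r !mulr0 !add0r.
Qed.

End mixture.

(** * Periodic gradients *)

Section gradient.
Context {R : realType} (u u1 u2 : R * R -> R).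
Context (uC : C1 u u1 u2) (u1p : C0sharp u1) (u2p : C0sharp u2).

Let unit_shift (f : R * R -> R) a b : C0sharp f -> f (a + 1, b) = f (a, b) /\ f (a, b + 1) = f (a, b).
Proof.
move=> [p _]; split.
  by rewrite -(p (a, b) (1, 0)) intvec10.
by rewrite -(p (a, b) (0, 1)) intvec01.
Qed.

(** The increments of [u] along the two unit vectors; it is also the mean of the
    gradient. *)
Definition period_vector : R * R := (u (1, 0) - u (0, 0), u (0, 1) - u (0, 0)).

Lemma increment_h a b : u (a + 1, b) = u (a, b) + period_vector.1.
Proof.
have [_ _ d1 d2] := uC.
have eh : u (1, b) = u (0, b) + period_vector.1.
  have q s : is_derive s (1 : R) (fun b => u (0, b) + period_vector.1) (u2 (1, s)).
    rewrite -[X in u2 (X, s)]add0r (unit_shift 0 s u2p).1 -[u2 _]addr0.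
    exact: derD (d2 0 s) (derC _ s).
  by apply: (der_eq (d2 1) q); rewrite /= addrC subrK.
have p s : is_derive s (1 : R) (fun a => u (a + 1, b)) (u1 (s, b)).
  by rewrite -(unit_shift s b u1p).1; exact: derShift (d1 (s + 1) b).
have q s : is_derive s (1 : R) (fun a => u (a, b) + period_vector.1) (u1 (s, b)).
  by rewrite -[u1 _]addr0; exact: derD (d1 s b) (derC _ s).
by apply: (der_eq p q); rewrite add0r.
Qed.

Lemma increment_v a b : u (a, b + 1) = u (a, b) + period_vector.2.
Proof.
have [_ _ d1 d2] := uC.
have ev : u (a, 1) = u (a, 0) + period_vector.2.
  have q s : is_derive s (1 : R) (fun a => u (a, 0) + period_vector.2) (u1 (s, 1)).
    rewrite -[X in u1 (s, X)]add0r (unit_shift s 0 u1p).2 -[u1 _]addr0.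
    exact: derD (d1 s 0) (derC _ s).
  by apply: (der_eq (d1 ^~ 1) q); rewrite /= addrC subrK.
have p s : is_derive s (1 : R) (fun b => u (a, b + 1)) (u2 (a, s)).
  by rewrite -(unit_shift a s u2p).2; exact: derShift (d2 a (s + 1)).
have q s : is_derive s (1 : R) (fun b => u (a, b) + period_vector.2) (u2 (a, s)).
  by rewrite -[u2 _]addr0; exact: derD (d2 a s) (derC _ s).
by apply: (der_eq p q); rewrite add0r.
Qed.

(** A function with periodic gradient is the sum of a linear form and of a
    periodic function. *)
Lemma increment y k : u (y + intvec k) = u y + dot period_vector (intvec k).
Proof.
pose v y := u y - dot period_vector y.
have vp : Z2periodic v.
  apply: unit_periodic => a b; rewrite /v /dot.
    by rewrite increment_h /=; ring.
  by rewrite increment_v /=; ring.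
by have := vp y k; rewrite /v /dot /= => E; apply/eqP; rewrite -subr_eq0; apply/eqP; lra.
Qed.

Lemma mean2_gradient : (mean2 u1, mean2 u2) = period_vector.
Proof.
have [_ _ d1 d2] := uC; have [_ c1] := u1p; have [_ c2] := u2p.
have lin (c s : R) : is_derive s (1 : R) (fun s => c * s) c.
  by rewrite -[X in is_derive _ _ _ X]mulr1; exact: (derZ c (derI s)).
have h b : primH u1 (1, b) = period_vector.1.
  have e s : is_derive s (1 : R) (fun a => u (a, b) - u (0, b)) (u1 (s, b)).
    by rewrite -[u1 _]subr0; exact: (derB (d1 s b) (derC _ s)).
  rewrite /primH /= (prim_uniq (cont_slice_h c1) (subrr _) e).
  by rewrite -[X in u (X, b) - _ = _]add0r increment_h addrAC subrr add0r.
have v a : primV u2 (a, 1) = period_vector.2.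
  have e s : is_derive s (1 : R) (fun b => u (a, b) - u (a, 0)) (u2 (a, s)).
    by rewrite -[u2 _]subr0; exact: (derB (d2 a s) (derC _ s)).
  rewrite /primV /= (prim_uniq (cont_slice_v c2) (subrr _) e).
  by rewrite -[X in u (a, X) - _ = _]add0r increment_v addrAC subrr add0r.
have [_ _ _ p2] := prim2_C1 u1p; have [_ _ p1 _] := prim2_C1 u2p.
rewrite [RHS]surjective_pairing; congr pair.
  have e s : is_derive s (1 : R) (fun b => prim2 u1 (1, b)) period_vector.1.
    by rewrite -(h s); exact: p2.
  by have := der_eq e (lin _); rewrite /mean2 => ->; rewrite ?mulr1 // mulr0 prim2_0v.
have e s : is_derive s (1 : R) (fun a => prim2 u2 (a, 1)) period_vector.2.
  by rewrite -(v s); exact: p1.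
by have := der_eq e (lin _); rewrite /mean2 => ->; rewrite ?mulr1 // mulr0 prim2_0h.
Qed.

End gradient.

Unset Implicit Arguments.

Theorem corollary3p4 (R : realType)
    (b Phi : R * R -> R * R) (rho a u : R * R -> R)
    (X : R -> R * R -> R * R)
    (b_C1 : C1sharp b)
    (rho_C1 : C1sharp rho)
    (rho_ge0 : forall y : R * R, 0 <= rho y)
    (rho_neq0 : exists y : R * R, rho y != 0)
    (b_def : forall y : R * R, b y = rho y *: Phi y)
    (a_C1 : C1sharp a)
    (a_gt0 : forall y : R * R, 0 < a y)
    (u_diff : forall y : R * R, differentiable u y)
    (gradu_C1 : C1sharp (grad u))
    (gradu_neq0 : forall y : R * R, grad u y != 0)
    (Phi_def : forall y : R * R, Phi y = a y *: Rperp (grad u y))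
    (gradu_irr : forall k : int * int, k != 0 ->
       dot (vint leb2 (grad u)) (intvec k) != 0)
    (X_flow : is_flow b X) :
  let m := harmonic_mean_Y2 (fun y => a y * rho y) in
  let zeta := m *: vint leb2 (fun y => Rperp (grad u y)) in
  [/\ (forall y : R * R, 0 < rho y) ->
        forall x : R * R, t^-1 *: X t x @[t --> +oo] --> zeta,
      (exists y : R * R, rho y = 0) -> m = 0 ->
        forall x : R * R, t^-1 *: X t x @[t --> +oo] --> (0 : R * R) &
      (exists y : R * R, rho y = 0) -> 0 < m ->
        rotation_set b X = segment0 zeta /\ zeta != 0].
Proof.
move=> m zeta.
set u1 := fun y : R * R => 'D_((1, 0) : R * R) u y.
set u2 := fun y : R * R => 'D_((0, 1) : R * R) u y.
have [[u11 [u12 u1C]] [u21 [u22 u2C']]] := C1sharp_pair gradu_C1.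
rewrite -/u1 -/u2 in u1C u2C'.
have u1p : C0sharp u1 by case: u1C.
have u2p : C0sharp u2 by case: u2C'.
have uC : C1 u u1 u2.
  by apply: derivable_C1; [move=> y; exact: diff_derivable..|case: u1p|case: u2p].
have u2C : C1per u2 u12 u22.
  have [_ _ _ c1] := u1C; have [_ _ _ c2] := u2C'.
  by rewrite (funext (C1_schwarz uC c1 c2)).
have gu0 y : 0 < u1 y * u1 y + u2 y * u2 y.
  rewrite -!expr2 lt_neqAle eq_sym addr_ge0 ?sqr_ge0 // andbT.
  apply: contra (gradu_neq0 y); rewrite paddr_eq0 ?sqr_ge0 // !sqrf_eq0.
  by move=> /andP[/eqP e1 /eqP e2]; rewrite /grad -/(u1 y) -/(u2 y) e1 e2.
have xiE : vint leb2 (grad u) = period_vector u.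
  rewrite -(mean2_gradient uC u1p u2p).
  by rewrite /vint -(Rintegral_mean2 u1p) -(Rintegral_mean2 u2p).
rewrite xiE in gradu_irr.
have u_shift := increment uC u1p u2p.
set w := fun y => a y * rho y in m zeta *.
have wC := C1perM (C1sharp_C1per a_C1) (C1sharp_C1per rho_C1).
have wp : C0sharp w by case: wC.
have w0 y : 0 <= w y by rewrite mulr_ge0 // ltW.
have bE : b = weighted_field u1 u2 w.
  apply/funext => y; rewrite b_def Phi_def scalerA mulrC.
  by [].
have X_flow' : flow_of (weighted_field u1 u2 w) X.
  rewrite -bE => x; have [X0 Xd] := X_flow x.
  by split=> // t; exact: is_derive_pair (Xd t).
have driftE : vint leb2 (fun y => Rperp (grad u y)) = leaf_drift u1 u2.
  by rewrite /vint /leaf_drift -(Rintegral_mean2 u2p) -(Rintegral_mean2 (perN u1p)).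
rewrite /zeta driftE => {zeta}.
split=> [rho_pos x|_ m0 x|[y1 rho_y1] m0].
- apply: (positive_limit uC u1C u2C gu0 u_shift gradu_irr wp w0 X_flow') => y.
  exact: mulr_gt0.
- apply: (degenerate_limit uC u1C u2C gu0 u_shift gradu_irr wp w0 X_flow').
  exact: harmonic_mean_eq0.
split.
  rewrite bE; apply/seteqP; split=> [_ [mu mu_inv <-]|_ [s /= s01 <-]].
    have [s s01 ->] := rotation_vector_segment uC u1C u2C gu0 u_shift gradu_irr wp w0
      X_flow' mu_inv (ex_intro _ _ (ex_intro _ _ wC)) m0.
    by exists s => //=; rewrite in_itv.
  have [k yk] := to_Y2 y1; rewrite inE in yk.
  have wy : w (y1 + intvec k) = 0.
    by case: wp => wper _; have -> : w (y1 + intvec k) = w y1 := wper y1 k; rewrite /w rho_y1 mulr0.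
  rewrite in_itv in s01.
  have [mu [mu_inv E]] := rotation_vector_mixture uC u1C u2C gu0 u_shift gradu_irr wC w0
    X_flow' m0 (harmonic_mean_gt0 wp w0 m0) yk wy s01.
  by exists mu.
have e2 := gradu_irr (0, 1) isT.
have d1 : (leaf_drift u1 u2).1 != 0.
  move: e2; rewrite -(mean2_gradient uC u1p u2p) /dot /intvec /=.
  by rewrite mulr0 add0r mulr1.
apply: contra d1 => /eqP/(congr1 fst)/= /eqP.
by rewrite mulf_eq0 gt_eqF.
Qed.
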